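(* For every $m\ge 2$ the variety $X_{\mathrm{inv}}^{\mathrm{sym}}(m)\subset\mathbb{P}(V^{\mathrm{sym}})$ is Legendrian, and we have: (a) $X_{\mathrm{inv}}^{\mathrm{sym}}(2)$ is a linear subspace. (b) $X_{\mathrm{inv}}^{\mathrm{sym}}(3)$ is smooth and it is isomorphic to a hyperplane section of the Lagrangian Grassmannian $Gr_L(3,6)$. (c) $X_{\mathrm{inv}}^{\mathrm{sym}}(4)$ is smooth and it is the $9$-dimensional Grassmannian variety $Gr(3,6)$. (d) For $m\ge 5$, the variety $X_{\mathrm{inv}}^{\mathrm{sym}}(m)$ is singular.
   Context: For an integer $m\ge 2$, $V^{\mathrm{sym}}$ is the complex vector space of dimension $2\binom{m+1}{2}$ of pairs $(A,B)$ of symmetric complex $m\times m$ matrices; $[A,B]$ denotes the class of $(A,B)$ in $\mathbb{P}(V^{\mathrm{sym}})=(V^{\mathrm{sym}}\setminus\{0\})/\mathbb{C}^*$. It carries the symplectic form $\omega((A,B),(A',B'))=\operatorname{tr}(A(B')^T-A'B^T)$. $X_{\mathrm{inv}}^{\mathrm{sym}}(m)$ is the closure in $\mathbb{P}(V^{\mathrm{sym}})$ of $\{[A,A^{-1}] : A=A^T,\ \det A=1\}$. A subvariety $Z$ of a symplectic vector space is Lagrangian if at every smooth point its tangent space is a Lagrangian subspace (equal to its own $\omega$-perpendicular). A subvariety of the projectivisation is Legendrian if its affine cone is Lagrangian. $Gr_L(3,6)\subset\mathbb{P}^{13}$ is the Grassmannian of Lagrangian subspaces of the symplectic vector space $\mathbb{C}^6$,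 in its minimal homogeneous embedding; $Gr(3,6)\subset\mathbb{P}^{19}$ is the Grassmannian of $3$-dimensional subspaces of $\mathbb{C}^6$ in its Plücker embedding (considered up to projective equivalence). *)

(* Defs.v *)
From HB Require Import structures.
From mathcomp Require Import all_boot all_order all_algebra mpoly.
From mathcomp Require Import classical_sets reals.
From mathcomp Require Import complex.

Set Implicit Arguments.
Unset Strict Implicit.
Unset Printing Implicit Defensive.

Import GRing.Theory.
Local Open Scope ring_scope.
Local Open Scope classical_set_scope.

(** Classical algebraic geometry over an infinite field [K]: a (possibly
    reducible) subvariety of a vector space [V] is a Zariski closed subset of
    [V], a subvariety of P(V) is a Zariski closed subset of P(V). *)

Section AffineVarieties.
Variables (K : fieldType) (V : vectType K).

(** Coordinates are taken in the library's basis of [V]; the notions below do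
    not depend on this choice. *)
Definition polyfun (p : {mpoly K[\dim {:V}]}) (v : V) : K :=
  p.@[fun i => coord (vbasis {:V}) i v].

Definition dirderiv (p : {mpoly K[\dim {:V}]}) (v w : V) : K :=
  \sum_i polyfun p^`M(i) v * coord (vbasis {:V}) i w.

Definition zclosed (Z : set V) : Prop :=
  exists S : set {mpoly K[\dim {:V}]},
    Z = [set v | forall p, S p -> polyfun p v = 0].

Definition vanishing_ideal (Z : set V) : set {mpoly K[\dim {:V}]} :=
  [set p | forall v, Z v -> polyfun p v = 0].

Definition zirreducible (Z : set V) : Prop :=
  [/\ zclosed Z, Z !=set0 &
      forall A B, zclosed A -> zclosed B ->
        Z `<=` A `|` B -> Z `<=` A \/ Z `<=` B].

(** [n] algebraically independent elements of the coordinate ring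
    K[V]/I(W); for [W] irreducible, the largest such [n] is the transcendence
    degree of the function field of [W], i.e. the dimension of [W]. *)
Definition alg_indep_on (W : set V) (n : nat)
    (f : 'I_n -> {mpoly K[\dim {:V}]}) : Prop :=
  forall P : {mpoly K[n]},
    (forall v, W v -> P.@[fun i => polyfun (f i) v] = 0) -> P = 0.

Definition trdeg_ge (W : set V) (n : nat) : Prop :=
  exists f : 'I_n -> {mpoly K[\dim {:V}]}, alg_indep_on W f.

Definition max_trdeg (F : set (set V)) (d : nat) : Prop :=
  (exists W, [/\ F W, zirreducible W & trdeg_ge W d]) /\
  (forall W n, F W -> zirreducible W -> trdeg_ge W n -> (n <= d)%N).

Definition has_dim (Z : set V) (d : nat) : Prop :=
  max_trdeg [set W | W `<=` Z] d.

(** The largest dimension of an irreducible component of [Z] through [v]. *)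
Definition has_local_dim (Z : set V) (v : V) (d : nat) : Prop :=
  max_trdeg [set W | W `<=` Z /\ W v] d.

Definition tangent (Z : set V) (v : V) : set V :=
  [set w | forall p, vanishing_ideal Z p -> dirderiv p v w = 0].

Definition smooth_point (Z : set V) (v : V) : Prop :=
  Z v /\ exists T : {vspace V},
    [set` T] = tangent Z v /\ has_local_dim Z v (\dim T).

Definition perp (omega : V -> V -> K) (T : set V) : set V :=
  [set w | forall u, T u -> omega u w = 0].

Definition lagrangian (omega : V -> V -> K) (Z : set V) : Prop :=
  zclosed Z /\
  forall v, smooth_point Z v -> tangent Z v = perp omega (tangent Z v).

End AffineVarieties.

(** Points of P(V) are the lines of [V] through the origin; the vectors
    [v != 0] of the line are the homogeneous coordinates of the point. *)
Definition proj (K : fieldType) (V : vectType K) : Type :=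
  {x : {vspace V} | \dim x == 1%N}.

Section ProjectiveVarieties.
Variables (K : fieldType) (V : vectType K).

Definition homog_coord (x : proj V) (v : V) : Prop := v \in val x /\ v != 0.

Definition pclosed (X : set (proj V)) : Prop :=
  exists S : set {mpoly K[\dim {:V}]},
    (forall p, S p -> exists d, p \is d.-homog) /\
    X = [set x | forall p v, S p -> homog_coord x v -> polyfun p v = 0].

Definition pclosure (Y : set (proj V)) : set (proj V) :=
  \bigcap_(Z in [set Z | pclosed Z /\ Y `<=` Z]) Z.

Definition cone (X : set (proj V)) : set V :=
  [set v | v = 0 \/ exists2 x, X x & homog_coord x v].

Definition has_pdim (X : set (proj V)) (d : nat) : Prop :=
  has_dim (cone X) d.+1.

Definition legendrian (omega : V -> V -> K) (X : set (proj V)) : Prop :=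
  pclosed X /\ lagrangian omega (cone X).

(** [X] is smooth at [x] iff its affine cone is smooth at the nonzero vectors
    of the line [x]. *)
Definition psmooth_point (X : set (proj V)) (x : proj V) : Prop :=
  X x /\ forall v, homog_coord x v -> smooth_point (cone X) v.

Definition psmooth (X : set (proj V)) : Prop :=
  forall x, X x -> psmooth_point X x.

Definition psingular (X : set (proj V)) : Prop :=
  exists2 x, X x & ~ psmooth_point X x.

Definition psubspace (U : {vspace V}) : set (proj V) :=
  [set x | (val x <= U)%VS].

Definition linear_span (X : set (proj V)) (U : {vspace V}) : Prop :=
  X `<=` psubspace U /\
  forall U', X `<=` psubspace U' -> (U <= U')%VS.

(** [Y] is the section of [X], viewed in its linear span P(U), by a hyperplane
    P(H) of P(U), with its reduced structure. For the Lagrangian Grassmannian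
    the scheme-theoretic section is already reduced, the hyperplane class
    being a generator of the Picard group. *)
Definition hyperplane_section (X Y : set (proj V)) : Prop :=
  exists U H : {vspace V},
    [/\ linear_span X U, (H <= U)%VS, (\dim H).+1 = \dim U
      & Y = X `&` psubspace H].

End ProjectiveVarieties.

Section Morphisms.
Variables (K : fieldType) (V W : vectType K).

Definition polymap (F : 'I_(\dim {:W}) -> {mpoly K[\dim {:V}]}) (v : V) : W :=
  \sum_j polyfun (F j) v *: (vbasis {:W})`_j.

(** Around every point [x] of [X], on the open set X \ D, the map [f] is given
    by forms of the same degree without a common zero. *)
Definition regular_map (X : set (proj V)) (f : proj V -> proj W) : Prop :=
  forall x, X x -> exists (D : set (proj V)) (d : nat)
      (F : 'I_(\dim {:W}) -> {mpoly K[\dim {:V}]}),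
    [/\ pclosed D, ~ D x, (forall j, F j \is d.-homog)
      & forall y v, X y -> ~ D y -> homog_coord y v ->
          homog_coord (f y) (polymap F v)].

Definition proj_equivalent (X : set (proj V)) (Y : set (proj W)) : Prop :=
  exists phi : 'Hom(V, W),
    [/\ lker phi = 0%VS, limg phi = fullv
      & forall x y, val y = (phi @: val x)%VS -> (X x <-> Y y)].

End Morphisms.

Definition isomorphic (K : fieldType) (V W : vectType K)
    (X : set (proj V)) (Y : set (proj W)) : Prop :=
  exists (f : proj V -> proj W) (g : proj W -> proj V),
    [/\ regular_map X f, regular_map Y g,
        forall x, X x -> Y (f x) /\ g (f x) = x
      & forall y, Y y -> X (g y) /\ f (g y) = y].

(** Grassmannians in the Pluecker embedding. The coordinates on the exterior
    power ^k K^n are indexed by the increasing [k]-tuples of elements of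
    {0, ..., n-1}; the subspace of K^n spanned by the rows of [M] has as
    coordinates the maximal minors of [M]. *)
Section Grassmannians.
Variable K : fieldType.

Definition incr_tuple (k n : nat) : finType :=
  {t : k.-tuple 'I_n | sorted ltn (map val t)}.

Definition extpow (k n : nat) : vectType K := {ffun incr_tuple k n -> K^o}.

Definition plucker (k n : nat) (M : 'M[K]_(k, n)) : extpow k n :=
  [ffun t => \det (colsub (tnth (val t)) M)].

Definition Gr (k n : nat) : set (proj (extpow k n)) :=
  [set x | exists M : 'M[K]_(k, n),
     row_free M /\ homog_coord x (plucker M)].

Definition stdsymp (n : nat) : 'M[K]_(n + n) :=
  block_mx 0 1%:M (- 1%:M) 0.

Definition lagrangian_rows (n : nat) (M : 'M[K]_(n, n + n)) : Prop :=
  forall v : 'rV[K]_(n + n), (v <= M)%MS <-> M *m stdsymp n *m v^T = 0.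

(** The linear span of [GrL n] (a P^13 for n = 3) is the ambient space of the
    minimal homogeneous embedding. *)
Definition GrL (n : nat) : set (proj (extpow n (n + n))) :=
  [set x | exists M : 'M[K]_(n, n + n),
     [/\ row_free M, lagrangian_rows M & homog_coord x (plucker M)]].

End Grassmannians.

Arguments Gr K k n : clear implicits.
Arguments GrL K n : clear implicits.

Section SymmetricPairs.
Variables (K : fieldType) (m : nat).

Definition asym_part (u : 'M[K]_m * 'M[K]_m) : 'M[K]_m * 'M[K]_m :=
  (u.1 - u.1^T, u.2 - u.2^T).

Fact asym_part_is_linear : linear asym_part.
Proof.
move=> a [A B] [A' B']; rewrite /asym_part /=.
by congr pair; rewrite /= linearP /= scalerBr opprD addrACA.
Qed.

HB.instance Definition _ :=
  GRing.isLinear.Build K ('M[K]_m * 'M[K]_m)%type ('M[K]_m * 'M[K]_m)%type _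
    asym_part asym_part_is_linear.

Definition sympairs : {vspace 'M[K]_m * 'M[K]_m} := lker (linfun asym_part).

Fact mem_sympairs (u : 'M[K]_m * 'M[K]_m) :
  (u \in sympairs) = (u.1^T == u.1) && (u.2^T == u.2).
Proof.
rewrite memv_ker lfunE /= /asym_part xpair_eqE !subr_eq0.
by rewrite eq_sym [u.2 == _]eq_sym.
Qed.

Definition Vsym : vectType K := subvs_of sympairs.

Definition omega_sym (u u' : Vsym) : K :=
  let: (A, B) := vsval u in
  let: (A', B') := vsval u' in
  \tr (A *m B'^T - A' *m B^T).

Definition Xinv_sym : set (proj Vsym) :=
  pclosure [set x | exists2 u : Vsym, homog_coord x u &
    let: (A, B) := vsval u in \det A = 1 /\ B = invmx A].

End SymmetricPairs.

Arguments omega_sym K m : clear implicits.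
Arguments Xinv_sym K m : clear implicits.

(* Main.v *)
Require Import Defs.
From mathcomp Require Import all_boot all_order all_algebra.
From mathcomp Require Import classical_sets reals complex.
From HB Require Import structures.
From mathcomp Require Import mpoly boolp zify ring.

(** Let Z be the affine cone of X_inv(m) and N = m(m+1)/2, half the dimension of
    the space of symmetric pairs.

    Legendrian: at a point of the open orbit the velocities of the curves
    (g A g^T, g^-T B g^-1), with g = 1 + t x y^T and y^T x = 0, together with the
    point itself, span a Lagrangian space. Hence the Poisson bracket of two
    elements of the ideal of Z vanishes on the open orbit, so on Z, and all the
    tangent spaces of Z are coisotropic. Since det A is of degree one in A_00,
    the equation det A = 1 can be solved rationally for A_00; this makes Z the
    closure of the image of a polynomial map from an affine space of dimension N,
    hence irreducible of dimension N. At a smooth point the tangent space is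
    coisotropic of dimension N, that is, Lagrangian.

    For m >= 5 there are curves in Z through (E_00, 0) whose velocities there
    are not orthogonal, so that this point is singular. For m = 3, 4 every nonzero
    point is moved by the group into the chart A_00 <> 0 (or B_00 <> 0), where
    Jacobi's identity for complementary minors bounds the dimension of the tangent
    space by N. For m = 2 the inverse of A is linear in A, up to the determinant.

    A 3 x 6 matrix (P | Q) has the Pluecker coordinates det P, adj P Q, adj Q P,
    det Q. For m = 4 the isomorphism with Gr(3, 6) is the splitting
    /\^3(/\^2 C^4) = S^2 C^4 + S^2 C^4*; in the chart P = 1 it sends Q = N + [a]_x
    to the pair A = [1, a; a, adj N + a a^T], B = [det N + a N a, - N a; - N a, N].
    For m = 3 the pair (s A, s A^-1), with det A = 1, corresponds to the Lagrangian
    subspace with coordinates s, s A, s A^-1, s; the function s is regular as it is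
    the quotient of an entry of adj B by an entry of A, or conversely. *)

Set Implicit Arguments.
Unset Strict Implicit.
Unset Printing Implicit Defensive.

Import Order.TTheory GRing.Theory Num.Theory.
Local Open Scope classical_set_scope.
Local Open Scope ring_scope.

(** * Polynomial functions *)

(** The ideal of Z is never determined, although tangent spaces and smoothness refer to all of it.
    Coisotropy bounds every tangent space from below by N, so that a few equations, not known to
    generate the ideal, suffice for smoothness. Density is used algebraically: a polynomial that
    vanishes wherever another nonzero polynomial does not is zero. Singular matrices, the apex of
    the cone and limits with s = 0 are reached in this way along one-parameter polynomial families,
    for instance M + t. The bound m <= 4 comes from weights. A curve diag(t^alpha_i) through (E_00,
    0) with velocity (E_11, 0) has weights 0 and 1 at two indices, all others at most 2f - 2, and
    mean f; this takes at least five indices. For m = 3 the function s is a thirteenth coordinate: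
    the hyperplane section lies in a P^12, while the pairs form a P^11. Hence the isomorphism is
    given by quadratic forms in one direction, by a linear projection in the other, and is not a
    projective equivalence. *)

Section FunctionAlgebras.
Variables (K : fieldType) (X : Type).
Implicit Types (P : (X -> K) -> Prop).

(** One closure principle serves the polynomials in a parameter ([upoly]) and the polynomial
    functions on a vector space ([pfun]): products, determinants and adjugates of matrices are
    treated once, for an arbitrary algebra of functions. *)
Record falg P : Prop := Falg {
  falgC : forall c, P (fun=> c);
  falgD : forall f g, P f -> P g -> P (fun x => f x + g x);
  falgM : forall f g, P f -> P g -> P (fun x => f x * g x) }.

Variables (P : (X -> K) -> Prop) (HP : falg P).

Lemma falgN f : P f -> P (fun x => - f x).
Proof.
move=> Pf; have := falgM HP (falgC HP (-1)) Pf.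
by congr P; apply/funext => x; rewrite mulN1r.
Qed.

Lemma falgB f g : P f -> P g -> P (fun x => f x - g x).
Proof. by move=> Pf Pg; apply: falgD => //; apply: falgN. Qed.

Lemma falg_sum I (r : seq I) (F : I -> X -> K) (Q : pred I) :
  (forall i, P (F i)) -> P (fun x => \sum_(i <- r | Q i) F i x).
Proof.
move=> PF; elim: r => [|i r IH].
  by have := falgC HP 0; congr P; apply/funext => x; rewrite big_nil.
case Qi: (Q i).
  have := falgD HP (PF i) IH.
  by congr P; apply/funext => x; rewrite big_cons Qi.
by move: IH; congr P; apply/funext => x; rewrite big_cons Qi.
Qed.

Lemma falg_prod I (r : seq I) (F : I -> X -> K) (Q : pred I) :
  (forall i, P (F i)) -> P (fun x => \prod_(i <- r | Q i) F i x).
Proof.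
move=> PF; elim: r => [|i r IH].
  by have := falgC HP 1; congr P; apply/funext => x; rewrite big_nil.
case Qi: (Q i).
  have := falgM HP (PF i) IH.
  by congr P; apply/funext => x; rewrite big_cons Qi.
by move: IH; congr P; apply/funext => x; rewrite big_cons Qi.
Qed.

Lemma falgX f n : P f -> P (fun x => f x ^+ n).
Proof.
move=> Pf; have := falg_prod (index_enum 'I_n) xpredT (fun=> Pf).
by congr P; apply/funext => x; rewrite prodr_const card_ord.
Qed.

Lemma falg_meval n (p : {mpoly K[n]}) (g : X -> 'I_n -> K) :
  (forall i, P (fun x => g x i)) -> P (fun x => p.@[g x]).
Proof.
move=> Pg.
have -> : (fun x => p.@[g x]) =
  (fun x => \sum_(m <- msupp p) p@_m * \prod_i g x i ^+ m i).
  by apply/funext => x; rewrite mevalE.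
apply: falg_sum => m; apply: falgM => //; first exact: falgC.
by apply: falg_prod => i; apply: falgX.
Qed.

Definition mxfun m n (M : X -> 'M[K]_(m, n)) := forall i j, P (fun x => M x i j).

Lemma mxfunC m n (M : 'M[K]_(m, n)) : mxfun (fun=> M).
Proof. by move=> i j; apply: falgC. Qed.

Lemma mxfunD m n (M N : X -> 'M[K]_(m, n)) :
  mxfun M -> mxfun N -> mxfun (fun x => M x + N x).
Proof.
move=> PM PN i j; have := falgD HP (PM i j) (PN i j).
by congr P; apply/funext => x; rewrite mxE.
Qed.

Lemma mxfunZ m n a (M : X -> 'M[K]_(m, n)) :
  P a -> mxfun M -> mxfun (fun x => a x *: M x).
Proof.
move=> Pa PM i j; have := falgM HP Pa (PM i j).
by congr P; apply/funext => x; rewrite mxE.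
Qed.

Lemma mxfunN m n (M : X -> 'M[K]_(m, n)) :
  mxfun M -> mxfun (fun x => - M x).
Proof.
move=> PM i j; have := falgN (PM i j).
by congr P; apply/funext => x; rewrite mxE.
Qed.

Lemma mxfun_tr m n (M : X -> 'M[K]_(m, n)) :
  mxfun M -> mxfun (fun x => (M x)^T).
Proof.
move=> PM i j; have := PM j i.
by congr P; apply/funext => x; rewrite mxE.
Qed.

Lemma mxfunM m n p (M : X -> 'M[K]_(m, n)) (N : X -> 'M[K]_(n, p)) :
  mxfun M -> mxfun N -> mxfun (fun x => M x *m N x).
Proof.
move=> PM PN i j.
have -> : (fun x => (M x *m N x) i j) = (fun x => \sum_k M x i k * N x k j).
  by apply/funext => x; rewrite mxE.
by apply: falg_sum => k; apply: falgM.
Qed.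

Lemma falg_det m (M : X -> 'M[K]_m) : mxfun M -> P (fun x => \det (M x)).
Proof.
move=> PM; apply: falg_sum => s; apply: falgM => //; first exact: falgC.
by apply: falg_prod => i; apply: PM.
Qed.

Lemma falg_cofactor m (M : X -> 'M[K]_m) i j :
  mxfun M -> P (fun x => cofactor (M x) i j).
Proof.
move=> PM; apply: falgM => //; first exact: falgC.
apply: falg_det => k l; have := PM (lift i k) (lift j l).
by congr P; apply/funext => x; rewrite !mxE.
Qed.

Lemma mxfun_adj m (M : X -> 'M[K]_m) : mxfun M -> mxfun (fun x => \adj (M x)).
Proof.
move=> PM i j; have := falg_cofactor j i PM.
by congr P; apply/funext => x; rewrite mxE.
Qed.

End FunctionAlgebras.

Section PolynomialFunctions.
Variables (K : fieldType).

Definition upoly (h : K -> K) := exists q : {poly K}, forall t, q.[t] = h t.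

Lemma upolyP : falg upoly.
Proof.
split=> [c | f g [p Hp] [q Hq] | f g [p Hp] [q Hq]].
- by exists c%:P => t; rewrite hornerC.
- by exists (p + q) => t; rewrite hornerD Hp Hq.
- by exists (p * q) => t; rewrite hornerM Hp Hq.
Qed.

Lemma upoly_id : upoly id.
Proof. by exists 'X => t; rewrite hornerX. Qed.

Definition pfun (V : vectType K) (h : V -> K) :=
  exists p, forall v, polyfun p v = h v.

Lemma pfunP V : falg (@pfun V).
Proof.
split=> [c | f g [p Hp] [q Hq] | f g [p Hp] [q Hq]].
- by exists c%:MP => t; rewrite /polyfun mevalC.
- by exists (p + q) => t; rewrite -Hp -Hq /polyfun mevalD.
- by exists (p * q) => t; rewrite -Hp -Hq /polyfun mevalM.
Qed.

Definition linform (V : vectType K) (l : V -> K) :=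
  forall a u v, l (a *: u + v) = a * l u + l v.

Lemma linform_sum (V : vectType K) (l : V -> K) : linform l ->
  forall n (a : 'I_n -> K) (e : 'I_n -> V),
    l (\sum_i a i *: e i) = \sum_i a i * l (e i).
Proof.
move=> Hl n a e.
have l0 : l 0 = 0.
  by have := Hl (-1) 0 0; rewrite scaler0 addr0 mulN1r addNr.
have lD u v : l (u + v) = l u + l v by have := Hl 1 u v; rewrite scale1r mul1r.
have lZ b u : l (b *: u) = b * l u by have := Hl b u 0; rewrite l0 !addr0.
rewrite (big_morph l lD l0); apply: eq_bigr => i _; exact: lZ.
Qed.

Lemma linform_coord (V : vectType K) (l : V -> K) : linform l ->
  forall v, l v = \sum_(i < \dim {:V}) coord (vbasis {:V}) i v * l (vbasis {:V})`_i.
Proof.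
move=> Hl v; rewrite {1}(coord_vbasis (memvf v)).
exact: linform_sum.
Qed.

(** Degrees are recorded here because [regular_map] asks for forms of one common degree, which
    [falg] cannot see. *)
Definition hfun (V : vectType K) d (h : V -> K) :=
  exists2 p, p \is d.-homog & forall v, polyfun p v = h v.

Lemma hfun_pfun (V : vectType K) d (h : V -> K) : hfun d h -> pfun h.
Proof. by case=> p _ Hp; exists p. Qed.

Lemma hfun_linform (V : vectType K) (l : V -> K) : linform l -> hfun 1 l.
Proof.
move=> Hl; exists (\sum_(i < \dim {:V}) l (vbasis {:V})`_i *: 'X_i).
  by apply: rpred_sum => i _; apply: dhomogZ; rewrite dhomogX; apply/eqP/mdeg1.
move=> v; rewrite (linform_coord Hl) /polyfun raddf_sum /=.
by apply: eq_bigr => i _; rewrite mevalZ mevalXU mulrC.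
Qed.

Lemma hfunM (V : vectType K) d e (f g : V -> K) :
  hfun d f -> hfun e g -> hfun (d + e) (fun v => f v * g v).
Proof.
case=> p hp Hp [q hq Hq]; exists (p * q); first exact: dhomogM.
by move=> v; rewrite /polyfun mevalM -Hp -Hq.
Qed.

Lemma hfunD (V : vectType K) d (f g : V -> K) :
  hfun d f -> hfun d g -> hfun d (fun v => f v + g v).
Proof.
case=> p hp Hp [q hq Hq]; exists (p + q); first exact: dhomogD.
by move=> v; rewrite /polyfun mevalD -Hp -Hq.
Qed.

Lemma hfunN (V : vectType K) d (f : V -> K) :
  hfun d f -> hfun d (fun v => - f v).
Proof.
case=> p hp Hp; exists (- p); first by rewrite dhomogN.
by move=> v; rewrite /polyfun mevalN -Hp.
Qed.

Lemma hfun0 (V : vectType K) d : hfun d (fun _ : V => 0).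
Proof. by exists 0; [exact: dhomog0 | move=> v; rewrite /polyfun meval0]. Qed.

Lemma pfun_linform (V : vectType K) (l : V -> K) : linform l -> pfun l.
Proof. by move/hfun_linform/hfun_pfun. Qed.

Lemma linform_vcoord (V : vectType K) i :
  linform (fun v : V => coord (vbasis {:V}) i v).
Proof. by move=> a u v; rewrite linearP. Qed.

Lemma falg_pfun X (P : (X -> K) -> Prop) (HP : falg P) (V : vectType K)
    (h : V -> K) (F : X -> V) :
  pfun h -> (forall i, P (fun x => coord (vbasis {:V}) i (F x))) ->
  P (fun x => h (F x)).
Proof.
case=> p Hp HF; have -> : (fun x => h (F x)) = (fun x => polyfun p (F x)).
  by apply/funext => x; rewrite Hp.
exact: falg_meval.
Qed.

Lemma coord_surj (V : vectType K) (x : 'I_(\dim {:V}) -> K) :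
  exists v : V, forall i, coord (vbasis {:V}) i v = x i.
Proof.
exists (\sum_(i < \dim {:V}) x i *: (vbasis {:V})`_i) => i.
rewrite coord_sum_free //; exact: basis_free (vbasisP _).
Qed.

End PolynomialFunctions.

Section Calculus.
Variables (K : numFieldType).

(** The product [q * r] vanishes everywhere, hence at more integers than its size allows; integers
    are distinct in characteristic 0. This is the limit argument of the whole development: [r] cuts
    out the degenerate parameters. *)
Lemma poly_zero_outside (q r : {poly K}) : r != 0 ->
  (forall t, r.[t] != 0 -> q.[t] = 0) -> q = 0.
Proof.
move=> r0 H; apply/eqP; apply: contraT => q0.
have qr0 : q * r != 0 by rewrite mulf_neq0.
pose s := [seq (i%:R : K) | i <- iota 0 (size (q * r))].
have us : uniq s by rewrite map_inj_uniq ?iota_uniq //; exact: (mulrIn (oner_neq0 K)).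
have rs : all (root (q * r)) s.
  apply/allP => t _; rewrite rootE hornerM.
  by have [->|/H ->] := eqVneq r.[t] 0; rewrite ?mulr0 ?mul0r.
by have := max_poly_roots qr0 rs us; rewrite size_map size_iota ltnn.
Qed.

Lemma poly_zero (q : {poly K}) : (forall t, q.[t] = 0) -> q = 0.
Proof. by move=> H; apply: (@poly_zero_outside _ 1); rewrite ?oner_neq0. Qed.

Lemma poly_horner_inj (p q : {poly K}) : (forall t, p.[t] = q.[t]) -> p = q.
Proof.
move=> H; apply/eqP; rewrite -subr_eq0; apply/eqP/poly_zero => t.
by rewrite hornerD hornerN H subrr.
Qed.

Definition polycomp n (g : 'I_n -> {poly K}) (p : {mpoly K[n]}) : {poly K} :=
  mmap polyC g p.

Lemma polycomp_horner n (g : 'I_n -> {poly K}) p t :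
  (polycomp g p).[t] = p.@[fun i => (g i).[t]].
Proof.
rewrite /polycomp /mmap mevalE horner_sum.
apply: eq_bigr => m _; rewrite hornerM hornerC; congr (_ * _).
rewrite /mmap1 horner_prod; apply: eq_bigr => i _; exact: horner_exp.
Qed.


Lemma polycomp_ring n (g : 'I_n -> {poly K}) :
  [/\ forall c, polycomp g c%:MP = c%:P, forall i, polycomp g 'X_i = g i,
      forall p q, polycomp g (p + q) = polycomp g p + polycomp g q
    & forall p q, polycomp g (p * q) = polycomp g p * polycomp g q].
Proof.
rewrite /polycomp; split=> *; rewrite ?mmapC ?raddfD ?rmorphM //=.
by rewrite mmapX mmap1U.
Qed.

Lemma mpoly_ring_ind n (P : {mpoly K[n]} -> Prop) :
  (forall c, P c%:MP) -> (forall i, P 'X_i) ->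
  (forall p q, P p -> P q -> P (p + q)) ->
  (forall p q, P p -> P q -> P (p * q)) -> forall p, P p.
Proof.
move=> PC PX PD PM p; rewrite [p]mpolyE.
elim/big_ind: _ => [| |m _] //; first exact: PC 0.
rewrite -mul_mpolyC; apply: (PM) => //; rewrite mpolyXE_id.
elim/big_ind: _ => [| |i _] //; first exact: PC 1.
by elim: (m i) => [|k IH]; rewrite ?expr0 ?exprS; [exact: PC 1 | exact: PM].
Qed.

Lemma polycomp_deriv n (g : 'I_n -> {poly K}) p :
  (polycomp g p)^`() = \sum_i polycomp g p^`M(i) * (g i)^`().
Proof.
have [gC gX gD gM] := polycomp_ring g.
elim/mpoly_ring_ind: p => [c | j | p q IHp IHq | p q IHp IHq].
- rewrite gC derivC big1 // => i _; rewrite mderivC.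
  by rewrite -[0]/(0%:MP) gC mul0r.
- rewrite gX (bigD1 j) //= big1 ?addr0 => [|i ij];
    rewrite mderivX mnm1E ?eqxx.
    by rewrite -{1}(add0m U_(j)%MM) addmK mpolyX0 scale1r -[1]/(1%:MP) gC mul1r.
  by rewrite eq_sym (negPf ij) scale0r -[0]/(0%:MP) gC mul0r.
- rewrite gD derivD IHp IHq -big_split /=; apply: eq_bigr => i _.
  by rewrite mderivD gD mulrDl.
- rewrite gM derivM IHp IHq mulr_suml mulr_sumr -big_split /=.
  apply: eq_bigr => i _; rewrite mderivM gD !gM mulrDl.
  by rewrite mulrAC mulrA.
Qed.

Lemma meval_line_deriv n (p : {mpoly K[n]}) (x y : 'I_n -> K) (q : {poly K}) :
  (forall t, q.[t] = p.@[fun i => x i + t * y i]) ->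
  \sum_i p^`M(i).@[x] * y i = q^`().[0].
Proof.
move=> Hq; pose g i := (x i)%:P + y i *: 'X.
have -> : q = polycomp g p.
  apply: poly_horner_inj => t; rewrite Hq polycomp_horner.
  by apply: meval_eq => i; rewrite /g !hornerE mulrC.
rewrite polycomp_deriv horner_sum; apply: eq_bigr => i _; rewrite hornerM.
have -> : ((g i)^`()).[0] = y i by rewrite /g !derivE !hornerE.
rewrite polycomp_horner; congr (_ * _).
by apply: meval_eq => j; rewrite /g !hornerE.
Qed.

Lemma mnm_neq0 n (m : 'X_{1..n}) : m != 0%MM -> exists i, m i != 0%N.
Proof.
move=> m0; apply/existsP; rewrite -negb_forall; apply: contra m0 => /forallP H.
by apply/eqP/mnmP => i; rewrite mnm0E; apply/eqP; have := H i.
Qed.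

Lemma meval_at0 n (p : {mpoly K[n]}) : p.@[fun=> 0] = p@_0%MM.
Proof.
rewrite [in LHS](mpolyE p) raddf_sum /= [in RHS](mpolyE p) raddf_sum /=.
apply: eq_bigr => m _; rewrite mevalZ mcoeffZ mevalX mcoeffX; congr (_ * _).
have [->|m0] := eqVneq m 0%MM.
  by rewrite big1 // => i _; rewrite mnm0E expr0.
have [i mi] := mnm_neq0 m0.
by rewrite (bigD1 i) //= expr0n (negPf mi) mul0r.
Qed.

(** Induction on the degree of the monomial: the derivative in a variable that divides it vanishes
    as a function too, and has there the wanted coefficient times a positive integer, nonzero in
    [K]. *)
Lemma mpoly_fun_eq0 n (p : {mpoly K[n]}) : (forall x, p.@[x] = 0) -> p = 0.
Proof.
move=> p0; apply/mpolyP => m; rewrite mcoeff0.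
have [k] := ubnP (mdeg m); elim: k => // k IH in m p p0 *.
have [-> _ | ] := eqVneq m 0%MM; first by rewrite -meval_at0.
move=> /mnm_neq0[i mi] lt_mk.
have Um : (U_(i) <= m)%MM.
  by apply/mnm_lepP => j; rewrite mnm1E; case: eqP => // <-; rewrite lt0n.
have dm : (mdeg (m - U_(i))%MM < k)%N.
  move: lt_mk; rewrite -{1}(submK Um) mdegD mdeg1 addn1; lia.
have p'0 x : p^`M(i).@[x] = 0.
  have : \sum_j p^`M(j).@[x] * (j == i)%:R = 0.
    rewrite (@meval_line_deriv _ _ _ _ 0) ?deriv0 ?horner0 // => t.
    by rewrite horner0 p0.
  rewrite (bigD1 i) //= eqxx mulr1 big1 ?addr0 // => j /negPf->.
  by rewrite mulr0.
have /eqP := IH _ _ p'0 dm; rewrite mcoeff_mderiv submK //.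
by rewrite mulrn_eq0 /= => /eqP.
Qed.

End Calculus.

(** * Algebraic dependence by linear algebra *)

Section AlgebraicDependence.
Variable K : fieldType.

Lemma kernel_row (I J : finType) (c : I -> J -> K) : (#|J| < #|I|)%N ->
  exists x : I -> K, (exists i, x i != 0) /\ forall j, \sum_i x i * c i j = 0.
Proof.
move=> lt; pose M := \matrix_(i < #|I|, j < #|J|) c (enum_val i) (enum_val j).
have : ~~ row_free M.
  rewrite /row_free neq_ltn; apply/orP; left.
  exact: leq_ltn_trans (rank_leq_col _) lt.
rewrite -kermx_eq0 => /rowV0Pn[v /sub_kermxP vM v0].
have [k vk] : exists k, v 0 k != 0.
  apply/existsP; rewrite -negb_forall; apply: contra v0 => /forallP H.
  by apply/eqP/rowP => k; rewrite mxE; apply/eqP; have := H k.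
exists (fun i => v 0 (enum_rank i)); split.
  by exists (enum_val k); rewrite enum_valK.
move=> j; have /rowP/(_ (enum_rank j)) := vM; rewrite !mxE => H.
rewrite -[RHS]H (reindex_onto enum_val enum_rank) /=; last by move=> i _; rewrite enum_rankK.
apply: eq_big => [k'|k' _]; first by rewrite enum_valK eqxx.
by rewrite mxE enum_valK enum_rankK.
Qed.

Lemma msizeM_pred n (p q : {mpoly K[n]}) :
  (msize (p * q) <= (msize p + msize q).-1)%N.
Proof.
have [->|p0] := eqVneq p 0; first by rewrite mul0r msize0.
have [->|q0] := eqVneq q 0; first by rewrite mulr0 msize0.
by rewrite msizeM.
Qed.

Lemma msize_exp n (p : {mpoly K[n]}) d k : (msize p <= d.+1)%N ->
  (msize (p ^+ k) <= (d * k).+1)%N.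
Proof.
move=> hp; elim: k => [|k IH]; first by rewrite expr0 muln0 msize1.
rewrite exprS; apply: leq_trans (msizeM_pred _ _) _.
by rewrite mulnS; lia.
Qed.

(* Counting: the [D ^ n] monomials of degree [< D] in the [g i] lie in the space
   of polynomials of degree at most [n * d * D], of dimension at most
   [(D * (n * d + 1)) ^ N]; for [n > N] this is too small for large [D]. *)
Lemma algebraic_dependence N n (g : 'I_n -> {mpoly K[N]}) : (N < n)%N ->
  exists2 P : {mpoly K[n]}, P != 0 & forall x, P.@[fun i => (g i).@[x]] = 0.
Proof.
move=> ltNn.
pose d := \max_i msize (g i).
have hd i : (msize (g i) <= d.+1)%N by apply: leqW; apply: (leq_bigmax i).
have [D hD] : exists D, ((n * d).+1 ^ N < D)%N by exists ((n * d).+1 ^ N).+1.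
have D0 : (0 < D)%N := leq_ltn_trans (leq0n _) hD.
pose E := (n * (d * D))%N.
pose mon (a : {ffun 'I_n -> 'I_D}) : 'X_{1..n} := [multinom (a i : nat) | i < n].
pose mon' (a : {ffun 'I_N -> 'I_E.+1}) : 'X_{1..N} := [multinom (a i : nat) | i < N].
pose gm a := \prod_i g i ^+ mon a i.
have gm_size a : (msize (gm a) <= E.+1)%N.
  have H (s : seq 'I_n) : (msize (\prod_(i <- s) g i ^+ mon a i) <= (size s * (d * D)).+1)%N.
    elim: s => [|i s IH]; first by rewrite big_nil msize1.
    rewrite big_cons; apply: leq_trans (msizeM_pred _ _) _ => /=.
    have H1 := msize_exp (mon a i) (hd i).
    have H2 : (d * mon a i <= d * D)%N by rewrite leq_mul2l mnmE ltnW ?orbT // ltn_ord.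
    rewrite mulSn; move: IH H1 H2; move: (d * mon a i)%N (size s * _)%N => x y.
    by move: (d * D)%N (mmeasure _ _) (mmeasure _ _) => z t u; clear; lia.
  by have := H (enum 'I_n); rewrite big_enum size_enum_ord.
have lt_card : (#|{ffun 'I_N -> 'I_E.+1}| < #|{ffun 'I_n -> 'I_D}|)%N.
  rewrite !card_ffun !card_ord.
  apply: (@leq_trans (D ^ N.+1)); last exact: leq_pexp2l.
  rewrite expnS; apply: (@leq_ltn_trans ((n * d).+1 ^ N * D ^ N)).
    rewrite -expnMn; case: (N) => [//|N']; rewrite leq_exp2r //; rewrite /E; lia.
  by rewrite ltn_pmul2r ?expn_gt0 ?D0.
have [x [[a0 xa0] Hx]] := kernel_row (fun a b => (gm a)@_(mon' b)) lt_card.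
exists (\sum_a x a *: 'X_[mon a]).
  apply/eqP => /mpolyP/(_ (mon a0)); rewrite mcoeff0 raddf_sum /=.
  rewrite (bigD1 a0) //= mcoeffZ mcoeffX eqxx mulr1 big1 ?addr0.
    by move=> H; rewrite H eqxx in xa0.
  move=> a aa0; rewrite mcoeffZ mcoeffX; case: eqP => [e|_]; last by rewrite mulr0.
  case/eqP: aa0; apply/ffunP => i; apply/val_inj.
  by have /mnmP/(_ i) := e; rewrite !mnmE.
move=> y; rewrite raddf_sum /=.
have -> : \sum_a (x a *: 'X_[mon a]).@[fun i => (g i).@[y]] = (\sum_a x a *: gm a).@[y].
  rewrite raddf_sum /=; apply: eq_bigr => a _; rewrite !mevalZ; congr (_ * _).
  rewrite mevalX rmorph_prod /=; apply: eq_bigr => i _; by rewrite rmorphXn.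
suff -> : \sum_a x a *: gm a = 0 by rewrite meval0.
apply/mpolyP => m; rewrite mcoeff0 raddf_sum /=.
have [lt_m | lt_m] := leqP (mdeg m) E.
  have lt_mi i : (m i < E.+1)%N.
    by rewrite ltnS; apply: leq_trans lt_m; rewrite mdegE (bigD1 i) //= leq_addr.
  rewrite -[RHS](Hx [ffun i => Ordinal (lt_mi i)]).
  apply: eq_bigr => a _; rewrite mcoeffZ; congr (_ * _@__).
  by apply/mnmP => i; rewrite mnmE ffunE.
rewrite big1 // => a _; rewrite mcoeffZ memN_msupp_eq0 ?mulr0 //.
by apply: mmeasure_mnm_ge; apply: leq_trans (gm_size a) _.
Qed.

End AlgebraicDependence.

(** * Cones over projective sets, polynomial curves *)

Section Lines.
Variables (K : fieldType) (V : vectType K).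

Lemma line_proof (v : V) : v != 0 -> \dim <[v]>%VS == 1%N.
Proof. by rewrite dim_vline => ->. Qed.

Definition line (v : V) (v0 : v != 0) : proj V := exist _ <[v]>%VS (line_proof v0).

Lemma homog_coord_line (v : V) (v0 : v != 0) : homog_coord (line v0) v.
Proof. by split=> //=; exact: memv_line. Qed.

Lemma homog_coordE (x : proj V) v : homog_coord x v -> val x = <[v]>%VS.
Proof.
case: x => U /= dU [/= vU v0]; apply/eqP; rewrite eq_sym.
by rewrite -(dimv_leqif_eq (_ : <[v]> <= U)%VS) ?dim_vline ?v0 ?(eqP dU) // -memvE.
Qed.

Lemma homog_coordP (x : proj V) u v : homog_coord x u ->
  homog_coord x v <-> exists2 a, a != 0 & v = a *: u.
Proof.
move=> xu; have := homog_coordE xu; case: xu => _ u0 ex.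
rewrite /homog_coord ex; split=> [[/vlineP[a ->]]|[a a0 ->]].
  by rewrite scaler_eq0 negb_or => /andP[a0 _]; exists a.
by rewrite memvZ ?memv_line // scaler_eq0 negb_or a0.
Qed.

Lemma homog_coord_inj (x y : proj V) v : homog_coord x v -> homog_coord y v -> x = y.
Proof. by move=> /homog_coordE xv /homog_coordE yv; apply: val_inj; rewrite xv yv. Qed.

Lemma homog_coordZ (x : proj V) a v : a != 0 ->
  homog_coord x (a *: v) <-> homog_coord x v.
Proof.
move=> a0; split=> [xv | xv]; last by apply/(homog_coordP _ xv); exists a.
by apply/(homog_coordP _ xv); exists a^-1; rewrite ?invr_neq0 // scalerK.
Qed.

Lemma homog_coord_ex (x : proj V) : exists v, homog_coord x v.
Proof.
case: x => U dU; exists (vpick U); split=> /=; first exact: memv_pick.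
by rewrite vpick0 -dimv_eq0 (eqP dU).
Qed.

Lemma coneZ (X : set (proj V)) a v : cone X v -> cone X (a *: v).
Proof.
case=> [-> | [x Xx xv]]; first by left; rewrite scaler0.
have [->|a0] := eqVneq a 0; first by left; rewrite scale0r.
right; exists x; first exact: Xx.
by apply/(homog_coordZ _ _ a0).
Qed.

Lemma coordZ (a : K) (v : V) i :
  coord (vbasis {:V}) i (a *: v) = a * coord (vbasis {:V}) i v.
Proof. by rewrite linearZ. Qed.

Lemma polyfunZ d (p : {mpoly K[\dim {:V}]}) a v : p \is d.-homog ->
  polyfun p (a *: v) = a ^+ d * polyfun p v.
Proof.
move=> /dhomogP hp; rewrite /polyfun !mevalE mulr_sumr big_seq [RHS]big_seq.
apply: eq_bigr => m /hp <-; rewrite mulrCA; congr (_ * _).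
under eq_bigr do rewrite coordZ exprMn.
by rewrite big_split /= mdegE -expr_sum.
Qed.

(* Take a subspace of maximal dimension among those contained in [S]. *)
Lemma subset_vspace (S : set V) : S 0 ->
  (forall a u v, S u -> S v -> S (a *: u + v)) ->
  exists U : {vspace V}, [set` U] = S.
Proof.
move=> S0 SD.
pose Q n := `[< exists U : {vspace V}, \dim U = n /\ forall u, u \in U -> S u >].
have Q0 : exists n, Q n.
  by exists 0%N; apply/asboolP; exists 0%VS; rewrite dimv0;
    split=> // u; rewrite memv0 => /eqP ->.
have Qb n : Q n -> (n <= \dim {:V})%N.
  by move=> /asboolP[U [<- _]]; rewrite dimvS // subvf.
case: (ex_maxnP Q0 Qb) => n /asboolP[U [dU US]] nmax.
exists U; apply/seteqP; split=> u /=; first exact: US.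
move=> Su; apply: contraT => nUu; suff : Q n.+1 by move/nmax; rewrite ltnn.
apply/asboolP; exists (U + <[u]>)%VS; split.
  rewrite dimv_disjoint_sum ?dU ?dim_vline.
    by rewrite (contraNneq _ nUu) ?addn1 // => ->; exact: mem0v.
  apply/eqP; rewrite -subv0; apply/subvP => w; rewrite memv_cap => /andP[wU].
  case/vlineP => a wE; move: wU; rewrite wE; have [->|a0] := eqVneq a 0.
    by move=> _; rewrite scale0r mem0v.
  by move=> /(@memvZ _ _ _ a^-1); rewrite scalerK // (negPf nUu).
move=> w /memv_addP[u1 u1U [u2 /vlineP[a ->] ->]].
by rewrite addrC; apply: SD => //; exact: US.
Qed.

End Lines.

Section Cones.
Variables (K : numFieldType) (V : vectType K).
Local Notation n := (\dim {:V}).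

(** On the line through [v], [p] restricts to a polynomial in the scaling factor whose coefficients
    are the values of its homogeneous components at [v]; it vanishes identically. The bound [k] is
    larger than [d] and than every degree in [p]. *)
Lemma pihomog_vanish (C : set V) : (forall a v, C v -> C (a *: v)) ->
  forall p d, vanishing_ideal C p -> vanishing_ideal C (pihomog mdeg d p).
Proof.
move=> CZ p d Ip v Cv; pose k := (msize p + d.+1)%N.
pose q : {poly K} := \poly_(e < k) polyfun (pihomog mdeg e p) v.
suff q0 : q = 0.
  have : q`_d = 0 by rewrite q0 coef0.
  by rewrite coef_poly ifT // /k addnS ltnS leq_addl.
apply: poly_zero => t; rewrite horner_poly -[RHS](Ip (t *: v)); last exact: CZ.
rewrite {2}(@pihomog_partitionE _ _ mdeg k p) ?leq_addr //.
rewrite /polyfun raddf_sum /=; apply: eq_bigr => i _.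
by rewrite -[RHS]/(polyfun _ (t *: v)) (polyfunZ _ _ (pihomogP _ _ _)) mulrC.
Qed.

(** Single forms are enough to test the closure, since the zero locus of one form is already
    closed. *)
Lemma pclosureP (Y : set (proj V)) x : pclosure Y x <->
  forall p d, p \is d.-homog ->
    (forall y v, Y y -> homog_coord y v -> polyfun p v = 0) ->
    forall v, homog_coord x v -> polyfun p v = 0.
Proof.
split=> [clx p d hp pY v xv | H Z [[S [hS ->]] YS]] /=.
  have := clx [set x | forall q u, q = p -> homog_coord x u -> polyfun q u = 0].
  apply=> //; split; last by move=> y Yy q u -> yu; exact: pY yu.
  exists [set q | q = p]; split; first by move=> q ->; exists d.
  by apply/seteqP; split=> z H q u /=; exact: H.
move=> p v Sp xv; have [d hp] := hS p Sp; apply: (H p d) => // y u Yy yu.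
exact: (YS y Yy p u).
Qed.

Lemma pclosed_pclosure (Y : set (proj V)) : pclosed (pclosure Y).
Proof.
exists [set p | (exists d, p \is d.-homog) /\
  forall y v, Y y -> homog_coord y v -> polyfun p v = 0]; split.
  by move=> p [].
apply/seteqP; split=> x.
  by move/pclosureP => H p v [[d hp] pY] xv; exact: (H p d hp).
by move=> H; apply/pclosureP => p d hp pY v; apply: H; split=> //; exists d.
Qed.

(** This trades the projective closure for the Zariski closure of a cone in the vector space, where
    arbitrary polynomials may be used; the passage back to forms is the homogeneity of the ideal of
    [C]. *)
Lemma cone_pclosure (Y : set (proj V)) (C : set V) v0 :
  v0 != 0 -> C v0 -> (forall a v, C v -> C (a *: v)) ->
  (forall v, v != 0 -> C v <-> exists2 x, Y x & homog_coord x v) ->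
  forall v, cone (pclosure Y) v <->
    forall p, vanishing_ideal C p -> polyfun p v = 0.
Proof.
move=> v0n0 Cv0 CZ CY v; have C0 : C 0 by rewrite -(scale0r v0); exact: CZ.
split=> [[-> p Ip | [x /pclosureP clx xv] p Ip] | H]; first exact: Ip.
  rewrite (@pihomog_partitionE _ _ mdeg _ p (leqnn _)) /polyfun raddf_sum big1 //=.
  move=> i _; apply: (clx _ i (pihomogP _ _ _)) xv => y u Yy yu.
  have Ii := @pihomog_vanish C CZ p i Ip; apply: (Ii u); apply/CY; first by case: yu.
  by exists y.
have [->|vn0] := eqVneq v 0; [by left | right].
exists (line vn0); last exact: homog_coord_line.
apply/pclosureP => p d hp pY u /(homog_coordP _ (homog_coord_line vn0))[a _ ->].
rewrite (polyfunZ _ _ hp) H ?mulr0 // => w Cw.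
(* Only a form of degree 0 could be nonzero at the origin; as it vanishes at [v0], scaling [v0] to
   the origin excludes this. *)
have [w0|w0] := eqVneq w 0; last first.
  by have /CY[//|x Yx xw] := Cw; exact: pY xw.
rewrite w0 -(scale0r v0) (polyfunZ _ _ hp).
by have /CY[//|x Yx xv0] := Cv0; rewrite (pY _ _ Yx xv0) mulr0.
Qed.


Lemma zclosed_vanishing (Z : set V) :
  (forall v, Z v <-> forall p, vanishing_ideal Z p -> polyfun p v = 0) ->
  zclosed Z.
Proof.
move=> HZ; exists (vanishing_ideal Z).
by apply/seteqP; split=> v /HZ.
Qed.

End Cones.

(** * First-order expansions along polynomial curves *)

Section Jets.
Variables (K : numFieldType).

Definition jet (h : K -> K) (a b : K) :=
  exists q : {poly K}, [/\ forall t, q.[t] = h t, q.[0] = a & q^`().[0] = b].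

Lemma jet_ext h h' a b : jet h a b -> (forall t, h t = h' t) -> jet h' a b.
Proof. by case=> q [Hq q0 q1] E; exists q; split=> // t; rewrite Hq E. Qed.

Lemma jetC c : jet (fun=> c) c 0.
Proof. by exists c%:P; split=> *; rewrite ?derivC hornerC. Qed.

Lemma jet_id : jet id 0 1.
Proof. by exists 'X; split=> *; rewrite ?derivX ?hornerC ?hornerX. Qed.

Lemma jetD f g a b c d :
  jet f a b -> jet g c d -> jet (fun t => f t + g t) (a + c) (b + d).
Proof.
move=> [p [Hp p0 p1]] [q [Hq q0 q1]]; exists (p + q).
by rewrite derivD !hornerD p0 p1 q0 q1; split=> // t; rewrite hornerD Hp Hq.
Qed.

Lemma jetM f g a b c d :
  jet f a b -> jet g c d -> jet (fun t => f t * g t) (a * c) (b * c + a * d).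
Proof.
move=> [p [Hp p0 p1]] [q [Hq q0 q1]]; exists (p * q).
by rewrite derivM hornerD !hornerM p0 p1 q0 q1; split=> // t; rewrite hornerM Hp Hq.
Qed.

Lemma jet_sum I (r : seq I) (f : I -> K -> K) a b :
  (forall i, jet (f i) (a i) (b i)) ->
  jet (fun t => \sum_(i <- r) f i t) (\sum_(i <- r) a i) (\sum_(i <- r) b i).
Proof.
move=> H; elim: r => [|i r IH].
  by rewrite !big_nil; apply: (jet_ext (jetC 0)) => t; rewrite big_nil.
rewrite !big_cons; apply: (jet_ext (jetD (H i) IH)) => t.
by rewrite big_cons.
Qed.

Lemma jetZ f a b c : jet f a b -> jet (fun t => c * f t) (c * a) (c * b).
Proof. by move=> /(jetM (jetC c)); rewrite mul0r add0r. Qed.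

Lemma jet_uniq h a b a' b' : jet h a b -> jet h a' b' -> a = a' /\ b = b'.
Proof.
move=> [p [Hp <- <-]] [q [Hq <- <-]].
by rewrite (@poly_horner_inj _ p q) // => t; rewrite Hp Hq.
Qed.

Lemma jetX f a b n : jet f a b -> jet (fun t => f t ^+ n) (a ^+ n) (b * a ^+ n.-1 *+ n).
Proof.
move=> [p [Hp p0 p1]]; exists (p ^+ n).
rewrite deriv_exp hornerMn hornerM !horner_exp p0 p1.
by split=> // t; rewrite horner_exp Hp.
Qed.

Variable (V : vectType K).

Definition curve_jet (c : K -> V) (v w : V) :=
  forall i, jet (fun t => coord (vbasis {:V}) i (c t))
    (coord (vbasis {:V}) i v) (coord (vbasis {:V}) i w).

Lemma polyfun_curve p c v w : curve_jet c v w ->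
  jet (fun t => polyfun p (c t)) (polyfun p v) (dirderiv p v w).
Proof.
move=> H; have [g Hg] := choice H.
exists (polycomp g p); split.
- move=> t; rewrite polycomp_horner; apply: meval_eq => i.
  by case: (Hg i) => E _ _; exact: E.
- by rewrite polycomp_horner; apply: meval_eq => i; case: (Hg i).
- rewrite polycomp_deriv horner_sum; apply: eq_bigr => i _.
  rewrite hornerM polycomp_horner; case: (Hg i) => _ _ ->; congr (_ * _).
  by apply: meval_eq => j; case: (Hg j).
Qed.

Lemma curve_jet_line v w : curve_jet (fun t => v + t *: w) v w.
Proof.
move=> i; have := jetD (jetC (coord (vbasis {:V}) i v))
  (jetM jet_id (jetC (coord (vbasis {:V}) i w))).
rewrite mul0r !addr0 mul1r mulr0 addr0 add0r; move/jet_ext; apply=> t.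
by rewrite linearD linearZ.
Qed.

(** The tool for upper bounds on tangent spaces: each equation [h] of [Z] is differentiated along
    the line [v + t w], which need not lie in [Z]. *)
Lemma tangent_jet (Z : set V) h a b v w : tangent Z v w -> pfun h ->
  (forall u, Z u -> h u = 0) -> jet (fun t => h (v + t *: w)) a b -> b = 0.
Proof.
move=> Tw [p Hp] Zh Hj.
have Ip : vanishing_ideal Z p by move=> u Zu; rewrite Hp Zh.
have := polyfun_curve p (curve_jet_line v w); rewrite (Tw _ Ip).
by move/(fun H => jet_ext H (fun t => Hp _))/(jet_uniq Hj) => [].
Qed.

(** The tool for lower bounds: a curve that lies in [Z] for generic [t] has its limit point in the
    closure of [Z] and its velocity in the tangent space there. *)
Lemma curve_vanish (Z : set V) (r : {poly K}) c v w : curve_jet c v w -> r != 0 ->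
  (forall t, r.[t] != 0 -> Z (c t)) ->
  forall p, vanishing_ideal Z p -> polyfun p v = 0 /\ dirderiv p v w = 0.
Proof.
move=> Hc r0 Zc p Ip; have [q [Hq <- <-]] := polyfun_curve p Hc.
suff -> : q = 0 by rewrite deriv0 !horner0.
by apply: (poly_zero_outside r0) => t /Zc/Ip; rewrite Hq.
Qed.

End Jets.

(** * The affine cone of X_inv *)

Section SymmetricPairs.
Variables (K : numClosedFieldType) (m : nat).
Local Notation V := (Vsym K m).

Definition vA (v : V) : 'M[K]_m := (vsval v).1.
Definition vB (v : V) : 'M[K]_m := (vsval v).2.
Definition mkV (A B : 'M[K]_m) : V := vsproj (sympairs K m) (A, B).

Lemma vA_sym v : (vA v)^T = vA v.
Proof. by have := subvsP v; rewrite mem_sympairs => /andP[/eqP]. Qed.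

Lemma vB_sym v : (vB v)^T = vB v.
Proof. by have := subvsP v; rewrite mem_sympairs => /andP[_ /eqP]. Qed.

Lemma vAC v i j : vA v i j = vA v j i.
Proof. by rewrite -{1}vA_sym mxE. Qed.

Lemma vBC v i j : vB v i j = vB v j i.
Proof. by rewrite -{1}vB_sym mxE. Qed.

Lemma mkVK A B : A^T = A -> B^T = B -> vsval (mkV A B) = (A, B).
Proof. by move=> sA sB; rewrite vsprojK // mem_sympairs /= sA sB !eqxx. Qed.

Lemma vA_mk A B : A^T = A -> B^T = B -> vA (mkV A B) = A.
Proof. by move=> sA sB; rewrite /vA mkVK. Qed.

Lemma vB_mk A B : A^T = A -> B^T = B -> vB (mkV A B) = B.
Proof. by move=> sA sB; rewrite /vB mkVK. Qed.

Lemma Vsym_eq u v : vA u = vA v -> vB u = vB v -> u = v.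
Proof.
rewrite /vA /vB => eA eB; apply: val_inj => /=.
by apply/eqP; rewrite [vsval u]surjective_pairing [vsval v]surjective_pairing eA eB.
Qed.

Lemma mkV_eta v : mkV (vA v) (vB v) = v.
Proof. by rewrite /mkV -surjective_pairing vsvalK. Qed.

Lemma vAD u v : vA (u + v) = vA u + vA v.
Proof. by rewrite /vA linearD. Qed.
Lemma vBD u v : vB (u + v) = vB u + vB v.
Proof. by rewrite /vB linearD. Qed.
Lemma vAZ a v : vA (a *: v) = a *: vA v.
Proof. by rewrite /vA linearZ. Qed.
Lemma vBZ a v : vB (a *: v) = a *: vB v.
Proof. by rewrite /vB linearZ. Qed.
Lemma vA0 : vA 0 = 0.
Proof. by rewrite /vA linear0. Qed.
Lemma vB0 : vB 0 = 0.
Proof. by rewrite /vB linear0. Qed.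

Lemma linform_vA i j : linform (fun v => vA v i j).
Proof. by move=> a u v; rewrite vAD vAZ !mxE. Qed.

Lemma linform_vB i j : linform (fun v => vB v i j).
Proof. by move=> a u v; rewrite vBD vBZ !mxE. Qed.

Lemma omega_symE u v :
  omega_sym K m u v = \tr (vA u *m vB v) - \tr (vA v *m vB u).
Proof.
rewrite /omega_sym -(vB_sym u) -(vB_sym v) /vA /vB.
by case: (vsval u) => A B; case: (vsval v) => A' B'; rewrite raddfB /=.
Qed.

Lemma linform_Vsym (l : V -> K) : linform l ->
  exists a b : 'I_m -> 'I_m -> K, forall v,
    l v = \sum_i \sum_j vA v i j * a i j + \sum_i \sum_j vB v i j * b i j.
Proof.
move=> Hl.
exists (fun i j => l (mkV (delta_mx i j) 0)), (fun i j => l (mkV 0 (delta_mx i j))).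
move=> v.
have l0 : l 0 = 0 by have := Hl (-1) 0 0; rewrite scaler0 addr0 mulN1r addNr.
have lD x y : l (x + y) = l x + l y by have := Hl 1 x y; rewrite scale1r mul1r.
have lZ b x : l (b *: x) = b * l x by have := Hl b x 0; rewrite l0 !addr0.
(* The matrix units are not symmetric, so [mkV] merely projects them to the symmetric pairs in an
   unspecified way. This projection is linear and fixes symmetric pairs, so the decomposition of [v]
   survives it. *)
have dec : v = \sum_i \sum_j vA v i j *: mkV (delta_mx i j) 0
     + \sum_i \sum_j vB v i j *: mkV 0 (delta_mx i j).
  pose f (u : 'M[K]_m * 'M[K]_m) : V := vsproj (sympairs K m) u.
  pose inA (A : 'M[K]_m) := mkV A 0; pose inB (B : 'M[K]_m) := mkV 0 B.
  have linA : linear inA.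
    move=> a A B; rewrite /inA /mkV -linearP; congr vsproj.
    by congr pair; rewrite /= scaler0 addr0.
  have linB : linear inB.
    move=> a A B; rewrite /inB /mkV -linearP; congr vsproj.
    by congr pair; rewrite /= scaler0 addr0.
  pose LA : {linear 'M[K]_m -> V} := HB.pack inA (GRing.isLinear.Build _ _ _ _ inA linA).
  pose LB : {linear 'M[K]_m -> V} := HB.pack inB (GRing.isLinear.Build _ _ _ _ inB linB).
  transitivity (LA (vA v) + LB (vB v)).
    rewrite /= /inA /inB /mkV -linearD -{1}(mkV_eta v); congr vsproj.
    by congr pair; rewrite /= ?addr0 ?add0r.
  rewrite [in LA _](matrix_sum_delta (vA v)) [in LB _](matrix_sum_delta (vB v)).
  rewrite !linear_sum; congr (_ + _); apply: eq_bigr => i _;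
    rewrite linear_sum; apply: eq_bigr => j _; by rewrite linearZ.
rewrite {1}dec lD !(big_morph l lD l0); congr (_ + _); apply: eq_bigr => i _;
  rewrite (big_morph l lD l0); apply: eq_bigr => j _; exact: lZ.
Qed.

Lemma falg_Vsym X (P : (X -> K) -> Prop) (F : X -> V) : falg P ->
  mxfun P (fun x => vA (F x)) -> mxfun P (fun x => vB (F x)) ->
  forall l, linform l -> P (fun x => l (F x)).
Proof.
move=> HP PA PB l /linform_Vsym[a [b Hl]].
have -> : (fun x => l (F x)) = fun x => \sum_i \sum_j vA (F x) i j * a i j
    + \sum_i \sum_j vB (F x) i j * b i j by apply/funext => x.
apply: (falgD HP); apply: (falg_sum HP) => i; apply: (falg_sum HP) => j;
  apply: (falgM HP) => //; exact: falgC.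
Qed.

Lemma falg_pfun_Vsym X (P : (X -> K) -> Prop) (F : X -> V) h : falg P ->
  mxfun P (fun x => vA (F x)) -> mxfun P (fun x => vB (F x)) ->
  pfun h -> P (fun x => h (F x)).
Proof.
move=> HP PA PB ph; apply: (falg_pfun HP ph) => i.
exact: falg_Vsym PA PB _ (linform_vcoord i).
Qed.

Lemma curve_jet_Vsym (c : K -> V) (v w : V) :
  (forall i j, jet (fun t => vA (c t) i j) (vA v i j) (vA w i j)) ->
  (forall i j, jet (fun t => vB (c t) i j) (vB v i j) (vB w i j)) ->
  curve_jet c v w.
Proof.
move=> HA HB k; have [a [b Hl]] := linform_Vsym (linform_vcoord (V := V) k).
rewrite !Hl; apply: (jet_ext (h := fun t => \sum_i \sum_j vA (c t) i j * a i j
    + \sum_i \sum_j vB (c t) i j * b i j)) => [|t]; last by rewrite Hl.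
apply: jetD; apply: jet_sum => i; apply: jet_sum => j.
  have := jetZ (a i j) (HA i j); rewrite !(mulrC (a i j)).
  by move/jet_ext; apply=> t; rewrite mulrC.
have := jetZ (b i j) (HB i j); rewrite !(mulrC (b i j)).
by move/jet_ext; apply=> t; rewrite mulrC.
Qed.

Lemma pfun_vA : mxfun (@pfun K V) vA.
Proof. by move=> i j; apply: pfun_linform; exact: linform_vA. Qed.

Lemma pfun_vB : mxfun (@pfun K V) vB.
Proof. by move=> i j; apply: pfun_linform; exact: linform_vB. Qed.

(* The affine cone over the open orbit, with the origin. *)
Definition INVc : set V := [set v | exists s A B,
  [/\ A^T = A, \det A = 1, A *m B = 1%:M, vA v = s *: A & vB v = s *: B]].

Lemma inv_sym (A B : 'M[K]_m) : A^T = A -> A *m B = 1%:M -> B^T = B.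
Proof.
move=> sA AB; have := congr1 trmx AB; rewrite trmx_mul sA trmx1 => BA.
by rewrite -[LHS]mulmx1 -AB mulmxA BA mul1mx.
Qed.

Lemma INVc_mk s A B : A^T = A -> \det A = 1 -> A *m B = 1%:M ->
  INVc (mkV (s *: A) (s *: B)).
Proof.
move=> sA dA AB; have sB := inv_sym sA AB.
by exists s, A, B; rewrite vA_mk ?vB_mk ?linearZ /= ?sA ?sB.
Qed.

Lemma INVcZ a v : INVc v -> INVc (a *: v).
Proof.
move=> [s [A [B [sA dA AB eA eB]]]]; exists (a * s), A, B.
by rewrite vAZ vBZ eA eB !scalerA.
Qed.

Hypothesis m0 : (0 < m)%N.

Lemma INVc_proj v : v != 0 -> INVc v <->
  exists2 x, (exists2 u : V, homog_coord x u &
    let: (A, B) := vsval u in \det A = 1 /\ B = invmx A) & homog_coord x v.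
Proof.
move=> v0; split=> [[s [A [B [sA dA AB eA eB]]]]|[x [u xu Hu] xv]].
  have sB := inv_sym sA AB; have s0 : s != 0.
    apply: contraNneq v0 => s0; apply/eqP/Vsym_eq.
      by rewrite eA s0 scale0r vA0.
    by rewrite eB s0 scale0r vB0.
  exists (line v0); last exact: homog_coord_line.
  exists (mkV A B).
    apply/(homog_coordZ _ _ s0); suff -> : s *: mkV A B = v by exact: homog_coord_line.
    by apply: Vsym_eq; rewrite ?vAZ ?vBZ ?vA_mk ?vB_mk.
  rewrite mkVK //; split=> //.
  have uA : A \in unitmx by rewrite unitmxE dA unitr1.
  by rewrite -[invmx A]mulmx1 -AB mulKmx.
have [a a0 ->] := (homog_coordP _ xu).1 xv; apply: INVcZ.
have : vsval u = (vA u, vB u) by rewrite -surjective_pairing.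
move: Hu => /[swap] ->; case=> dA eB.
exists 1, (vA u), (vB u); rewrite vA_sym !scale1r; split=> //.
by rewrite eB mulmxV // unitmxE dA unitr1.
Qed.

Lemma INVc1 : INVc (mkV 1%:M 1%:M).
Proof.
by rewrite -(scale1r (1%:M)); apply: INVc_mk; rewrite ?trmx1 ?det1 ?mul1mx.
Qed.

Lemma mkV11_neq0 : mkV 1%:M 1%:M != 0.
Proof.
apply/eqP => /(congr1 vA); rewrite vA0 vA_mk ?trmx1 // => /matrixP.
move=> /(_ (Ordinal m0) (Ordinal m0)); rewrite !mxE eqxx.
by move/eqP; rewrite oner_eq0.
Qed.

Definition Zinv : set V := cone (Xinv_sym K m).

Lemma ZinvP v : Zinv v <-> forall p, vanishing_ideal INVc p -> polyfun p v = 0.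
Proof.
exact: cone_pclosure mkV11_neq0 INVc1 INVcZ INVc_proj v.
Qed.

Lemma INVc_Zinv v : INVc v -> Zinv v.
Proof. by move=> Cv; apply/ZinvP => p; apply. Qed.

Lemma ZinvI : vanishing_ideal Zinv = vanishing_ideal INVc.
Proof.
apply/seteqP; split=> p Ip v; first by move/INVc_Zinv; exact: Ip.
by move/ZinvP; apply.
Qed.

Lemma Zinv_pfun h v : pfun h -> (forall u, INVc u -> h u = 0) -> Zinv v -> h v = 0.
Proof. by move=> [p Hp] H /ZinvP Zv; rewrite -Hp Zv // => u Cu; rewrite Hp H. Qed.

Lemma Zinv_curve (r : {poly K}) c v w : curve_jet c v w -> r != 0 ->
  (forall t, r.[t] != 0 -> Zinv (c t)) -> Zinv v /\ tangent Zinv v w.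
Proof.
move=> Hc r0 Zc; split; first apply/ZinvP => p.
  by rewrite -ZinvI => Ip; have [] := curve_vanish Hc r0 Zc Ip.
by move=> p Ip; have [] := curve_vanish Hc r0 Zc Ip.
Qed.

Lemma zclosed_Zinv : zclosed Zinv.
Proof. by apply: zclosed_vanishing => v; rewrite ZinvI; exact: ZinvP. Qed.

Lemma ZinvZ a v : Zinv v -> Zinv (a *: v).
Proof. exact: coneZ. Qed.

End SymmetricPairs.

(** * Tangent vectors along unipotent orbits *)

Section Matrices.
Variable K : comNzRingType.

(** Sylvester's identity: one block matrix is factored into triangular ones by eliminating either of
    its diagonal blocks. *)
Lemma det_1addM m n (X : 'M[K]_(m, n)) (Y : 'M[K]_(n, m)) :
  \det (1%:M + X *m Y) = \det (1%:M + Y *m X).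
Proof.
have E1 : block_mx 1%:M (- Y) X 1%:M =
    block_mx 1%:M 0 X 1%:M *m block_mx 1%:M (- Y) 0 (1%:M + X *m Y).
  rewrite mulmx_block !(mul1mx, mulmx1, mul0mx, mulmx0, addr0, add0r) mulmxN.
  by rewrite addrCA addNr addr0.
have E2 : block_mx 1%:M (- Y) X 1%:M =
    block_mx (1%:M + Y *m X) (- Y) 0 1%:M *m block_mx 1%:M 0 X 1%:M.
  rewrite mulmx_block !(mul1mx, mulmx1, mul0mx, mulmx0, addr0, add0r) mulNmx.
  by rewrite addrK.
have := congr1 determinant E1; rewrite E2 !det_mulmx !(det_ublock, det_lblock) !det1.
by rewrite !mul1r !mulr1.
Qed.

(** Two distinct basis vectors kill an off-diagonal entry; the orthogonal vectors [e_i + e_j] and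
    [e_i - e_j] then equate two diagonal entries. *)
Lemma scalar_of_isotropic m (Q : 'M[K]_m) :
  (forall x y : 'cV[K]_m, y^T *m x = 0 -> y^T *m Q *m x = 0) ->
  forall i j, Q i j = (i == j)%:R * Q i i /\ Q i i = Q j j.
Proof.
move=> H i j.
have e k l (P : 'M[K]_m) : (delta_mx k 0 : 'cV_m)^T *m P *m (delta_mx l 0 : 'cV_m) = (P k l)%:M.
  rewrite trmx_delta -rowE -colE; apply/matrixP => a b.
  by rewrite !ord1 !mxE mulr1n.
have e1 k l : (delta_mx k 0 : 'cV[K]_m)^T *m (delta_mx l 0 : 'cV_m) = ((k == l)%:R)%:M.
  by have := e k l 1%:M; rewrite mulmx1 mxE.
have off k l : k != l -> Q k l = 0.
  move=> kl; have := H (delta_mx l 0) (delta_mx k 0).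
  rewrite e e1 (negPf kl) raddf0; move/(_ erefl)/matrixP/(_ 0 0).
  by rewrite !mxE mulr1n.
split; first by have [->|/off ->] := eqVneq i j; rewrite ?mul1r ?mul0r.
have [->//|ij] := eqVneq i j; apply/eqP; rewrite -subr_eq0; apply/eqP.
have := H (delta_mx i 0 + delta_mx j 0) (delta_mx i 0 - delta_mx j 0).
rewrite linearB /= !mulmxBl !mulmxDr !e !e1 !eqxx (eq_sym j) (negPf ij).
move=> Q0; have {}/Q0/matrixP/(_ 0 0) : (1%:M + 0%:M - (0%:M + 1%:M) : 'M[K]_1) = 0.
  by rewrite addrC (addrC 0%:M) addNr.
by rewrite !mxE !mulr1n (off i j ij) (off j i) 1?eq_sym // addr0 add0r.
Qed.

End Matrices.

Section Poisson.
Variables (K : numClosedFieldType) (m : nat).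
Local Notation V := (Vsym K m).
Local Notation omega := (omega_sym K m).
Local Notation INVc := (@INVc K m).

Lemma jet_quad (a b c : K) : jet (fun t => a + t * b + t * t * c) a b.
Proof.
exists (a%:P + b *: 'X + c *: 'X^2); split=> *;
  rewrite ?derivE !hornerE ?expr0n ?mulr0 ?addr0 //=; ring.
Qed.

Lemma mxjet_quad (M0 M1 M2 : 'M[K]_m) M i j :
  (forall t, M t = M0 + t *: M1 + (t * t) *: M2) ->
  jet (fun t => M t i j) (M0 i j) (M1 i j).
Proof.
by move=> HM; apply: (jet_ext (jet_quad _ _ (M2 i j))) => t; rewrite HM !mxE.
Qed.

Lemma unip_expand (s t : K) (N A : 'M[K]_m) :
  s *: ((1%:M + t *: N) *m A *m (1%:M + t *: N^T)) =
  s *: A + t *: (N *m (s *: A) + (s *: A) *m N^T) + (t * t) *: (N *m (s *: A) *m N^T).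
Proof.
rewrite mulmxDl mul1mx mulmxDr mulmx1 mulmxDl -!scalemxAr -!scalemxAl.
rewrite !(scalerDr, scalerA) !addrA (mulrC t s) (mulrC (t * t)) mulrA.
by congr (_ + _); rewrite addrAC.
Qed.

Lemma INVc_dirderiv_scale p v : vanishing_ideal INVc p -> INVc v -> dirderiv p v v = 0.
Proof.
move=> Ip Cv; have [] // := curve_vanish (curve_jet_line v v) (oner_neq0 _) _ Ip.
by move=> t _; rewrite -[X in X + _]scale1r -scalerDl; exact: INVcZ.
Qed.

(** Since [y^T x = 0], the matrix [N = x y^T] has square zero. So [1 + t N] has determinant 1 and
    inverse [1 - t N]: the orbit curve of [v] is polynomial in [t], stays in the cone and has
    velocity [w] at 0. *)
Lemma INVc_dirderiv_unip p v w (x y : 'cV[K]_m) : vanishing_ideal INVc p ->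
  INVc v -> y^T *m x = 0 ->
  vA w = x *m y^T *m vA v + vA v *m (y *m x^T) ->
  vB w = - (y *m x^T *m vB v + vB v *m (x *m y^T)) ->
  dirderiv p v w = 0.
Proof.
move=> Ip [s [A [B [sA dA AB eA eB]]]] yx wA wB.
pose N := x *m y^T; have NN : N *m N = 0 by rewrite /N mulmxA -(mulmxA x) yx mulmx0 mul0mx.
have NT : N^T = y *m x^T by rewrite /N trmx_mul trmxK.
pose g t := 1%:M + t *: N; pose h t := 1%:M - t *: N.
have gh t : g t *m h t = 1%:M.
  rewrite /g /h mulmxBr mulmx1 mulmxDl mul1mx -scalemxAl -scalemxAr NN !scaler0 addr0.
  by rewrite addrK.
have hg t : h t *m g t = 1%:M by exact: mulmx1C.
have dg t : \det (g t) = 1.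
  rewrite /g /N scalemxAl det_1addM -scalemxAr yx scaler0 addr0; exact: det1.
pose c t := mkV (s *: (g t *m A *m (g t)^T)) (s *: ((h t)^T *m B *m h t)).
have sB := inv_sym sA AB.
have symA t : (g t *m A *m (g t)^T)^T = g t *m A *m (g t)^T.
  by rewrite !trmx_mul trmxK sA mulmxA.
have symB t : ((h t)^T *m B *m h t)^T = (h t)^T *m B *m h t.
  by rewrite !trmx_mul trmxK sB mulmxA.
have Hc : curve_jet c v w.
  apply: curve_jet_Vsym => i j.
    apply: (mxjet_quad (M2 := N *m vA v *m N^T)) => t.
    rewrite /c vA_mk ?linearZ /= ?symA ?symB // wA -NT -/N eA /g.
    by rewrite linearD /= trmx1 linearZ /= unip_expand.
  apply: (mxjet_quad (M2 := N^T *m vB v *m N)) => t.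
  rewrite /c vB_mk ?linearZ /= ?symA ?symB // wB -NT -/N eB /h.
  have -> : (1%:M - t *: N)^T = 1%:M + (- t) *: N^T.
    by rewrite raddfB /= trmx1 linearZ /= scaleNr.
  have -> : 1%:M - t *: N = 1%:M + (- t) *: N^T^T by rewrite trmxK scaleNr.
  by rewrite unip_expand trmxK mulrNN scalerN scaleNr.
have [] // := curve_vanish Hc (oner_neq0 _) _ Ip.
move=> t _; apply: INVc_mk => //.
  by rewrite !det_mulmx det_tr dg dA !mulr1.
rewrite !mulmxA -(mulmxA _ (g t)^T) -trmx_mul hg trmx1 mulmx1.
by rewrite -(mulmxA _ A) AB mulmx1.
Qed.

End Poisson.

(** * The cone is coisotropic *)

Section Coisotropy.
Variables (K : numClosedFieldType) (m : nat).
Hypothesis m0 : (0 < m)%N.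
Local Notation V := (Vsym K m).
Local Notation omega := (omega_sym K m).
Local Notation INVc := (@INVc K m).
Local Notation Zinv := (@Zinv K m).

Lemma omegaN u v : omega u v = - omega v u.
Proof. by rewrite !omega_symE opprB. Qed.

Lemma linform_omega u : linform (omega u).
Proof.
move=> a v w; rewrite !omega_symE vAD vBD vAZ vBZ mulmxDr mulmxDl !raddfD /=.
by rewrite -scalemxAl -scalemxAr !mxtraceZ; ring.
Qed.

Lemma linform_omegal u : linform (omega^~ u).
Proof.
move=> a v w; rewrite omegaN linform_omega (omegaN _ v) (omegaN _ w); ring.
Qed.

Lemma mxtrace_delta (X : 'M[K]_m) i j : \tr (X *m delta_mx i j) = X j i.
Proof.
rewrite -(mul_delta_mx (0 : 'I_1)) mulmxA mxtrace_mulC mulmxA -rowE -colE.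
by rewrite trace_mx11 !mxE.
Qed.

Lemma omega_nondeg u : (forall w, omega u w = 0) -> u = 0.
Proof.
move=> H; have sym (i j : 'I_m) : (delta_mx i j + delta_mx j i : 'M[K]_m)^T = delta_mx i j + delta_mx j i.
  by rewrite linearD /= !trmx_delta addrC.
have s0 : (0 : 'M[K]_m)^T = 0 by rewrite trmx0.
have two (x : K) : x + x = 0 -> x = 0.
  by move/eqP; rewrite -mulr2n mulrn_eq0 /= => /eqP.
apply: Vsym_eq; rewrite ?vA0 ?vB0; apply/matrixP => i j; rewrite mxE; apply: two.
  have := H (mkV 0 (delta_mx i j + delta_mx j i)).
  rewrite omega_symE vA_mk ?vB_mk // mul0mx mxtrace0 subr0 mulmxDr mxtraceD.
  by rewrite !mxtrace_delta (vAC u j).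
have := H (mkV (delta_mx i j + delta_mx j i) 0).
rewrite omega_symE vA_mk ?vB_mk // mulmx0 mxtrace0 sub0r mxtrace_mulC mulmxDr mxtraceD.
by rewrite !mxtrace_delta (vBC u j) => /eqP; rewrite oppr_eq0 => /eqP.
Qed.

(* [H] is the Hamiltonian vector field of [p]. *)
Lemma hamiltonian (p : {mpoly K[\dim {:V}]}) : exists H : V -> V,
  [/\ forall v w, omega (H v) w = dirderiv p v w,
      mxfun (@pfun K V) (fun v => vA (H v)) & mxfun (@pfun K V) (fun v => vB (H v))].
Proof.
have /choice[a /choice[b Hab]] k := linform_Vsym (linform_vcoord (V := V) k).
pose g k v := polyfun p^`M(k) v.
have pg k : pfun (g k) by exists p^`M(k).
pose GA v := \matrix_(i, j) \sum_k g k v * a k i j.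
pose GB v := \matrix_(i, j) \sum_k g k v * b k i j.
have HP := pfunP V.
have pGA : mxfun (@pfun K V) GA.
  move=> i j; have -> : (fun v => GA v i j) = (fun v => \sum_k g k v * a k i j).
    by apply/funext => v; rewrite mxE.
  apply: (falg_sum HP) => k; apply: (falgM HP) => //; exact: falgC.
have pGB : mxfun (@pfun K V) GB.
  move=> i j; have -> : (fun v => GB v i j) = (fun v => \sum_k g k v * b k i j).
    by apply/funext => v; rewrite mxE.
  apply: (falg_sum HP) => k; apply: (falgM HP) => //; exact: falgC.
(* The form pairs the first block with the second up to sign, so the gradient in [B] gives the first
   component and minus the gradient in [A] the second. Symmetrising does not change traces against
   symmetric matrices. *)
pose X v := 2^-1 *: (GB v + (GB v)^T); pose Y v := - 2^-1 *: (GA v + (GA v)^T).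
have sX v : (X v)^T = X v by rewrite linearZ /= linearD /= trmxK addrC.
have sY v : (Y v)^T = Y v by rewrite linearZ /= linearD /= trmxK addrC.
exists (fun v => mkV (X v) (Y v)); split.
- move=> v w; rewrite omega_symE vA_mk ?vB_mk //.
  have tr_sym (G S : 'M[K]_m) : S^T = S ->
      \tr (2^-1 *: (G + G^T) *m S) = \sum_i \sum_j S i j * G i j.
    move=> sS; rewrite -scalemxAl mxtraceZ mulmxDl mxtraceD.
    rewrite -[X in _ + X]mxtrace_tr trmx_mul trmxK sS (mxtrace_mulC S).
    rewrite -mulr2n -(mulr_natl (\tr _)) mulrA mulVf ?pnatr_eq0 // mul1r.
    apply: eq_bigr => i _; rewrite mxE; apply: eq_bigr => j _.
    by rewrite mulrC -{1}sS mxE.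
  rewrite (mxtrace_mulC (vA w)) /Y scaleNr mulNmx raddfN /= opprK.
  rewrite /X (tr_sym (GB v)) ?vB_sym // (tr_sym (GA v)) ?vA_sym // addrC.
  under [RHS]eq_bigr do rewrite Hab mulrDr.
  rewrite big_split /=; congr (_ + _).
    under [RHS]eq_bigr do rewrite mulr_sumr; rewrite [RHS]exchange_big; apply: eq_bigr => i _ /=.
    under [RHS]eq_bigr do rewrite mulr_sumr; rewrite [RHS]exchange_big; apply: eq_bigr => j _ /=.
    by rewrite mxE mulr_sumr; apply: eq_bigr => k _; rewrite mulrCA.
  under [RHS]eq_bigr do rewrite mulr_sumr; rewrite [RHS]exchange_big; apply: eq_bigr => i _ /=.
  under [RHS]eq_bigr do rewrite mulr_sumr; rewrite [RHS]exchange_big; apply: eq_bigr => j _ /=.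
  by rewrite mxE mulr_sumr; apply: eq_bigr => k _; rewrite mulrCA.
- have -> : (fun v => vA (mkV (X v) (Y v))) = X by apply/funext => v; rewrite vA_mk.
  apply: (mxfunZ HP); first exact: falgC.
  by apply: (mxfunD HP) => //; exact: mxfun_tr.
- have -> : (fun v => vB (mkV (X v) (Y v))) = Y by apply/funext => v; rewrite vB_mk.
  apply: (mxfunZ HP); first exact: falgC.
  by apply: (mxfunD HP) => //; exact: mxfun_tr.
Qed.

Lemma pfun_omega (H H' : V -> V) :
  mxfun (@pfun K V) (fun v => vA (H v)) -> mxfun (@pfun K V) (fun v => vB (H v)) ->
  mxfun (@pfun K V) (fun v => vA (H' v)) -> mxfun (@pfun K V) (fun v => vB (H' v)) ->
  pfun (fun v => omega (H v) (H' v)).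
Proof.
move=> HA HB HA' HB'; have HP := pfunP V.
have -> : (fun v => omega (H v) (H' v)) = (fun v => \sum_i (vA (H v) *m vB (H' v)) i i
  - \sum_i (vA (H' v) *m vB (H v)) i i) by apply/funext => v; rewrite omega_symE.
by apply: (falgB HP); apply: (falg_sum HP) => i; apply: (mxfunM HP).
Qed.

Section AtInvertible.
Variables (s : K) (A B : 'M[K]_m) (v : V).
Hypotheses (s0 : s != 0) (sA : A^T = A) (dA : \det A = 1) (AB : A *m B = 1%:M).
Hypotheses (vAE : vA v = s *: A) (vBE : vB v = s *: B).

Let Cv : INVc v. Proof. by exists s, A, B. Qed.

(** Orthogonality of [u] to the unipotent velocities says that [Q] is isotropic in the sense of
    [scalar_of_isotropic]; orthogonality to [v] itself makes the two summands of [Q] share its trace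
    equally. These are the linearised equations [A B = s^2], [det A = s^m]: the Hamiltonian vector
    is itself tangent. *)
Lemma ham_scalar p u : vanishing_ideal INVc p ->
  (forall w, omega u w = dirderiv p v w) ->
  exists mu : K, vA v *m vB u + vA u *m vB v = mu%:M /\
    \tr (vA u *m vB v) *+ 2 = mu * m%:R.
Proof.
move=> Ip Hu; set Q := vA v *m vB u + vA u *m vB v.
have Qiso (x y : 'cV[K]_m) : y^T *m x = 0 -> y^T *m Q *m x = 0.
  move=> yx.
  have := @INVc_dirderiv_unip K m p v
    (mkV (x *m y^T *m vA v + vA v *m (y *m x^T)) (- (y *m x^T *m vB v + vB v *m (x *m y^T))))
    x y Ip Cv yx.
  have s1 : (x *m y^T *m vA v + vA v *m (y *m x^T))^T = x *m y^T *m vA v + vA v *m (y *m x^T).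
    by rewrite linearD /= !trmx_mul !trmxK vA_sym addrC.
  have s2 : (- (y *m x^T *m vB v + vB v *m (x *m y^T)))^T = - (y *m x^T *m vB v + vB v *m (x *m y^T)).
    by rewrite linearN linearD /= !trmx_mul !trmxK vB_sym addrC.
  rewrite vA_mk ?vB_mk // => /(_ erefl erefl); rewrite -Hu omega_symE vA_mk ?vB_mk //.
  have t1 (P : 'M[K]_m) : \tr (P *m (x *m y^T)) = \tr (y^T *m P *m x).
    by rewrite mulmxA mxtrace_mulC mulmxA.
  have t2 (P : 'M[K]_m) : \tr (P *m (y *m x^T)) = \tr (y^T *m P^T *m x).
    by rewrite -mxtrace_tr !trmx_mul trmxK mxtrace_mulC t1.
  have e1 : \tr (vA u *m (y *m x^T *m vB v)) = \tr (y^T *m (vA u *m vB v) *m x).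
    by rewrite (mulmxA (vA u)) (mxtrace_mulC _ (vB v)) (mulmxA (vB v)) t2 trmx_mul vA_sym vB_sym.
  have e2 : \tr (vA u *m (vB v *m (x *m y^T))) = \tr (y^T *m (vA u *m vB v) *m x).
    by rewrite (mulmxA (vA u)) t1.
  have e3 : \tr (x *m y^T *m vA v *m vB u) = \tr (y^T *m (vA v *m vB u) *m x).
    by rewrite -(mulmxA (x *m y^T)) (mxtrace_mulC (x *m y^T)) t1.
  have e4 : \tr (vA v *m (y *m x^T) *m vB u) = \tr (y^T *m (vA v *m vB u) *m x).
    by rewrite (mxtrace_mulC _ (vB u)) (mulmxA (vB u)) t2 trmx_mul vA_sym vB_sym.
  rewrite mulmxN raddfN /= mulmxDr mulmxDl !mxtraceD e1 e2 e3 e4 => E.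
  apply/matrixP => a b; rewrite !ord1 [RHS]mxE -trace_mx11 /Q mulmxDr mulmxDl mxtraceD.
  move: E; set z1 := \tr _; set z2 := \tr (_ *m (vA v *m vB u) *m _) => E.
  have /eqP : (z2 + z1) *+ 2 = 0 by rewrite -[RHS]oppr0 -[in RHS]E; ring.
  by rewrite mulrn_eq0 /= => /eqP.
have Qs := scalar_of_isotropic Qiso.
have [mu QE] : exists mu : K, Q = mu%:M.
  exists (Q (Ordinal m0) (Ordinal m0)); apply/matrixP => i j.
  have [-> _] := Qs i j; have [_ ->] := Qs i (Ordinal m0).
  by rewrite [RHS]mxE mulr_natl.
exists mu; split=> //.
have := INVc_dirderiv_scale Ip Cv; rewrite -Hu omega_symE => /eqP.
rewrite subr_eq0 => /eqP E; rewrite mulr2n {2}E addrC -mxtraceD addrC.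
by rewrite addrC -/Q QE mxtrace_scalar mulr_natr.
Qed.

(** As [vB v] is invertible, the scalar relation expresses the second block of a Hamiltonian vector
    through its first one. After substitution the terms quadratic in [vB v] cancel by cyclicity of
    the trace, the others by the trace condition. *)
Lemma bracket_vanish p q u u' : vanishing_ideal INVc p -> vanishing_ideal INVc q ->
  (forall w, omega u w = dirderiv p v w) -> (forall w, omega u' w = dirderiv q v w) ->
  omega u u' = 0.
Proof.
move=> Ip Iq Hu Hu'.
have [mu [E1 T1]] := ham_scalar Ip Hu; have [nu [E2 T2]] := ham_scalar Iq Hu'.
have BA : vB v *m vA v = (s * s)%:M.
  rewrite vAE vBE -scalemxAl -scalemxAr scalerA.
  by rewrite (mulmx1C AB) scalemx1.
have key w c : vA v *m vB w + vA w *m vB v = c%:M ->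
    (s * s) *: vB w = c *: vB v - vB v *m vA w *m vB v.
  move=> E; have := congr1 (mulmx (vB v)) E.
  rewrite mulmxDr mulmxA BA mul_scalar_mx mul_mx_scalar mulmxA => <-.
  by rewrite addrK.
apply/eqP; have ss0 : s * s != 0 by rewrite mulf_neq0.
rewrite -(mulrI_eq0 _ (mulfI ss0)) omega_symE mulrBr -!mxtraceZ !scalemxAr.
rewrite (key _ _ E1) (key _ _ E2) !mulmxBr !raddfB /= -!scalemxAr !mxtraceZ.
rewrite !mulmxA.
have -> : \tr (vA u' *m vB v *m vA u *m vB v) = \tr (vA u *m vB v *m vA u' *m vB v).
  by rewrite -(mulmxA _ (vA u)) mxtrace_mulC mulmxA.
suff E : nu * \tr (vA u *m vB v) = mu * \tr (vA u' *m vB v).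
  by rewrite E opprK addrACA subrr addNr addr0.
apply: (mulIf (_ : 2 != 0 :> K)); first by rewrite pnatr_eq0.
by rewrite -!mulrA !mulr_natr T1 T2; ring.
Qed.

End AtInvertible.

(* The left-hand side is the Poisson bracket of [p] and [q]: a polynomial in [v],
   so that it is enough to check its vanishing on the open orbit. *)
Lemma poisson p q u u' v : vanishing_ideal INVc p -> vanishing_ideal INVc q ->
  Zinv v ->
  (forall w, omega u w = dirderiv p v w) -> (forall w, omega u' w = dirderiv q v w) ->
  omega u u' = 0.
Proof.
move=> Ip Iq Zv Hu Hu'.
have [H [HE HA HB]] := hamiltonian p; have [H' [HE' HA' HB']] := hamiltonian q.
have uniq_ham w w' : (forall x, omega w x = omega w' x) -> w = w'.
  move=> E; apply/eqP; rewrite -subr_eq0; apply/eqP/omega_nondeg => x.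
  rewrite omegaN -scaleN1r addrC linform_omega (omegaN x w) (omegaN x w') E; ring.
have -> : u = H v by apply: uniq_ham => x; rewrite Hu HE.
have -> : u' = H' v by apply: uniq_ham => x; rewrite Hu' HE'.
pose b w := omega (H w) (H' w).
have pb : pfun b by exact: pfun_omega.
apply: (Zinv_pfun m0 pb _ Zv) => w Cw.
have b_nz s A B : s != 0 -> A^T = A -> \det A = 1 -> A *m B = 1%:M ->
    b (mkV (s *: A) (s *: B)) = 0.
  move=> s0 sA dA AB; have sB := inv_sym sA AB.
  have wA : vA (mkV (s *: A) (s *: B)) = s *: A by rewrite vA_mk // linearZ /= ?sA ?sB.
  have wB : vB (mkV (s *: A) (s *: B)) = s *: B by rewrite vB_mk // linearZ /= ?sA ?sB.
  by apply: (bracket_vanish s0 sA dA AB wA wB Ip Iq).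
have [s [A [B [sA dA AB eA eB]]]] := Cw; have sB := inv_sym sA AB.
have wE : w = mkV (s *: A) (s *: B).
  by apply: Vsym_eq; rewrite ?vA_mk ?vB_mk // linearZ /= ?sA ?sB.
(* At the apex [s = 0] nothing is invertible; the bracket is polynomial along the ray [(t A, t B)]
   and vanishes for [t != 0]. *)
have [s0|s0] := eqVneq s 0; last by rewrite wE b_nz.
have [q' Hq'] : @upoly K (fun t => b (mkV (t *: A) (t *: B))).
  have mxU (M : 'M[K]_m) : mxfun (@upoly K) (fun t => t *: M).
    by apply: (mxfunZ (upolyP K)); [exact: upoly_id | apply: mxfunC; exact: upolyP].
  apply: falg_pfun_Vsym pb; first exact: upolyP.
    have -> : (fun t => vA (mkV (t *: A) (t *: B))) = (fun t => t *: A) => //.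
    by apply/funext => t; rewrite vA_mk // linearZ /= ?sA ?sB.
  have -> : (fun t => vB (mkV (t *: A) (t *: B))) = (fun t => t *: B) => //.
  by apply/funext => t; rewrite vB_mk // linearZ /= ?sA ?sB.
rewrite wE -Hq' (_ : q' = 0) ?horner0 //; apply: (@poly_zero_outside _ _ 'X).
  by rewrite polyX_eq0.
by move=> t; rewrite hornerX => t0; rewrite Hq' b_nz.
Qed.

Lemma perp_dim (D : {vspace V}) : exists T : {vspace V},
  (\dim {:V} <= \dim T + \dim D)%N /\
  forall x, x \in T <-> forall u, u \in D -> omega u x = 0.
Proof.
pose f x : 'rV[K]_(\dim D) := \row_i omega (vbasis D)`_i x.
have linf : linear f.
  by move=> a x y; apply/rowP => i; rewrite !mxE linform_omega.
pose F : {linear V -> 'rV[K]_(\dim D)} := HB.pack f (GRing.isLinear.Build _ _ _ _ f linf).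
exists (lker (linfun F)); split.
  rewrite -[leqLHS](limg_ker_dim (linfun F)) capfv leq_add2l.
  apply: leq_trans (dimvS (subvf _)) _.
  by rewrite dimvf /dim /= mul1n.
move=> x; rewrite memv_ker lfunE /=; split=> [/eqP/rowP H u uD | H].
  rewrite (coord_vbasis uD); have := linform_sum (linform_omegal x).
  move=> -> ; rewrite big1 // => i _.
  by have := H i; rewrite !mxE => ->; rewrite mulr0.
apply/eqP/rowP => i; rewrite !mxE H //; apply/vbasis_mem/mem_nth.
by rewrite size_tuple.
Qed.

Lemma hamiltonian_space v : exists D : {vspace V}, forall u,
  u \in D <-> exists2 p, vanishing_ideal Zinv p & forall w, omega u w = dirderiv p v w.
Proof.
pose S : set V := [set u | exists2 p, vanishing_ideal Zinv p &
  forall w, omega u w = dirderiv p v w].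
have [|a u u' [p Ip Hp] [q Iq Hq]|D HD] := @subset_vspace K V S.
- exists 0; first by move=> x _; rewrite /polyfun meval0.
  move=> w; rewrite /dirderiv big1 => [|i _].
    by have := linform_omegal w (-1) 0 0; rewrite scaler0 addr0 mulN1r addNr.
  by rewrite mderiv0 /polyfun meval0 mul0r.
- exists (a *: p + q).
    move=> x Zx; rewrite /polyfun mevalD mevalZ.
    by rewrite -!/(polyfun _ _) (Ip x Zx) (Iq x Zx) mulr0 addr0.
  move=> w; rewrite linform_omegal Hp Hq /dirderiv mulr_sumr -big_split /=.
  apply: eq_bigr => i _; rewrite mderivD mderivZ /polyfun mevalD mevalZ.
  by rewrite mulrDl mulrA.
- exists D => u; have -> : u \in D = ([set` D] u) :> Prop by [].
  by rewrite HD.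
Qed.

(** Let [D] be the space of Hamiltonian vectors at [v] of the elements of the ideal. Then [T] is the
    perpendicular of [D] by definition of the tangent space, and the vanishing of the brackets says
    that [D] lies in [T]. So the ambient dimension is at most [dim T + dim D], and [D = T] in case
    [T] has at most half of it. *)
Lemma Zinv_tangent_dim v (T : {vspace V}) : Zinv v -> [set` T] = tangent Zinv v ->
  (\dim {:V} <= \dim T + \dim T)%N /\
  ((\dim T + \dim T <= \dim {:V})%N -> tangent Zinv v = perp omega (tangent Zinv v)).
Proof.
move=> Zv TE; have [D HD] := hamiltonian_space v.
have [T' [dT' HT']] := perp_dim D.
have T'E : T' = T.
  apply/vspaceP => x; apply/idP/idP => [/HT' H | xT].
    suff : [set` T] x by [].
    rewrite TE => p Ip; have [H0 [HE _ _]] := hamiltonian p.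
    by rewrite -HE H //; apply/HD; exists p.
  apply/HT' => u /HD[p Ip Hu]; rewrite Hu.
  have : [set` T] x by [].
  by rewrite TE; apply.
subst T'; have DT : (D <= T)%VS.
  apply/subvP => u /HD[p Ip Hu]; apply/HT' => u' /HD[q Iq Hu'].
  by rewrite ZinvI // in Ip Iq; exact: (poisson Iq Ip Zv Hu' Hu).
have dDT := dimvS DT; split; first exact: leq_trans dT' (leq_add (leqnn _) dDT).
move=> dT; have DTE : D = T.
  apply/eqP; rewrite -(dimv_leqif_eq DT) eqn_leq dDT /=.
  by have := leq_trans dT dT'; rewrite leq_add2l.
subst D; rewrite -TE; apply/seteqP; split=> x /=.
  by move=> /HT' H u; exact: H.
by move=> H; apply/HT' => u; exact: H.
Qed.

End Coisotropy.

(** * Rational parametrization, irreducibility and dimension *)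

Section LinearMaps.
Variables (K : fieldType) (U W : vectType K).

Lemma linear_hom (f : U -> W) : linear f -> exists F : 'Hom(U, W), forall u, F u = f u.
Proof.
move=> linf.
pose g : {linear U -> W} := HB.pack f (GRing.isLinear.Build _ _ _ _ f linf).
by exists (linfun g) => u; rewrite lfunE.
Qed.

End LinearMaps.

Section HalfSpace.
Variables (K : numClosedFieldType) (m : nat).
Local Notation V := (Vsym K m).

(** [U] stands for the space of symmetric matrices and is the source of the parametrization.
    Exchanging the two blocks shows that it has half of the ambient dimension, without counting
    matrix entries. *)
Lemma half_space : exists U : {vspace V},
  (forall v, v \in U <-> vB v = 0) /\ \dim {:V} = (\dim U + \dim U)%N.
Proof.
have t0 : (0 : 'M[K]_m)^T = 0 by rewrite trmx0.
have [|PA HA] := @linear_hom K V V (fun v => mkV (vA v) 0).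
  by move=> a u v; apply: Vsym_eq; rewrite !(vAD, vBD, vAZ, vBZ) ?vA_mk ?vB_mk
    ?linearD ?linearZ /= ?vA_sym // scaler0 addr0.
have [|PB HB] := @linear_hom K V V (fun v => mkV 0 (vB v)).
  by move=> a u v; apply: Vsym_eq; rewrite !(vAD, vBD, vAZ, vBZ) ?vA_mk ?vB_mk
    ?linearD ?linearZ /= ?vB_sym // scaler0 addr0.
have [|sw Hsw] := @linear_hom K V V (fun v => mkV (vB v) (vA v)).
  by move=> a u v; apply: Vsym_eq; rewrite !(vAD, vBD, vAZ, vBZ) ?vA_mk ?vB_mk
    ?linearD ?linearZ /= ?vB_sym ?vA_sym.
have inU v : v \in lker PB <-> vB v = 0.
  rewrite memv_ker HB; split=> [/eqP/(congr1 (@vB K m))|->].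
    by rewrite vB0 vB_mk // vB_sym.
  by apply/eqP/Vsym_eq; rewrite ?vA_mk ?vB_mk ?vA0 ?vB0.
have inW v : v \in lker PA <-> vA v = 0.
  rewrite memv_ker HA; split=> [/eqP/(congr1 (@vA K m))|->].
    by rewrite vA0 vA_mk // vA_sym.
  by apply/eqP/Vsym_eq; rewrite ?vA_mk ?vB_mk ?vA0 ?vB0.
exists (lker PB); split=> //.
have cap0 : (lker PB :&: lker PA)%VS = 0%VS.
  apply/eqP; rewrite -subv0; apply/subvP => v; rewrite memv_cap memv0.
  by move=> /andP[/inU vB0' /inW vA0']; apply/eqP/Vsym_eq; rewrite ?vA0 ?vB0.
have -> : \dim {:V} = \dim (lker PB + lker PA)%VS.
  congr (\dim _); apply/eqP; rewrite eqEsubv subvf andbT; apply/subvP => v _.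
  have -> : v = mkV (vA v) 0 + mkV 0 (vB v).
    by apply: Vsym_eq; rewrite ?vAD ?vBD ?vA_mk ?vB_mk ?vA_sym ?vB_sym ?addr0 ?add0r.
  by apply: memv_add; [apply/inU; rewrite vB_mk ?vA_sym | apply/inW; rewrite vA_mk ?vB_sym].
rewrite (dimv_disjoint_sum cap0); congr (_ + _)%N.
have swK v : sw (sw v) = v.
  rewrite !Hsw; apply: Vsym_eq; rewrite ?vA_mk ?vB_mk ?vA_mk ?vB_mk ?vA_sym ?vB_sym //.
have sw0 (S : {vspace V}) : (S :&: lker sw)%VS = 0%VS.
  apply/eqP; rewrite -subv0; apply/subvP => v; rewrite memv_cap memv0 memv_ker.
  by move=> /andP[_ /eqP E]; rewrite -(swK v) E linear0.
apply/eqP; rewrite eqn_leq; apply/andP; split.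
  rewrite -(limg_dim_eq (sw0 (lker PA))); apply: dimvS; apply/subvP => w.
  move=> /memv_imgP[v /inW v0 ->]; apply/inU.
  by rewrite Hsw vB_mk ?vA_sym ?vB_sym.
rewrite -(limg_dim_eq (sw0 (lker PB))); apply: dimvS; apply/subvP => w.
move=> /memv_imgP[v /inU v0 ->]; apply/inW.
by rewrite Hsw vA_mk ?vA_sym ?vB_sym.
Qed.

End HalfSpace.

(** Irreducibility of affine space: polynomial functions are polynomials, and these form an integral
    domain. *)
Lemma pfun_mul_eq0 (K : numFieldType) (W : vectType K) (f g : W -> K) :
  pfun f -> pfun g -> (forall w, f w * g w = 0) ->
  (forall w, f w = 0) \/ (forall w, g w = 0).
Proof.
move=> [p Hp] [q Hq] H.
have /eqP : p * q = 0.
  apply: mpoly_fun_eq0 => x; have [w Hw] := coord_surj x.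
  rewrite -(H w) -Hp -Hq -[RHS]mevalM; apply: meval_eq => i; by rewrite Hw.
rewrite mulf_eq0 => /orP[/eqP p0|/eqP q0]; [left | right] => w.
  by rewrite -Hp p0 /polyfun meval0.
by rewrite -Hq q0 /polyfun meval0.
Qed.

Section Parametrization.
Variables (K : numClosedFieldType) (n : nat).
Local Notation m := n.+1.
Local Notation V := (Vsym K m).
Local Notation INVc := (@INVc K m).
Local Notation Zinv := (@Zinv K m).
Variables (U : {vspace V}).
Hypothesis inU : forall v, v \in U <-> vB v = 0.
Local Notation N := (\dim {:subvs_of U}).

Definition cmat (c : subvs_of U) : 'M[K]_m := vA (vsval c).

Lemma cmat_sym c : (cmat c)^T = cmat c.
Proof. exact: vA_sym. Qed.

Lemma cmat_surj C : C^T = C -> exists c, cmat c = C.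
Proof.
move=> sC; exists (vsproj U (mkV C 0)); rewrite /cmat vsprojK ?vA_mk ?trmx0 //.
by apply/inU; rewrite vB_mk ?trmx0.
Qed.

Lemma pfun_cmat : mxfun (@pfun K (subvs_of U)) cmat.
Proof.
move=> i j; apply: pfun_linform => a u v.
by rewrite /cmat linearP vAD vAZ !mxE.
Qed.

Definition zero00 (C : 'M[K]_m) : 'M[K]_m := C - C 0 0 *: delta_mx 0 0.

(** When [M = cofactor C 0 0] is nonzero this is [M *: A], where [A] is the matrix of determinant 1
    that differs from [C] in the corner entry only. *)
Definition Ahat (C : 'M[K]_m) : 'M[K]_m :=
  cofactor C 0 0 *: zero00 C + (1 - \det (zero00 C)) *: delta_mx 0 0.

(* The equation [det A = 1] is of degree one in [A 0 0], hence solves rationally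
   for it; clearing the denominator [cofactor C 0 0] gives a polynomial map. The
   entry [C 0 0] serves as the homogeneity parameter. *)
Definition Phi (c : subvs_of U) : V :=
  let C := cmat c in
  mkV ((C 0 0 * cofactor C 0 0 ^+ n) *: Ahat C) ((C 0 0 * cofactor C 0 0) *: \adj (Ahat C)).

Lemma cofactor_00 (C : 'M[K]_m) x j : cofactor (C + x *: delta_mx 0 0) 0 j = cofactor C 0 j.
Proof.
rewrite /cofactor; congr (_ * \det _); apply/matrixP => k l; rewrite !mxE /=.
by rewrite mulr0 addr0.
Qed.

Lemma det_00 (C : 'M[K]_m) x : \det (C + x *: delta_mx 0 0) = \det C + x * cofactor C 0 0.
Proof.
rewrite !(expand_det_row _ 0); under eq_bigr do rewrite cofactor_00 !mxE mulrDl.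
rewrite big_split /=; congr (_ + _); rewrite (bigD1 0) //= big1 ?addr0 ?mulr1 // => j.
by move/negPf => ->; rewrite ?andbF mulr0 mul0r.
Qed.

Lemma sym_delta00 : (delta_mx 0 0 : 'M[K]_m)^T = delta_mx 0 0.
Proof. exact: trmx_delta. Qed.

Lemma zero00_sym C : C^T = C -> (zero00 C)^T = zero00 C.
Proof. by move=> sC; rewrite /zero00 linearB linearZ /= sC sym_delta00. Qed.

Lemma Ahat_sym C : C^T = C -> (Ahat C)^T = Ahat C.
Proof.
by move=> sC; rewrite /Ahat linearD !linearZ /= sym_delta00 zero00_sym.
Qed.

Lemma adj_sym (C : 'M[K]_m) : C^T = C -> (\adj C)^T = \adj C.
Proof. by move=> sC; rewrite trmx_adj sC. Qed.

Lemma vA_Phi c : vA (Phi c) = (cmat c 0 0 * cofactor (cmat c) 0 0 ^+ n) *: Ahat (cmat c).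
Proof.
by rewrite /Phi vA_mk // linearZ /= ?adj_sym ?Ahat_sym ?cmat_sym.
Qed.

Lemma vB_Phi c : vB (Phi c) = (cmat c 0 0 * cofactor (cmat c) 0 0) *: \adj (Ahat (cmat c)).
Proof.
by rewrite /Phi vB_mk // linearZ /= ?adj_sym ?Ahat_sym ?cmat_sym.
Qed.

Lemma cofactor_zero00 (C : 'M[K]_m) : cofactor (zero00 C) 0 0 = cofactor C 0 0.
Proof. by rewrite /zero00 -scaleNr cofactor_00. Qed.

Lemma INVc_Phi c : cofactor (cmat c) 0 0 != 0 -> INVc (Phi c).
Proof.
set C := cmat c; set M := cofactor C 0 0 => M0.
pose A := zero00 C + ((1 - \det (zero00 C)) / M) *: delta_mx 0 0.
have AE : Ahat C = M *: A by rewrite /A scalerDr scalerA mulrCA divff // mulr1.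
have sA : A^T = A.
  by rewrite linearD linearZ /= sym_delta00 zero00_sym // cmat_sym.
have dA : \det A = 1 by rewrite det_00 cofactor_zero00 divfK // addrC subrK.
(* The exponents in [Phi] equalise the two factors: [Ahat] contributes [M] to the first block, and
   its adjugate, of degree [n], contributes [M ^+ n] to the second. *)
exists (C 0 0 * M ^+ n.+1), A, (\adj A); rewrite mul_mx_adj dA; split=> //.
  by rewrite vA_Phi -/C -/M AE scalerA exprSr -mulrA.
by rewrite vB_Phi -/C -/M AE adjZ scalerA -mulrA -exprS.
Qed.

Lemma pfun_Phi h : pfun h -> pfun (fun c => h (Phi c)).
Proof.
move=> ph; have HP := pfunP (subvs_of U); have pC := pfun_cmat.
have p00 : pfun (fun c => cmat c 0 0) by exact: pC.
have pM : pfun (fun c => cofactor (cmat c) 0 0) by exact: falg_cofactor.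
have pzero : mxfun (@pfun K _) (fun c => zero00 (cmat c)).
  apply: (mxfunD HP) => //; apply: (mxfunN HP); apply: (mxfunZ HP) => //.
  exact: mxfunC.
have pAhat : mxfun (@pfun K _) (fun c => Ahat (cmat c)).
  apply: (mxfunD HP); apply: (mxfunZ HP) => //; last exact: mxfunC.
  by apply: (falgB HP); [exact: falgC | exact: falg_det].
apply: falg_pfun_Vsym ph => //.
  have -> : (fun c => vA (Phi c)) = fun c => (cmat c 0 0 * cofactor (cmat c) 0 0 ^+ n) *: Ahat (cmat c).
    by apply/funext => c; rewrite vA_Phi.
  by apply: (mxfunZ HP) => //; apply: (falgM HP) => //; exact: falgX.
have -> : (fun c => vB (Phi c)) = fun c => (cmat c 0 0 * cofactor (cmat c) 0 0) *: \adj (Ahat (cmat c)).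
  by apply/funext => c; rewrite vB_Phi.
apply: (mxfunZ HP); last exact: mxfun_adj.
exact: (falgM HP).
Qed.

Lemma inv_adj (A B : 'M[K]_m) : \det A = 1 -> A *m B = 1%:M -> B = \adj A.
Proof.
move=> dA AB; have := mul_adj_mx A; rewrite dA => adjA.
by rewrite -[LHS]mul1mx -adjA -mulmxA AB mulmx1.
Qed.

(** [Phi] reaches the pairs with [B 0 0 != 0]. If [B 0 0 = 0], the first column of the invertible
    [B] has another nonzero entry, at [j], and the transvection along [delta_mx j 0] makes the
    corner of [B] nonzero for generic [t]. *)
Lemma Phi_dense h : pfun h -> (forall c, h (Phi c) = 0) -> forall u, INVc u -> h u = 0.
Proof.
move=> ph hPhi.
have gen s A B : A^T = A -> \det A = 1 -> A *m B = 1%:M -> B 0 0 != 0 ->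
    h (mkV (s *: A) (s *: B)) = 0.
  move=> sA dA AB B00; have BE := inv_adj dA AB; have sB := inv_sym sA AB.
  have M0 : cofactor A 0 0 != 0 by move: B00; rewrite BE mxE.
  set M := cofactor A 0 0 in M0.
  (* The corner of the parameter only controls the scale of the image; this value makes the scale
     equal to [s]. *)
  have [|c cE] := @cmat_surj (zero00 A + (s / M ^+ n.+1) *: delta_mx 0 0).
    by rewrite linearD linearZ /= sym_delta00 zero00_sym.
  have ME : cofactor (cmat c) 0 0 = M by rewrite cE cofactor_00 cofactor_zero00.
  have zE : zero00 (cmat c) = zero00 A.
    rewrite cE; set D := delta_mx 0 0; rewrite {1}/zero00 !mxE !eqxx !mulr1 subrr add0r.
    by rewrite addrK.
  have c00 : cmat c 0 0 = s / M ^+ n.+1 by rewrite cE !mxE !eqxx !mulr1 subrr add0r.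
  have AhatE : Ahat (cmat c) = M *: A.
    have d1 : 1 - \det (zero00 A) = M * A 0 0.
      have := det_00 (zero00 A) (A 0 0).
      rewrite [zero00 A + _]subrK dA cofactor_zero00 -/M => ->.
      by rewrite addrAC subrr add0r mulrC.
    by rewrite /Ahat zE ME d1 -(scalerA M (A 0 0)) -scalerDr subrK.
  rewrite -[RHS](hPhi c); congr h; apply: Vsym_eq.
    rewrite vA_Phi vA_mk ?linearZ /= ?sA ?sB // AhatE ME c00 scalerA.
    by rewrite -mulrA -exprSr divfK // expf_neq0.
  rewrite vB_Phi vB_mk ?linearZ /= ?sA ?sB // AhatE ME c00 adjZ scalerA -BE.
  by rewrite -mulrA -exprS divfK // expf_neq0.
move=> u [s [A [B [sA dA AB eA eB]]]]; have sB := inv_sym sA AB.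
have -> : u = mkV (s *: A) (s *: B).
  by apply: Vsym_eq; rewrite ?vA_mk ?vB_mk // linearZ /= ?sA ?sB.
have [B00|] := eqVneq (B 0 0) 0; last exact: gen.
have [j Bj] : exists j, B j 0 != 0.
  apply/existsP; rewrite -negb_forall; apply/negP => /forallP H.
  have /matrixP/(_ 0 0) := AB; rewrite !mxE eqxx big1 => [/eqP|k _].
    by rewrite eq_sym oner_eq0.
  by have /eqP -> := H k; rewrite mulr0.
have j0 : j != 0 by apply: contraNneq Bj => ->; rewrite B00.
pose N := delta_mx j 0 : 'M[K]_m.
have NN : N *m N = 0 by rewrite /N mul_delta_mx_0 // eq_sym.
pose g t := 1%:M + t *: N; pose k t := 1%:M - t *: N.
have kg t : k t *m g t = 1%:M.
  rewrite /g /k mulmxDr mulmx1 mulmxBl mul1mx -scalemxAl -scalemxAr NN !scaler0 subr0.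
  by rewrite subrK.
have gk t : g t *m k t = 1%:M by exact: mulmx1C.
have dg t : \det (g t) = 1.
  rewrite /g /N -(mul_delta_mx (0 : 'I_1)) scalemxAl det_1addM -scalemxAr mul_delta_mx_0 //.
    by rewrite scaler0 addr0 det1.
  by rewrite eq_sym.
pose At t := g t *m A *m (g t)^T; pose Bt t := (k t)^T *m B *m k t.
have sAt t : (At t)^T = At t by rewrite /At !trmx_mul trmxK sA mulmxA.
have sBt t : (Bt t)^T = Bt t by rewrite /Bt !trmx_mul trmxK sB mulmxA.
have ABt t : At t *m Bt t = 1%:M.
  rewrite /At /Bt !mulmxA -(mulmxA _ (g t)^T) -trmx_mul kg trmx1 mulmx1.
  by rewrite -(mulmxA _ A) AB mulmx1.
have HP := upolyP K.
have pg : mxfun (@upoly K) g.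
  apply: (mxfunD HP); first exact: mxfunC.
  by apply: (mxfunZ HP); [exact: upoly_id | exact: mxfunC].
have pk : mxfun (@upoly K) k.
  apply: (mxfunD HP); first exact: mxfunC.
  by apply: (mxfunN HP); apply: (mxfunZ HP); [exact: upoly_id | exact: mxfunC].
have [q Hq] : @upoly K (fun t => h (mkV (s *: At t) (s *: Bt t))).
  apply: falg_pfun_Vsym ph => //.
    have -> : (fun t => vA (mkV (s *: At t) (s *: Bt t))) = (fun t => s *: At t).
      by apply/funext => t; rewrite vA_mk // linearZ /= ?sAt ?sBt.
    apply: (mxfunZ HP); first exact: falgC.
    apply: (mxfunM HP); last exact: mxfun_tr.
    by apply: (mxfunM HP) => //; exact: mxfunC.
  have -> : (fun t => vB (mkV (s *: At t) (s *: Bt t))) = (fun t => s *: Bt t).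
    by apply/funext => t; rewrite vB_mk // linearZ /= ?sAt ?sBt.
  apply: (mxfunZ HP); first exact: falgC.
  apply: (mxfunM HP) => //.
  by apply: (mxfunM HP); [exact: mxfun_tr | exact: mxfunC].
have E0 : h (mkV (s *: A) (s *: B)) = q.[0].
  by rewrite Hq /At /Bt /g /k scale0r addr0 subr0 trmx1 !mul1mx !mulmx1.
(* The corner of the moved [B]: its constant term [B 0 0] is zero, and its linear coefficient is
   nonzero by the choice of [j]. *)
pose r : {poly K} := (- (B j 0 *+ 2)) *: 'X + B j j *: 'X^2.
have Bt00 t : Bt t 0 0 = r.[t].
  have e1 (P : 'M[K]_m) a b : (P *m delta_mx j 0) a b = P a j *+ (b == 0).
    rewrite mxE (bigD1 j) //= big1 ?addr0 => [|l /negPf lj]; rewrite mxE ?eqxx ?lj ?mulr0 //=.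
    by rewrite mulr_natr.
  have e2 (P : 'M[K]_m) a b : (delta_mx 0 j *m P) a b = P j b *+ (a == 0).
    rewrite mxE (bigD1 j) //= big1 ?addr0 => [|l /negPf lj];
      rewrite mxE ?eqxx ?lj ?andbF ?mul0r //=.
    by rewrite andbT mulr_natl.
  have kT : (k t)^T = 1%:M + (- t) *: N^T.
    by rewrite /k raddfB /= trmx1 linearZ /= scaleNr.
  have kTT : k t = 1%:M + (- t) *: N^T^T by rewrite trmxK /k scaleNr.
  have := unip_expand 1 (- t) N^T B; rewrite -kTT -kT !scale1r -/(Bt t) => ->.
  have sB0 : B 0 j = B j 0 by rewrite -{1}sB mxE.
  have e3 (P Q R S : 'M[K]_m) a b :
    (P + a *: (Q + R) + b *: S) 0 0 = P 0 0 + a * (Q 0 0 + R 0 0) + b * S 0 0 by rewrite !mxE.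
  rewrite trmxK /N trmx_delta e3 !(e1, e2) !eqxx !mulr1n B00 sB0.
  by rewrite /r hornerD !hornerZ hornerX hornerXn; ring.
have r0 : r != 0.
  apply: contraNneq Bj => E; have := congr1 (fun q : {poly K} => q`_1) E.
  rewrite coef0 coefD !coefZ coefX coefXn !mulr1 mulr0 addr0.
  by move/eqP; rewrite oppr_eq0 mulrn_eq0.
rewrite E0 (poly_zero_outside (q := q) r0) ?horner0 // => t rt.
rewrite Hq; apply: gen => //; last by rewrite Bt00.
by rewrite !det_mulmx det_tr dg dA !mulr1.
Qed.

Lemma Zinv_Phi c : Zinv (Phi c).
Proof.
apply/ZinvP => // p Ip.
have p1 : pfun (fun c => polyfun p (Phi c)) by apply: pfun_Phi; exists p.
have p2 : pfun (fun c => cofactor (cmat c) 0 0).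
  by apply: falg_cofactor; [exact: pfunP | exact: pfun_cmat].
have [|H|H] := pfun_mul_eq0 p1 p2; last 2 first.
- exact: H.
- have [c1 c1E] := cmat_surj (trmx1 _ _).
  have /matrixP/(_ 0 0) := adj1 K m; rewrite [LHS]mxE [RHS]mxE eqxx.
  by have := H c1; rewrite c1E => -> /eqP; rewrite eq_sym oner_eq0.
- move=> d; have [->|d0] := eqVneq (cofactor (cmat d) 0 0) 0; first by rewrite mulr0.
  by rewrite Ip ?mul0r //; exact: INVc_Phi.
Qed.

Lemma Zinv_of_Phi h v : pfun h -> (forall c, h (Phi c) = 0) -> Zinv v -> h v = 0.
Proof. by move=> ph hP; apply: Zinv_pfun => //; exact: Phi_dense. Qed.

(** More than [N] functions, pulled back along [Phi], are polynomials in [N] variables and hence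
    dependent; the relation descends to the cone by density of the image. *)
Lemma trdeg_le W d : W `<=` Zinv -> trdeg_ge W d -> (d <= N)%N.
Proof.
move=> WZ [f Hf]; rewrite leqNgt; apply/negP => ltNd.
have /choice[g Hg] i : pfun (fun c => polyfun (f i) (Phi c)) by apply: pfun_Phi; exists (f i).
have [P P0 HP] := algebraic_dependence g ltNd.
case/eqP: P0; apply: Hf => v /WZ Zv.
apply: (Zinv_of_Phi (h := fun v => P.@[fun i => polyfun (f i) v])) Zv.
  by apply: falg_meval; [exact: pfunP | move=> i; exists (f i)].
move=> c; rewrite -[RHS](HP (fun i => coord (vbasis {:subvs_of U}) i c)).
by apply: meval_eq => i; rewrite -Hg.
Qed.

Lemma zirreducible_Zinv : zirreducible Zinv.
Proof.
split; first exact: zclosed_Zinv.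
  by exists (mkV 1%:M 1%:M); apply: INVc_Zinv => //; exact: INVc1.
move=> A B [S ->] [S' ->] ZAB.
apply: contrapT => /not_orP[/existsNP[v /not_implyP[Zv nA]]].
move=> /existsNP[v' /not_implyP[Zv' nB]].
have /existsNP[p /not_implyP[Sp pv]] := nA.
have /existsNP[q /not_implyP[Sq qv]] := nB.
have p1 : pfun (fun c => polyfun p (Phi c)) by apply: pfun_Phi; exists p.
have p2 : pfun (fun c => polyfun q (Phi c)) by apply: pfun_Phi; exists q.
have [|H|H] := pfun_mul_eq0 p1 p2.
- move=> c; have [/(_ p Sp) H|/(_ q Sq) H] := ZAB _ (Zinv_Phi c).
    by rewrite H mul0r.
  by rewrite H mulr0.
- by case: pv; apply: Zinv_of_Phi Zv => //; exists p.
- by case: qv; apply: Zinv_of_Phi Zv' => //; exists q.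
Qed.

Lemma INVc_of_mat C : C^T = C -> \det C != 0 -> exists2 v, INVc v & vA v = C.
Proof.
move=> sC dC; pose s := m.-root (\det C).
have sm : s ^+ m = \det C by rewrite rootCK.
have s0 : s != 0 by apply: contraNneq dC; rewrite -sm => ->; rewrite expr0n.
pose A := s^-1 *: C; have sA : A^T = A by rewrite linearZ /= sC.
have dA : \det A = 1 by rewrite detZ -sm exprVn mulVf // expf_neq0.
have AB : A *m \adj A = 1%:M by rewrite mul_mx_adj dA.
exists (mkV (s *: A) (s *: \adj A)); first exact: INVc_mk.
rewrite vA_mk; first by rewrite /A scalerA divff // scale1r.
  by rewrite linearZ /= sA.
by rewrite linearZ /= adj_sym.
Qed.

(** The coordinates of the block [A] are independent: over an algebraically closed field every
    invertible symmetric matrix is the first block of a point, scaled by an [m]-th root of its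
    determinant. *)
Lemma trdeg_Zinv : trdeg_ge Zinv N.
Proof.
pose l i (v : V) := coord (vbasis {:subvs_of U}) i (vsproj U (mkV (vA v) 0)).
have ll i : linform (l i).
  move=> a u v; rewrite /l -!linearP; congr (coord _ _ (vsproj U _)).
  by apply: Vsym_eq; rewrite !(vAD, vBD, vAZ, vBZ) ?vA_mk ?vB_mk
    ?linearD ?linearZ /= ?vA_sym ?trmx0 // scaler0 addr0.
have /choice[f Hf] i := pfun_linform (ll i).
exists f => P HP.
have p1 : pfun (polyfun P) by exists P.
have p2 : pfun (fun c => \det (cmat c)).
  by apply: falg_det; [exact: pfunP | exact: pfun_cmat].
have [|H|H] := pfun_mul_eq0 p1 p2.
- move=> c; have [->|dc] := eqVneq (\det (cmat c)) 0; first by rewrite mulr0.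
  have [v /INVc_Zinv Zv vAc] := INVc_of_mat (cmat_sym c) dc.
  suff -> : polyfun P c = P.@[fun i => polyfun (f i) v].
    by rewrite HP ?mul0r //; exact: Zv.
  apply: meval_eq => i; rewrite Hf /l vAc; congr (coord _ _ _).
  rewrite -[LHS]vsvalK; congr vsproj; apply: Vsym_eq.
    by rewrite vA_mk ?cmat_sym ?trmx0.
  by rewrite vB_mk ?cmat_sym ?trmx0 //; apply/inU/subvsP.
- apply: mpoly_fun_eq0 => x; have [c Hc] := coord_surj x.
  by rewrite -[RHS](H c); apply: meval_eq.
- have [c1 c1E] := cmat_surj (trmx1 _ _).
  by have /eqP := H c1; rewrite c1E det1 oner_eq0.
Qed.

Lemma has_dim_Zinv : has_dim Zinv N.
Proof.
split; last by move=> W d WZ _; exact: trdeg_le.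
exists Zinv; split=> //; [exact: zirreducible_Zinv | exact: trdeg_Zinv].
Qed.

Lemma has_local_dim_Zinv v d : Zinv v -> has_local_dim Zinv v d <-> d = N.
Proof.
move=> Zv; split=> [[[W [[WZ _] _ Wd]] Hd] | ->].
  apply/eqP; rewrite eqn_leq (trdeg_le WZ Wd); apply: (Hd Zinv).
  - by split.
  - exact: zirreducible_Zinv.
  - exact: trdeg_Zinv.
split; last by move=> W e [WZ _] _; exact: trdeg_le.
by exists Zinv; split; [split | exact: zirreducible_Zinv | exact: trdeg_Zinv].
Qed.

End Parametrization.

Section Legendrian.
Variables (K : numClosedFieldType) (n : nat).
Local Notation m := n.+1.
Local Notation V := (Vsym K m).

(** The lower bound for [dim T] is coisotropy and the local dimension is half of the ambient one, so
    an upper bound is all that remains. *)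
Lemma Zinv_smoothP v (T : {vspace V}) : Zinv v -> [set` T] = tangent (@Zinv K m) v ->
  (\dim T + \dim T <= \dim {:V})%N -> smooth_point (@Zinv K m) v.
Proof.
move=> Zv TE dT; have [U [inU dU]] := half_space K m; split=> //.
exists T; split=> //; apply/(has_local_dim_Zinv inU _ Zv).
have [ge _] := Zinv_tangent_dim (ltn0Sn n) Zv TE.
rewrite [RHS](_ : _ = \dim U); last by rewrite dimvf.
by rewrite dU in ge dT; lia.
Qed.

Lemma Zinv_lagrangian v : smooth_point (@Zinv K m) v ->
  tangent (@Zinv K m) v = perp (omega_sym K m) (tangent (@Zinv K m) v).
Proof.
move=> [Zv [T [TE /has_local_dim_Zinv]]]; have [U [inU dU]] := half_space K m.
move=> /(_ _ inU Zv); rewrite [X in _ = X](_ : _ = \dim U) ?dimvf // => dT.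
have [_] := Zinv_tangent_dim (ltn0Sn n) Zv TE; apply.
by rewrite dU dT.
Qed.

Lemma Xinv_legendrian : legendrian (omega_sym K m) (Xinv_sym K m).
Proof.
split; first exact: pclosed_pclosure.
by split; [exact: zclosed_Zinv | exact: Zinv_lagrangian].
Qed.

End Legendrian.

(** * Singular points for m >= 5 *)

Lemma XinvP (K : numClosedFieldType) m (x : proj (Vsym K m)) v :
  homog_coord x v -> Xinv_sym K m x <-> @Zinv K m v.
Proof.
move=> xv; split=> [Xx | [v0 | [y Xy yv]]]; first by right; exists x.
  by case: xv => _ /eqP.
by rewrite (homog_coord_inj xv yv).
Qed.

Section DiagonalCurves.
Variables (K : numClosedFieldType) (m : nat).
Hypothesis m0 : (0 < m)%N.

Definition diagf (a : 'I_m -> K) : 'M[K]_m := diag_mx (\row_i a i).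

Lemma diagf_sym a : (diagf a)^T = diagf a.
Proof. exact: tr_diag_mx. Qed.

Lemma jet_exp k : jet (fun t : K => t ^+ k) (k == 0%N)%:R (k == 1%N)%:R.
Proof.
have := jetX k (jet_id K); rewrite mul1r !expr0n.
by case: k => [|[|k]] /=; rewrite ?mulr0n ?mul0rn ?mulr1n.
Qed.

(* For [t != 0] the pair [diag (t ^ alpha_i)], [diag (t ^ beta_i)] is [t ^ f] times
   a pair with [det A = 1], [B = A ^-1]; [v] and [w] are its value and its
   derivative at [0]. *)
Lemma diagonal_curve (alpha beta : 'I_m -> nat) f :
  (forall i, alpha i + beta i = f + f)%N -> (\sum_i alpha i = m * f)%N ->
  let v := mkV (diagf (fun i => (alpha i == 0%N)%:R)) (diagf (fun i => (beta i == 0%N)%:R)) in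
  let w := mkV (diagf (fun i => (alpha i == 1%N)%:R)) (diagf (fun i => (beta i == 1%N)%:R)) in
  @Zinv K m v /\ tangent (@Zinv K m) v w.
Proof.
move=> ab suma v w.
pose c t : Vsym K m := mkV (diagf (fun i => t ^+ alpha i)) (diagf (fun i => t ^+ beta i)).
have jd (e : 'I_m -> nat) i j : jet (fun t : K => diagf (fun i => t ^+ e i) i j)
    (diagf (fun i => (e i == 0%N)%:R) i j) (diagf (fun i => (e i == 1%N)%:R) i j).
  rewrite !mxE; have [->|ij] := eqVneq i j.
    by rewrite !mulr1n; apply: (jet_ext (jet_exp (e j))) => t; rewrite !mxE eqxx mulr1n.
  by rewrite !mulr0n; apply: (jet_ext (jetC 0)) => t; rewrite !mxE (negPf ij) mulr0n.
have Hc : curve_jet c v w.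
  apply: curve_jet_Vsym => i j; rewrite /v /w ?vA_mk ?vB_mk ?diagf_sym //.
    by apply: (jet_ext (jd alpha i j)) => t; rewrite vA_mk ?diagf_sym.
  by apply: (jet_ext (jd beta i j)) => t; rewrite vB_mk ?diagf_sym.
apply: (Zinv_curve m0 Hc (r := 'X)); first by rewrite polyX_eq0.
move=> t; rewrite hornerX => t0; apply: INVc_Zinv => //.
have scl (e : 'I_m -> nat) :
    diagf (fun i => t ^+ e i) = t ^+ f *: diagf (fun i => t ^+ e i / t ^+ f).
  apply/matrixP => i j; rewrite !mxE mulrnAr; congr (_ *+ _).
  by rewrite mulrCA divff ?mulr1 // expf_neq0.
rewrite /c !scl; apply: INVc_mk; first exact: diagf_sym.
  rewrite det_diag; under eq_bigr do rewrite mxE.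
  rewrite big_split /= prodr_const card_ord -exprVn -!exprM -expr_sum suma mulnC.
  by rewrite exprVn divff // expf_neq0.
apply/matrixP => i j; rewrite mulmx_diag !mxE; case: eqP => [->|_]; rewrite ?mulr0n //.
by rewrite !mulr1n mulf_div -!exprD ab divff // expf_neq0.
Qed.

End DiagonalCurves.

Lemma Xinv_singular (K : numClosedFieldType) m : (5 <= m)%N -> psingular (Xinv_sym K m).
Proof.
(* Two curves through [(E_00, 0)] with velocities [(E_11, 0)] and [(0, E_11)]:
   these are not orthogonal, so the tangent space there is not Lagrangian. *)
case: m => [|[|[|[|[|k]]]]] // _.
(* For [m = 5] the three weights after [0, 1] sum to [5 f - 1] and are at most [2 f - 2], so that no
   weight of [B] is 0 or 1; [f = 5] is the least solution. The second pair of lists has [f = 3],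
   with weight 1 on the side of [B]. The default values are [f] itself, which keeps both conditions
   of [diagonal_curve] for every larger [m]. *)
pose al1 (i : 'I_(k.+4.+1)) := nth 5%N [:: 0; 1; 8; 8; 8]%N i.
pose be1 (i : 'I_(k.+4.+1)) := nth 5%N [:: 10; 9; 2; 2; 2]%N i.
pose al2 (i : 'I_(k.+4.+1)) := nth 3%N [:: 0; 5; 4]%N i.
pose be2 (i : 'I_(k.+4.+1)) := nth 3%N [:: 6; 1; 2]%N i.
have ab1 i : (al1 i + be1 i = 5 + 5)%N.
  by case: i => [[|[|[|[|[|i]]]]] ilt]; rewrite /al1 /be1 //= ?nth_nil.
have ab2 i : (al2 i + be2 i = 3 + 3)%N.
  by case: i => [[|[|[|i]]] ilt]; rewrite /al2 /be2 //= ?nth_nil.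
have s1 : (\sum_i al1 i = k.+4.+1 * 5)%N.
  rewrite !big_ord_recl (eq_bigr (fun=> 5%N)) => [|i _]; last by rewrite /al1 !lift0 /= ?nth_nil.
  by rewrite sum_nat_const card_ord /al1 !lift0 /=; lia.
have s2 : (\sum_i al2 i = k.+4.+1 * 3)%N.
  rewrite !big_ord_recl (eq_bigr (fun=> 3%N)) => [|i _]; last by rewrite /al2 !lift0 /= ?nth_nil.
  by rewrite sum_nat_const card_ord /al2 !lift0 /=; lia.
have [Zv T1] := diagonal_curve K (ltn0Sn _) ab1 s1.
have [_ T2] := diagonal_curve K (ltn0Sn _) ab2 s2.
pose e0 := delta_mx 0 0 : 'M[K]_(k.+4.+1); pose i1 := lift ord0 ord0 : 'I_(k.+4.+1).
pose e1 := delta_mx i1 i1 : 'M[K]_(k.+4.+1).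
have dE (b : 'I_(k.+4.+1) -> bool) a : (forall i, b i = (i == a)) ->
    diagf (fun i => (b i)%:R) = delta_mx a a :> 'M[K]_(k.+4.+1).
  move=> Hb; apply/matrixP => i j; rewrite !mxE Hb.
  by have [->|ij] := eqVneq i j; rewrite ?andbb //= (mulr0n, mulr1n) //;
    case: eqP => //= ia; rewrite -ia eq_sym (negPf ij).
have d0 (b : 'I_(k.+4.+1) -> bool) : (forall i, b i = false) ->
    diagf (fun i => (b i)%:R) = 0 :> 'M[K]_(k.+4.+1).
  by move=> Hb; apply/matrixP => i j; rewrite !mxE Hb mul0rn.
have e10 : diagf (fun i => (al1 i == 0%N)%:R) = e0.
  apply: dE => i; rewrite -val_eqE /=.
  by case: i => [[|[|[|[|[|i]]]]] ilt]; rewrite /al1 //= ?nth_nil.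
have e20 : diagf (fun i => (al2 i == 0%N)%:R) = e0.
  apply: dE => i; rewrite -val_eqE /=.
  by case: i => [[|[|[|i]]] ilt]; rewrite /al2 //= ?nth_nil.
have e11 : diagf (fun i => (al1 i == 1%N)%:R) = e1.
  apply: dE => i; rewrite -val_eqE /=.
  by case: i => [[|[|[|[|[|i]]]]] ilt]; rewrite /al1 //= ?nth_nil.
have e21 : diagf (fun i => (be2 i == 1%N)%:R) = e1.
  apply: dE => i; rewrite -val_eqE /=.
  by case: i => [[|[|[|i]]] ilt]; rewrite /be2 //= ?nth_nil.
have f10 : diagf (fun i => (be1 i == 0%N)%:R) = 0 :> 'M[K]_(k.+4.+1).
  by apply: d0 => i; case: i => [[|[|[|[|[|i]]]]] ilt]; rewrite /be1 //= ?nth_nil.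
have f11 : diagf (fun i => (be1 i == 1%N)%:R) = 0 :> 'M[K]_(k.+4.+1).
  by apply: d0 => i; case: i => [[|[|[|[|[|i]]]]] ilt]; rewrite /be1 //= ?nth_nil.
have f20 : diagf (fun i => (be2 i == 0%N)%:R) = 0 :> 'M[K]_(k.+4.+1).
  by apply: d0 => i; case: i => [[|[|[|i]]] ilt]; rewrite /be2 //= ?nth_nil.
have f21 : diagf (fun i => (al2 i == 1%N)%:R) = 0 :> 'M[K]_(k.+4.+1).
  by apply: d0 => i; case: i => [[|[|[|i]]] ilt]; rewrite /al2 //= ?nth_nil.
rewrite e10 f10 in Zv T1; rewrite e11 f11 in T1; rewrite e20 f20 f21 e21 in T2.
have se0 : e0^T = e0 by rewrite trmx_delta.
have se1 : e1^T = e1 by rewrite trmx_delta.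
have s0 : (0 : 'M[K]_(k.+4.+1))^T = 0 by rewrite trmx0.
have v0 : mkV e0 0 != 0.
  apply/eqP => /(congr1 (fun v => vA v 0 0)); rewrite vA_mk // vA0 !mxE eqxx /=.
  by move/eqP; rewrite oner_eq0.
exists (line v0); first by apply/(XinvP (homog_coord_line v0)).
move=> [_ /(_ _ (homog_coord_line v0)) /Zinv_lagrangian LT].
have : perp (omega_sym K (k.+4.+1)) (tangent (@Zinv K (k.+4.+1)) (mkV e0 0)) (mkV 0 e1) by rewrite -LT.
move=> /(_ _ T1); rewrite omega_symE !vA_mk ?vB_mk // mul0mx mxtrace0 subr0.
by rewrite mul_delta_mx -[delta_mx _ _]mul1mx mxtrace_delta mxE eqxx => /eqP; rewrite oner_eq0.
Qed.

(** * Group action and a smoothness criterion *)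

Section Moves.
Variables (K : numClosedFieldType) (n : nat).
Local Notation m := n.+1.
Local Notation V := (Vsym K m).
Local Notation Zinv := (@Zinv K m).
Local Notation INVc := (@INVc K m).

Definition shear (c : 'rV[K]_m) : 'M[K]_m := 1%:M + delta_mx 0 0 *m c.

Lemma shear_aux (c : 'rV[K]_m) : c 0 0 = 0 -> c *m (delta_mx 0 0 : 'cV_m) = 0.
Proof. by move=> c0; rewrite -colE; apply/matrixP => i j; rewrite !ord1 !mxE c0. Qed.

Lemma shearK (c : 'rV[K]_m) : c 0 0 = 0 -> shear c *m shear (- c) = 1%:M.
Proof.
move=> c0; rewrite /shear mulmxN mulmxBr mulmx1 mulmxDl mul1mx.
rewrite -mulmxA (mulmxA c) (shear_aux c0) ?mul0mx ?mulmx0 ?addr0 ?addrK //.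
Qed.

Lemma det_shear (c : 'rV[K]_m) : c 0 0 = 0 -> \det (shear c) = 1.
Proof.
move=> c0; rewrite /shear det_1addM (shear_aux c0) ?addr0 ?det1 //.
Qed.

(** The new corner is the value of the quadratic form of [A] at [e_0 + c]. If all these values
    vanish, then comparing [c = 0], [e_i], [- e_i] and [e_i + e_j] gives back every entry of [A] by
    polarisation, as 2 is invertible. *)
Lemma shear_neq0 (A : 'M[K]_m) : A^T = A -> A != 0 ->
  exists2 c : 'rV[K]_m, c 0 0 = 0 & (shear c *m A *m (shear c)^T) 0 0 != 0.
Proof.
move=> sA A0; apply: contrapT => H; case/eqP: A0.
pose e i : 'rV[K]_m := delta_mx 0 i.
pose Q (x y : 'rV[K]_m) := (x *m A *m y^T) 0 0.
have QD x y z : Q (x + y) z = Q x z + Q y z by rewrite /Q !mulmxDl mxE.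
have QC x y : Q x y = Q y x.
  rewrite /Q; transitivity ((x *m A *m y^T)^T 0 0); first by rewrite [RHS]mxE.
  by rewrite !trmx_mul trmxK sA mulmxA.
have Qe i j : Q (e i) (e j) = A i j.
  by rewrite /Q /e trmx_delta -rowE -colE !mxE.
have Qz (c : 'rV[K]_m) : c 0 0 = 0 -> Q (e 0 + c) (e 0 + c) = 0.
  move=> c0; apply/eqP; apply: contraT => nz; case: H; exists c => //.
  have E : row 0 (shear c) = e 0 + c.
    rewrite /shear linearD /= row1 row_mul (_ : row 0 (delta_mx 0 0) = 1%:M) ?mul1mx //.
    by apply/matrixP => i j; rewrite !ord1 !mxE.
  move: nz; rewrite /Q -E; congr (_ != 0).
  by rewrite -row_mul !mxE; apply: eq_bigr => k _; rewrite !mxE.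
have two (x : K) : x + x = 0 -> x = 0.
  by move/eqP; rewrite -mulr2n mulrn_eq0 /= => /eqP.
have QDr x y z : Q z (x + y) = Q z x + Q z y by rewrite QC QD !(QC z).
have QN x z : Q (- x) z = - Q x z by rewrite /Q !mulNmx mxE.
have A00 : A 0 0 = 0 by have := Qz 0; rewrite addr0 Qe mxE; apply.
have ec i : i != 0 -> (e i) 0 0 = 0 by rewrite mxE eq_sym => /negPf ->.
have A0i i : A 0 i = 0 /\ A i i = 0.
  have [->//|i0] := eqVneq i 0.
  have := Qz (e i) (ec _ i0); rewrite QD !QDr !Qe A00 add0r.
  have Aji : A i 0 = A 0 i by rewrite -{1}sA mxE.
  have := Qz (- e i); rewrite mxE (ec _ i0) oppr0 => /(_ erefl).
  rewrite QD !QDr !(QC _ (- _)) !QN !(QC _ (- _)) !QN !Qe A00 add0r opprK Aji addrA => E1 E2.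
  have Aii : A i i = 0.
    by apply: two; have := congr2 +%R E1 E2; rewrite addr0 => E; rewrite -[RHS]E; ring.
  by split=> //; apply: two; rewrite -[RHS]E2 Aii ?Aji; ring.
apply/matrixP => i j; rewrite mxE.
have [->|i0] := eqVneq i 0; first by case: (A0i j).
have [->|j0] := eqVneq j 0; first by rewrite -sA mxE; case: (A0i i).
have := Qz (e i + e j); rewrite mxE (ec _ i0) (ec _ j0) addr0 => /(_ erefl).
have Aji : A j i = A i j by rewrite -{1}sA mxE.
have A_i0 k : A k 0 = 0 by rewrite -sA mxE; case: (A0i k).
have [A0i' Aii] := A0i i; have [A0j Ajj] := A0i j.
rewrite !QD !QDr !Qe A00 !A_i0 A0i' A0j Aii Ajj Aji !add0r addr0.
exact: two.
Qed.

Lemma Zinv_map (F : V -> V) : (forall l, linform l -> linform (fun v => l (F v))) ->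
  (forall v, INVc v -> INVc (F v)) -> forall v, Zinv v -> Zinv (F v).
Proof.
move=> linF HF v Zv; apply/ZinvP => // p Ip.
apply: (@Zinv_pfun K m (ltn0Sn n) (fun v => polyfun p (F v))) Zv => [|u Cu].
  apply: (falg_pfun (pfunP V)); first by exists p.
  by move=> i; apply: pfun_linform; apply: linF; exact: linform_vcoord.
by apply: Ip; exact: HF.
Qed.

Lemma tangent_map (F : 'Hom(V, V)) : (forall v, Zinv v -> Zinv (F v)) ->
  forall v w, tangent Zinv v w -> tangent Zinv (F v) (F w).
Proof.
move=> HF v w Tw p Ip.
have pF : pfun (fun v => polyfun p (F v)).
  apply: (falg_pfun (pfunP V)); first by exists p.
  by move=> i; apply: pfun_linform => a u u'; rewrite !linearP.
have := polyfun_curve p (curve_jet_line (F v) (F w)).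
move/jet_ext => /(_ (fun t => polyfun p (F (v + t *: w)))) H.
apply: (tangent_jet Tw pF _ (H _)) => [u Zu | t]; first exact: Ip (HF _ Zu).
by rewrite linearD linearZ.
Qed.

Lemma swap_map : exists F : 'Hom(V, V),
  [/\ forall v, vA (F v) = vB v, forall v, vB (F v) = vA v,
      forall v, Zinv v -> Zinv (F v) & injective F].
Proof.
have [|F HF] := @linear_hom K V V (fun v => mkV (vB v) (vA v)).
  by move=> a u v; apply: Vsym_eq; rewrite !(vAD, vBD, vAZ, vBZ) ?vA_mk ?vB_mk
    ?linearD ?linearZ /= ?vB_sym ?vA_sym.
have FA v : vA (F v) = vB v by rewrite HF vA_mk ?vB_sym ?vA_sym.
have FB v : vB (F v) = vA v by rewrite HF vB_mk ?vB_sym ?vA_sym.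
exists F; split; [exact: FA | exact: FB | | move=> u v E]; last first.
  by apply: Vsym_eq; rewrite -?FB -?FA E.
apply: Zinv_map => [l ll a u v|v [s [A [B [sA dA AB eA eB]]]]]; first by rewrite linearP ll.
exists s, B, A; rewrite FA FB; split=> //; [exact: inv_sym AB | | exact: mulmx1C].
by have := congr1 determinant AB; rewrite det_mulmx dA mul1r det1.
Qed.

Lemma conj_map (g h : 'M[K]_m) : \det g = 1 -> g *m h = 1%:M -> exists F : 'Hom(V, V),
  [/\ forall v, vA (F v) = g *m vA v *m g^T, forall v, vB (F v) = h^T *m vB v *m h,
      forall v, Zinv v -> Zinv (F v) & injective F].
Proof.
move=> dg gh; have hg : h *m g = 1%:M by exact: mulmx1C.
have sg v : (g *m vA v *m g^T)^T = g *m vA v *m g^T by rewrite !trmx_mul trmxK vA_sym mulmxA.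
have sh v : (h^T *m vB v *m h)^T = h^T *m vB v *m h by rewrite !trmx_mul trmxK vB_sym mulmxA.
have [|F HF] := @linear_hom K V V (fun v => mkV (g *m vA v *m g^T) (h^T *m vB v *m h)).
  move=> a u v; apply: Vsym_eq.
    by rewrite [in RHS]vAD [in RHS]vAZ !vA_mk // vAD vAZ mulmxDr mulmxDl -scalemxAr -scalemxAl.
  by rewrite [in RHS]vBD [in RHS]vBZ !vB_mk // vBD vBZ mulmxDr mulmxDl -scalemxAr -scalemxAl.
have FA v : vA (F v) = g *m vA v *m g^T by rewrite HF vA_mk.
have FB v : vB (F v) = h^T *m vB v *m h by rewrite HF vB_mk.
exists F; split; [exact: FA | exact: FB | | move=> u v E]; last first.
  apply: Vsym_eq.
    have : h *m vA (F u) *m h^T = h *m vA (F v) *m h^T by rewrite E.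
    by rewrite !FA !mulmxA hg !mul1mx -!mulmxA -!trmx_mul hg trmx1 !mulmx1.
  have : g^T *m vB (F u) *m g = g^T *m vB (F v) *m g by rewrite E.
  by rewrite !FB !mulmxA -!trmx_mul hg trmx1 !mul1mx -!mulmxA hg !mulmx1.
apply: Zinv_map => [l ll a u v|v [s [A [B [sA dA AB eA eB]]]]]; first by rewrite linearP ll.
exists s, (g *m A *m g^T), (h^T *m B *m h); rewrite FA FB eA eB -!scalemxAr -!scalemxAl.
split=> //; first by rewrite !trmx_mul trmxK sA mulmxA.
  by rewrite !det_mulmx det_tr dg dA !mulr1.
rewrite !mulmxA -(mulmxA _ g^T) -trmx_mul hg trmx1 mulmx1.
by rewrite -(mulmxA _ A) AB mulmx1.
Qed.

Lemma tangent_space v : exists T : {vspace V}, [set` T] = tangent Zinv v.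
Proof.
apply: subset_vspace => [p Ip | a u w Tu Tw p Ip]; rewrite /dirderiv.
  by rewrite big1 // => i _; rewrite linear0 mulr0.
under eq_bigr do rewrite linearP mulrDr mulrCA.
by rewrite big_split -mulr_sumr /= -/(dirderiv p v u) Tu // mulr0 add0r -/(dirderiv p v w) Tw.
Qed.

(* This Lagrangian subspace is complementary, for [m = 3, 4], to the tangent space
   of the cone at [(E_00, 0)]. *)
Definition transverse (w : V) :=
  (forall j, vA w 0 j = 0) /\ forall i j, i != 0 -> j != 0 -> vB w i j = 0.

(** [C] is the kernel of a coordinate projection [F]; exchanging the two blocks embeds the image of
    [F] into [C], so [C] has at least half of the dimension. *)
Lemma transverse_space : exists C : {vspace V},
  (forall w, w \in C <-> transverse w) /\ (\dim {:V} <= \dim C + \dim C)%N.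
Proof.
pose P1 (X : 'M[K]_m) : 'M[K]_m := \matrix_(i, j) (if (i == 0) || (j == 0) then X i j else 0).
pose P2 (X : 'M[K]_m) : 'M[K]_m := \matrix_(i, j) (if (i == 0) || (j == 0) then 0 else X i j).
have P1s X : X^T = X -> (P1 X)^T = P1 X.
  by move=> sX; apply/matrixP => i j; rewrite !mxE orbC -{1}sX mxE.
have P2s X : X^T = X -> (P2 X)^T = P2 X.
  by move=> sX; apply/matrixP => i j; rewrite !mxE orbC -{1}sX mxE.
have P1l a X Y : P1 (a *: X + Y) = a *: P1 X + P1 Y.
  by apply/matrixP => i j; rewrite !mxE; case: ifP => _ //; rewrite mulr0 addr0.
have P2l a X Y : P2 (a *: X + Y) = a *: P2 X + P2 Y.
  by apply/matrixP => i j; rewrite !mxE; case: ifP => _ //; rewrite mulr0 addr0.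
have [|F HF] := @linear_hom K V V (fun v => mkV (P1 (vA v)) (P2 (vB v))).
  move=> a u v; have sA := vA_sym; have sB := vB_sym.
  apply: Vsym_eq.
    by rewrite [in RHS]vAD [in RHS]vAZ !vA_mk ?P1s ?P2s // vAD vAZ P1l.
  by rewrite [in RHS]vBD [in RHS]vBZ !vB_mk ?P1s ?P2s // vBD vBZ P2l.
have FA v : vA (F v) = P1 (vA v) by rewrite HF vA_mk ?P1s ?P2s ?vA_sym ?vB_sym.
have FB v : vB (F v) = P2 (vB v) by rewrite HF vB_mk ?P1s ?P2s ?vA_sym ?vB_sym.
have inC w : w \in lker F <-> transverse w.
  rewrite memv_ker; split=> [/eqP E | [H1 H2]].
    split=> [j | i j /negPf i0 /negPf j0].
      by have /(congr1 (fun v => vA v 0 j)) := E; rewrite FA vA0 !mxE.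
    by have /(congr1 (fun v => vB v i j)) := E; rewrite FB vB0 !mxE i0 j0.
  apply/eqP/Vsym_eq; rewrite ?FA ?FB ?vA0 ?vB0; apply/matrixP => i j; rewrite !mxE.
    have [->|i0] := eqVneq i 0; first by rewrite H1.
    by have [->|j0] := eqVneq j 0; rewrite // vAC H1.
  have [//|i0] := eqVneq i 0; have [//|j0] := eqVneq j 0.
  by rewrite H2.
exists (lker F); split=> //.
rewrite -[leqLHS](limg_ker_dim F) capfv leq_add2l.
have [S [SA SB _ Sinj]] := swap_map.
rewrite -(@limg_dim_eq _ _ _ S); last first.
  by apply/eqP; rewrite -subv0; move/lker0P/eqP: Sinj => ->; rewrite capv0 subvv.
apply/dimvS/subvP => _ /memv_imgP[_ /memv_imgP[u _ ->] ->]; apply/inC; split.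
  by move=> j; rewrite SA FB mxE eqxx.
by move=> i j /negPf i0 /negPf j0; rewrite SB FA mxE i0 j0.
Qed.

(** The moved tangent space meets [C] only in 0, and [C] has at least half of the dimension, so the
    tangent space has at most half. *)
Lemma smooth_of_transverse v (F : 'Hom(V, V)) : Zinv v -> injective F ->
  (forall v, Zinv v -> Zinv (F v)) ->
  (forall w, tangent Zinv (F v) w -> transverse w -> w = 0) -> smooth_point Zinv v.
Proof.
move=> Zv Finj FZ H; have [T TE] := tangent_space v.
have [C [inC dC]] := transverse_space.
apply: (Zinv_smoothP Zv TE).
rewrite -(@limg_dim_eq _ _ _ F T); last first.
  by apply/eqP; rewrite -subv0; move/lker0P/eqP: Finj => ->; rewrite capv0 subvv.
have cap0 : (F @: T :&: C)%VS = 0%VS.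
  apply/eqP; rewrite -subv0; apply/subvP => w; rewrite memv_cap memv0.
  move=> /andP[/memv_imgP[u uT ->] /inC tr]; apply/eqP; apply: H tr.
  apply: (tangent_map FZ); rewrite -TE; exact: uT.
have := dimvS (subvf (F @: T + C)%VS); rewrite dimv_disjoint_sum //.
lia.
Qed.

Lemma psmooth_of_transverse :
  (forall v w, Zinv v -> vA v 0 0 != 0 -> tangent Zinv v w -> transverse w -> w = 0) ->
  psmooth (Xinv_sym K m).
Proof.
move=> H x Xx; split; first exact: Xx.
move=> v xv; have Zv : Zinv v by apply/(XinvP xv).
have [S [SA SB SZ Sinj]] := swap_map.
have main u : Zinv u -> vA u != 0 -> exists F : 'Hom(V, V), [/\ injective F,
    forall v, Zinv v -> Zinv (F v) & vA (F u) 0 0 != 0].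
  move=> Zu u0; have [c c0 Hc] := shear_neq0 (vA_sym u) u0.
  have [F [FA _ FZ Finj]] := conj_map (det_shear c0) (shearK c0).
  by exists F; split; [exact: Finj | exact: FZ | rewrite FA].
have [vA0'|vA0'] := eqVneq (vA v) 0; last first.
  have [F [Finj FZ F0]] := main v Zv vA0'.
  apply: (smooth_of_transverse Zv Finj FZ) => w; apply: H; [exact: FZ | exact: F0].
have vB0' : vA (S v) != 0.
  rewrite SA; case: xv => _; apply: contra => /eqP E; apply/eqP/Vsym_eq.
    by rewrite vA0' vA0.
  by rewrite E vB0.
have [F [Finj FZ F0]] := main _ (SZ _ Zv) vB0'.
have FSE u : (F \o S)%VF u = F (S u) by rewrite lfunE.
apply: (@smooth_of_transverse v (F \o S)%VF); first exact: Zv.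
- by move=> u u'; rewrite !FSE => /Finj/Sinj.
- by move=> u Zu; rewrite FSE; apply/FZ/SZ.
- move=> w; rewrite FSE; apply: H; [exact/FZ/SZ | exact: F0].
Qed.

End Moves.

(** * Equations of the cone and smoothness for m = 3, 4 *)

Section Equations.
Variables (K : numClosedFieldType) (n : nat).
Local Notation m := n.+1.
Local Notation V := (Vsym K m).
Local Notation Zinv := (@Zinv K m).
Local Notation INVc := (@INVc K m).

Definition lower (B : 'M[K]_m) : 'M[K]_n := row' 0 (col' 0 B).

(** The Schur complement of the corner entry, multiplied by this entry: the 2 x 2 minors of [A] that
    contain the corner. *)
Definition schur (A : 'M[K]_m) : 'M[K]_n :=
  \matrix_(i, j) (A 0 0 * A (lift 0 i) (lift 0 j) - A (lift 0 i) 0 * A 0 (lift 0 j)).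

Lemma inv_corner (A B : 'M[K]_m) : \det A = 1 -> A *m B = 1%:M ->
  A 0 0 = \det (lower B).
Proof.
move=> dA AB; have dB : \det B = 1.
  by have := congr1 determinant AB; rewrite det_mulmx dA mul1r det1.
rewrite {1}(inv_adj dB (mulmx1C AB)) mxE /cofactor addn0 expr0 mul1r.
by congr (\det _); apply/matrixP => i j; rewrite !mxE.
Qed.

(* Jacobi's identity for complementary minors. *)
Lemma schur_inv (A B : 'M[K]_m) : \det A = 1 -> A *m B = 1%:M -> A 0 0 != 0 ->
  schur A = \adj (lower B).
Proof.
move=> dA AB A0; have a := inv_corner dA AB.
have SB : schur A *m lower B = (A 0 0)%:M.
  apply/matrixP => i j; rewrite mxE.
  have ABe k l : A k 0 * B 0 l + \sum_j A k (lift 0 j) * B (lift 0 j) l = (k == l)%:R.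
    by have /matrixP/(_ k l) := AB; rewrite !mxE big_ord_recl.
  have E1 := ABe 0 (lift 0 j); have E2 := ABe (lift 0 i) (lift 0 j).
  transitivity (A 0 0 * \sum_k A (lift 0 i) (lift 0 k) * B (lift 0 k) (lift 0 j)
     - A (lift 0 i) 0 * \sum_k A 0 (lift 0 k) * B (lift 0 k) (lift 0 j)).
    rewrite !mulr_sumr -sumrB; apply: eq_bigr => k _; rewrite !mxE; ring.
  rewrite eq_liftF in E1; rewrite (inj_eq lift_inj) in E2.
  rewrite !mxE -mulr_natr -E2; move/eqP: E1; rewrite addrC addr_eq0 => /eqP ->; ring.
have := congr1 (mulmxr (\adj (lower B))) SB; rewrite /= -mulmxA mul_mx_adj -a.
rewrite mul_scalar_mx mul_mx_scalar => /(congr1 ( *:%R (A 0 0)^-1)).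
by rewrite !scalerA mulVf // !scale1r.
Qed.

(** The product of [h] with the corner entry vanishes on the cone; pulled back along [Phi], one of
    the factors vanishes, and it is not the corner entry, which is 1 at the pair of identity
    matrices. *)
Lemma Zinv_pfun_gen h v : pfun h -> (forall u, INVc u -> vA u 0 0 != 0 -> h u = 0) ->
  Zinv v -> h v = 0.
Proof.
move=> ph H Zv; have [U [inU _]] := half_space K m.
have p1 := pfun_Phi U ph.
have p2 := pfun_Phi U (@pfun_vA K m 0 0).
have [c|H1|H1] := pfun_mul_eq0 p1 p2.
- have pp : pfun (fun v : V => h v * vA v 0 0).
    by apply: (falgM (pfunP V)) => //; exact: pfun_vA.
  apply: (Zinv_pfun (ltn0Sn n) pp _ (Zinv_Phi inU c)) => u Cu.
  by have [->|u0] := eqVneq (vA u 0 0) 0; rewrite ?mulr0 // H ?mul0r.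
- exact: (Zinv_of_Phi inU ph H1 Zv).
- have := Zinv_of_Phi inU (@pfun_vA K m 0 0) H1 (INVc_Zinv (ltn0Sn n) (INVc1 K m)).
  by rewrite vA_mk ?trmx1 // mxE eqxx => /eqP; rewrite oner_eq0.
Qed.

Lemma pfun_schur i j : pfun (fun v : V => schur (vA v) i j).
Proof.
have -> : (fun v : V => schur (vA v) i j) = fun v : V => vA v 0 0 * vA v (lift 0 i) (lift 0 j)
    - vA v (lift 0 i) 0 * vA v 0 (lift 0 j) by apply/funext => v; rewrite mxE.
have HP := pfunP V; have pA := @pfun_vA K m.
by apply: (falgB HP); apply: (falgM HP) => //; exact: pA.
Qed.

Lemma mxfun_lower : mxfun (@pfun K V) (fun v => lower (vB v)).
Proof.
move=> i j; have -> : (fun v : V => lower (vB v) i j) = fun v => vB v (lift 0 i) (lift 0 j).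
  by apply/funext => v; rewrite !mxE.
exact: pfun_vB.
Qed.

Lemma mxfun_AB : mxfun (@pfun K V) (fun v => vA v *m vB v).
Proof. by apply: (mxfunM (pfunP V)); [exact: pfun_vA | exact: pfun_vB]. Qed.

Lemma Zinv_AB v : Zinv v -> vA v *m vB v = ((vA v *m vB v) 0 0)%:M.
Proof.
have AB u : INVc u -> exists a : K, vA u *m vB u = a%:M.
  move=> [s [A [B [_ _ AB -> ->]]]]; exists (s * s).
  by rewrite -scalemxAl -scalemxAr scalerA AB scalemx1.
move=> Zv; apply/matrixP => i j; rewrite [RHS]mxE.
have [<-|ij] := eqVneq i j.
  rewrite mulr1n; apply/eqP; rewrite -subr_eq0; apply/eqP.
  apply: (Zinv_pfun (ltn0Sn n) (h := fun v => (vA v *m vB v) i i - (vA v *m vB v) 0 0)) Zv.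
    by apply: (falgB (pfunP V)); exact: mxfun_AB.
  by move=> u /AB[a ->]; rewrite !mxE !eqxx subrr.
rewrite mulr0n; apply: (Zinv_pfun (ltn0Sn n) (h := fun v => (vA v *m vB v) i j)) Zv.
  exact: mxfun_AB.
by move=> u /AB[a ->]; rewrite mxE (negPf ij).
Qed.

Lemma lower_line v w t : transverse w -> lower (vB (v + t *: w)) = lower (vB v).
Proof.
by move=> [_ H]; rewrite vBD vBZ; apply/matrixP => i j; rewrite !mxE H ?mulr0 ?addr0.
Qed.

Lemma schur_line v w t i j : transverse w ->
  schur (vA (v + t *: w)) i j =
  schur (vA v) i j + t * (vA v 0 0 * vA w (lift 0 i) (lift 0 j)).
Proof.
by move=> [H _]; rewrite vAD vAZ !mxE (vAC w (lift 0 i) 0) !H; ring.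
Qed.

(* Transverse tangent vectors vanish as soon as some equation expresses the
   lower right block of [A] through that of [B] where [A 0 0] is invertible. *)
Lemma transverse_eq0 v w : Zinv v -> vA v 0 0 != 0 ->
  tangent Zinv v w -> transverse w ->
  (forall i j : 'I_n, vA w (lift 0 i) (lift 0 j) = 0) -> (0 < n)%N -> w = 0.
Proof.
move=> Zv A0 Tw tr Aw n0.
have [H1 H2] := tr.
have wA : vA w = 0.
  apply/matrixP => i j; rewrite mxE.
  have [i' ->|->] := unliftP 0 i; last exact: H1.
  by have [j' ->|->] := unliftP 0 j; [exact: Aw | rewrite vAC H1].
have jAB i j : jet (fun t => (vA (v + t *: w) *m vB (v + t *: w)) i j)
    ((vA v *m vB v) i j) ((vA v *m vB w) i j).
  apply: (mxjet_quad (M2 := 0)) => t.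
  by rewrite vAD vBD vAZ vBZ wA scaler0 addr0 mulmxDr -scalemxAr scaler0 addr0.
have ent i j : (j != 0) -> (vA v *m vB w) i j = vA v i 0 * vB w 0 j.
  move=> j0; rewrite mxE big_ord_recl big1 ?addr0 // => k _.
  by rewrite H2 ?mulr0.
have B0j j : j != 0 -> vB w 0 j = 0.
  move=> j0; have : (vA v *m vB w) 0 j = 0.
    apply: (tangent_jet Tw (mxfun_AB 0 j)) (jAB 0 j) => u /Zinv_AB ->.
    by rewrite mxE eq_sym (negPf j0).
  by rewrite ent // => /eqP; rewrite mulf_eq0 (negPf A0) => /eqP.
have B00 : vB w 0 0 = 0.
  pose k : 'I_m := lift 0 (Ordinal n0).
  have k0 : k != 0 by [].
  have : (vA v *m vB w) 0 0 - (vA v *m vB w) k k = 0.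
    have pp : pfun (fun u : V => (vA u *m vB u) 0 0 - (vA u *m vB u) k k).
      by apply: (falgB (pfunP V)); exact: mxfun_AB.
    apply: (tangent_jet Tw pp) => [u /Zinv_AB ->|]; first by rewrite !mxE !eqxx subrr.
    have := jetD (jAB 0 0) (jetZ (-1) (jAB k k)); rewrite !mulN1r.
    by move/jet_ext; apply=> t; rewrite mulN1r.
  rewrite (ent k) // (B0j k) // mulr0 subr0 mxE big_ord_recl big1 ?addr0.
    by move/eqP; rewrite mulf_eq0 (negPf A0) => /eqP.
  by move=> j _; rewrite vBC B0j ?mulr0.
apply: Vsym_eq; rewrite ?vA0 ?vB0 //; apply/matrixP => i j; rewrite [RHS]mxE.
have [->|i0] := eqVneq i 0; have [->|j0] := eqVneq j 0 => //.
- exact: B0j.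
- by rewrite vBC B0j.
- exact: H2.
Qed.

End Equations.

Section Smoothness.
Variable K : numClosedFieldType.

(** Jacobi's identity is stated for [det A = 1]. On [(s A, s B)] both sides are quadratic in [s]
    exactly because [lower] has size 3, so the identity holds on the cone as it stands. *)
Lemma Zinv4_schur v : @Zinv K 4 v -> schur (vA v) = \adj (lower (vB v)).
Proof.
move=> Zv; apply/matrixP => i j; apply/eqP; rewrite -subr_eq0; apply/eqP.
apply: (Zinv_pfun_gen (h := fun v : Vsym K 4 => schur (vA v) i j - \adj (lower (vB v)) i j)) Zv.
  apply: (falgB (pfunP _)); first exact: pfun_schur.
  by apply: mxfun_adj; [exact: pfunP | exact: mxfun_lower].
move=> u [s [A [B [sA dA AB -> ->]]]]; rewrite mxE mulf_eq0 negb_or => /andP[s0 A0].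
have := schur_inv dA AB A0 => /matrixP/(_ i j) E.
have -> : lower (s *: B) = s *: lower B by apply/matrixP => k l; rewrite !mxE.
rewrite adjZ [X in _ - X]mxE -E !mxE; ring.
Qed.

(** Here the adjugate is only linear. Multiplying the two sides by the numbers of [inv_corner],
    which agree when [det A = 1], makes both cubic in the scale. *)
Lemma Zinv3_schur v i j : @Zinv K 3 v ->
  vA v 0 0 * schur (vA v) i j = \det (lower (vB v)) * \adj (lower (vB v)) i j.
Proof.
move=> Zv; apply/eqP; rewrite -subr_eq0; apply/eqP.
apply: (Zinv_pfun_gen (h := fun v : Vsym K 3 => vA v 0 0 * schur (vA v) i j
   - \det (lower (vB v)) * \adj (lower (vB v)) i j)) Zv.
  have HP := pfunP (Vsym K 3).
  apply: (falgB HP); apply: (falgM HP); first exact: pfun_vA.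
  - exact: pfun_schur.
  - by apply: falg_det => //; exact: mxfun_lower.
  - by apply: mxfun_adj; [exact: pfunP | exact: mxfun_lower].
move=> u [s [A [B [sA dA AB -> ->]]]]; rewrite mxE mulf_eq0 negb_or => /andP[s0 A0].
have := schur_inv dA AB A0 => /matrixP/(_ i j) E.
have -> : lower (s *: B) = s *: lower B by apply/matrixP => k l; rewrite !mxE.
rewrite adjZ detZ -(inv_corner dA AB) [X in _ - _ * X]mxE -E !mxE; ring.
Qed.

Lemma psmooth4 : psmooth (Xinv_sym K 4).
Proof.
apply: psmooth_of_transverse => v w Zv A0 Tw tr.
apply: (transverse_eq0 Zv A0 Tw tr) => // i j.
have pp : pfun (fun v : Vsym K 4 => schur (vA v) i j - \adj (lower (vB v)) i j).
  apply: (falgB (pfunP _)); first exact: pfun_schur.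
  by apply: mxfun_adj; [exact: pfunP | exact: mxfun_lower].
have : vA v 0 0 * vA w (lift 0 i) (lift 0 j) = 0.
  apply: (tangent_jet Tw pp (a := schur (vA v) i j - \adj (lower (vB v)) i j)).
    by move=> u /Zinv4_schur ->; rewrite subrr.
  apply: (jet_ext (jet_quad _ _ 0)) => t.
  by rewrite schur_line // lower_line //; ring.
by move/eqP; rewrite mulf_eq0 (negPf A0) => /eqP.
Qed.

Lemma psmooth3 : psmooth (Xinv_sym K 3).
Proof.
apply: psmooth_of_transverse => v w Zv A0 Tw tr.
apply: (transverse_eq0 Zv A0 Tw tr) => // i j.
pose h (v : Vsym K 3) := vA v 0 0 * schur (vA v) i j
  - \det (lower (vB v)) * \adj (lower (vB v)) i j.
have ph : pfun h.
  have HP := pfunP (Vsym K 3).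
  apply: (falgB HP); apply: (falgM HP); first exact: pfun_vA.
  - exact: pfun_schur.
  - by apply: falg_det => //; exact: mxfun_lower.
  - by apply: mxfun_adj; [exact: HP | exact: mxfun_lower].
have : vA v 0 0 * (vA v 0 0 * vA w (lift 0 i) (lift 0 j)) = 0.
  apply: (tangent_jet Tw ph (a := h v)).
    by move=> u Zu; rewrite /h Zinv3_schur ?subrr.
  apply: (jet_ext (jet_quad _ _ 0)) => t.
  rewrite /h schur_line // lower_line //.
  have -> : vA (v + t *: w) 0 0 = vA v 0 0.
    by rewrite vAD vAZ !mxE tr.1 mulr0 addr0.
  ring.
by move/eqP; rewrite !mulf_eq0 !(negPf A0) => /eqP.
Qed.

End Smoothness.

(** * The case m = 2 *)

(** The polynomial is the characteristic polynomial of [- M], which is monic. Thus [M + t] is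
    invertible for generic [t]. *)
Lemma det_shift (K : numFieldType) m (M : 'M[K]_m) :
  exists2 r : {poly K}, r != 0 & forall t, r.[t] = \det (M + t%:M).
Proof.
exists (char_poly (- M)); first exact: monic_neq0 (char_poly_monic _).
move=> t; rewrite /char_poly -horner_evalE -det_map_mx; congr (\det _).
apply/matrixP => i j; rewrite !mxE /= horner_evalE !hornerE opprK hornerMn hornerX.
exact: addrC.
Qed.

Section Limits.
Variables (K : numClosedFieldType) (m : nat).
Hypothesis m0 : (0 < m)%N.

Lemma Zinv_limit (A B : K -> 'M[K]_m) (r : {poly K}) :
  mxfun (@upoly K) A -> mxfun (@upoly K) B ->
  (forall t, (A t)^T = A t) -> (forall t, (B t)^T = B t) -> r != 0 ->
  (forall t, r.[t] != 0 -> @Zinv K m (mkV (A t) (B t))) ->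
  forall t, @Zinv K m (mkV (A t) (B t)).
Proof.
move=> pA pB sA sB r0 H t; apply/ZinvP => // p Ip.
have [q Hq] : @upoly K (fun t => polyfun p (mkV (A t) (B t))).
  apply: falg_pfun_Vsym; [exact: upolyP | | | by exists p].
    have -> : (fun t => vA (mkV (A t) (B t))) = A by apply/funext => u; rewrite vA_mk.
    exact: pA.
  have -> : (fun t => vB (mkV (A t) (B t))) = B by apply/funext => u; rewrite vB_mk.
  exact: pB.
rewrite -Hq (poly_zero_outside (q := q) r0) ?horner0 // => u /H.
by rewrite Hq => /ZinvP; apply.
Qed.

Lemma INVc_crit s (A B : 'M[K]_m) : s != 0 -> A^T = A -> \det A = s ^+ m ->
  A *m B = (s * s)%:M -> INVc (mkV A B).
Proof.
move=> s0 sA dA AB.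
have -> : mkV A B = mkV (s *: (s^-1 *: A)) (s *: (s^-1 *: B)).
  by rewrite !scalerA divff // !scale1r.
apply: INVc_mk; first by rewrite linearZ /= sA.
  by rewrite detZ dA -exprMn mulVf // expr1n.
rewrite -scalemxAl -scalemxAr AB !scale_scalar_mx mulrA -invfM.
by rewrite mulVf // mulf_neq0.
Qed.

End Limits.

Section Plane.
Variable K : numClosedFieldType.

Lemma adj2E (A : 'M[K]_2) : \adj A = (\tr A)%:M - A.
Proof.
have tE : \tr A = A 0 0 + A 1 1 by rewrite /mxtrace !big_ord_recl big_ord0 addr0; congr (_ + A _ _); apply/val_inj.
have c2 (i : 'I_2) : i = 0 \/ i = 1.
  by case: i => [[|[|//]] hi]; [left | right]; apply/val_inj.
have l0 : lift 0 0 = 1 :> 'I_2 by apply/val_inj.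
have l1 : lift 1 0 = 0 :> 'I_2 by apply/val_inj.
apply/matrixP => i j; rewrite !mxE /cofactor det_mx11 !mxE tE.
by case: (c2 i) => ->; case: (c2 j) => ->; rewrite ?l0 ?l1 /= ?expr0 ?expr1 ?expr2; ring.
Qed.

Lemma Xinv2_linear : exists U : {vspace Vsym K 2}, Xinv_sym K 2 = psubspace U.
Proof.
have adjl a (A B : 'M[K]_2) : \adj (a *: A + B) = a *: \adj A + \adj B.
  rewrite !adj2E mxtraceD mxtraceZ raddfD /= scalerBr scale_scalar_mx.
  by rewrite opprD addrACA.
have adjs (A : 'M[K]_2) : A^T = A -> (\adj A)^T = \adj A by move=> sA; rewrite trmx_adj sA.
have [|F HF] := @linear_hom K (Vsym K 2) (Vsym K 2) (fun v => mkV 0 (vB v - \adj (vA v))).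
  have s0 : (0 : 'M[K]_2)^T = 0 by rewrite trmx0.
  have sd v : (vB v - \adj (vA v))^T = vB v - \adj (vA v).
    by rewrite raddfB /= vB_sym trmx_adj vA_sym.
  move=> a u v; apply: Vsym_eq.
    rewrite [in RHS]vAD [in RHS]vAZ !vA_mk ?sd //.
    by rewrite scaler0 addr0.
  rewrite [in RHS]vBD [in RHS]vBZ !vB_mk ?sd //.
  rewrite vBD vBZ vAD vAZ adjl scalerBr opprD.
  by rewrite addrACA.
have inU v : v \in lker F <-> vB v = \adj (vA v).
  have sd : (vB v - \adj (vA v))^T = vB v - \adj (vA v).
    by rewrite raddfB /= vB_sym trmx_adj vA_sym.
  rewrite memv_ker HF; split=> [/eqP/(congr1 (@vB K 2)) | ->].
    by rewrite vB_mk ?trmx0 // vB0 => /eqP; rewrite subr_eq0 => /eqP.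
  by rewrite subrr; apply/eqP/Vsym_eq; rewrite ?vA_mk ?vB_mk ?vA0 ?vB0 ?trmx0.
have ZU v : @Zinv K 2 v <-> v \in lker F.
  split=> [Zv | /inU vE].
    apply/inU/matrixP => i j; apply/eqP; rewrite -subr_eq0; apply/eqP.
    apply: (Zinv_pfun _ (h := fun v : Vsym K 2 => vB v i j - \adj (vA v) i j)) Zv => //.
      apply: (falgB (pfunP _)); first exact: pfun_vB.
      by apply: mxfun_adj; [exact: pfunP | exact: pfun_vA].
    move=> u [s [A [B [sA dA AB -> ->]]]].
    by rewrite adjZ /= expr1 (inv_adj dA AB) subrr.
  have [r r0 Hr] := det_shift (vA v).
  pose A t := vA v + t%:M.
  have sA t : (A t)^T = A t by rewrite /A raddfD /= vA_sym tr_scalar_mx.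
  have pA : mxfun (@upoly K) A.
    move=> i j; have HP := upolyP K.
    have -> : (fun t => A t i j) = fun t => vA v i j + t * (i == j)%:R.
      by apply/funext => t; rewrite /A !mxE mulr_natr.
    apply: (falgD HP); first exact: falgC.
    by apply: (falgM HP); [exact: upoly_id | exact: falgC].
  have -> : v = mkV (A 0) (\adj (A 0)).
    by rewrite /A raddf0 addr0 -vE mkV_eta.
  have pB : mxfun (@upoly K) (fun t => \adj (A t)) by apply: mxfun_adj => //; exact: upolyP.
  have sB t : (\adj (A t))^T = \adj (A t) by rewrite trmx_adj sA.
  apply: (Zinv_limit (ltn0Sn 1) pA pB sA sB r0) => t rt.
   apply: INVc_Zinv => //.
  have sq : sqrtC (\det (A t)) ^+ 2 = \det (A t) by rewrite sqrtCK.
  apply: (INVc_crit (s := sqrtC (\det (A t)))) => //.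
    by rewrite sqrtC_eq0 -Hr.
  by rewrite mul_mx_adj -expr2 sq.
exists (lker F); apply/seteqP; split=> x.
  move=> Xx; have [v xv] := homog_coord_ex x.
  change (is_true (val x <= lker F)%VS); rewrite (homog_coordE xv) -memvE.
  by apply/ZU/(XinvP xv).
move=> xU; have [v xv] := homog_coord_ex x; apply/(XinvP xv)/ZU.
by rewrite memvE -(homog_coordE xv).
Qed.

End Plane.

(** * Pluecker coordinates of 3 x 6 matrices *)

Definition o0 : 'I_3 := @Ordinal 3 0 isT.
Definition o1 : 'I_3 := @Ordinal 3 1 isT.
Definition o2 : 'I_3 := @Ordinal 3 2 isT.

(** The cyclic successor: with rows and columns in cyclic order, the cofactors of a 3 x 3 matrix
    carry no signs. *)
Definition nx (i : 'I_3) : 'I_3 :=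
  match val i with 0 => o1 | 1 => o2 | _ => o0 end%N.

Lemma ord3P i : [\/ i = o0, i = o1 | i = o2].
Proof.
by case: i => [[|[|[|//]]] hi]; [apply: Or31 | apply: Or32 | apply: Or33]; apply/val_inj.
Qed.

Lemma nxE : (nx o0 = o1) * (nx o1 = o2) * (nx o2 = o0).
Proof. by []. Qed.

Section Matrices3.
Variable K : comNzRingType.

Lemma big3 (F : 'I_3 -> K) : \sum_i F i = F o0 + F o1 + F o2.
Proof.
rewrite !big_ord_recl big_ord0 addr0 addrA.
by congr (F _ + F _ + F _); apply/val_inj.
Qed.

Lemma cofactor3 (M : 'M[K]_3) i j : cofactor M i j =
  M (nx i) (nx j) * M (nx (nx i)) (nx (nx j)) - M (nx i) (nx (nx j)) * M (nx (nx i)) (nx j).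
Proof.
have d2 (N : 'M[K]_2) : \det N = N 0 0 * N 1 1 - N 0 1 * N 1 0.
  have e0 : lift 0 0 = 1 :> 'I_2 by apply/val_inj.
  have e1 : lift 1 0 = 0 :> 'I_2 by apply/val_inj.
  rewrite (expand_det_row N 0) !big_ord_recl big_ord0 addr0 e0 /cofactor !det_mx11 !mxE e0 e1 /=; ring.
rewrite /cofactor d2 !mxE.
have l00 : lift o0 0 = o1 by apply/val_inj. have l01 : lift o0 1 = o2 by apply/val_inj.
have l10 : lift o1 0 = o0 by apply/val_inj. have l11 : lift o1 1 = o2 by apply/val_inj.
have l20 : lift o2 0 = o0 by apply/val_inj. have l21 : lift o2 1 = o1 by apply/val_inj.
by case: (ord3P i) => ->; case: (ord3P j) => ->;
  rewrite ?(l00, l01, l10, l11, l20, l21) !nxE /=; ring.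
Qed.

Lemma adj3 (M : 'M[K]_3) i j : \adj M i j =
  M (nx j) (nx i) * M (nx (nx j)) (nx (nx i)) - M (nx j) (nx (nx i)) * M (nx (nx j)) (nx i).
Proof. by rewrite mxE cofactor3. Qed.

Lemma det3 (M : 'M[K]_3) : \det M =
  M o0 o0 * (M o1 o1 * M o2 o2 - M o1 o2 * M o2 o1)
  + M o0 o1 * (M o1 o2 * M o2 o0 - M o1 o0 * M o2 o2)
  + M o0 o2 * (M o1 o0 * M o2 o1 - M o1 o1 * M o2 o0).
Proof. by rewrite (expand_det_row _ o0) big3 !cofactor3 !nxE. Qed.

Lemma mulmx3 m n (A : 'M[K]_(m, 3)) (B : 'M_(3, n)) i j :
  (A *m B) i j = A i o0 * B o0 j + A i o1 * B o1 j + A i o2 * B o2 j.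
Proof. by rewrite mxE big3. Qed.

Lemma adj_mul3 (A B : 'M[K]_3) : \adj (A *m B) = \adj B *m \adj A.
Proof.
apply/matrixP => i j; rewrite mulmx3 !adj3 !mulmx3.
by case: (ord3P i) => ->; case: (ord3P j) => ->; rewrite !nxE; ring.
Qed.

Lemma adj_adj3 (A : 'M[K]_3) : \adj (\adj A) = \det A *: A.
Proof.
apply/matrixP => i j; rewrite [RHS]mxE det3 !adj3.
by case: (ord3P i) => ->; case: (ord3P j) => ->; rewrite !nxE; ring.
Qed.

End Matrices3.

Section Exterior.
Variable K : fieldType.
Local Notation W := (extpow K 3 (3 + 3)).
Local Notation I6 := 'I_(3 + 3).

(* The element of [{0, 1, 2}] other than [a] and [b], for [a < b] only. *)
Definition third (a b : 'I_3) : 'I_3 :=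
  match val a, val b with 0, 1 => o2 | 0, _ => o1 | _, _ => o0 end%N.

(** Pluecker indices are increasing, cofactors cyclic; the orders of the two indices other than [r]
    disagree only for [r = 1]. *)
Definition sgn3 (r : 'I_3) : K := if val r == 1%N then -1 else 1.

Definition psi_coef (p : K) (S T : 'M[K]_3) (q : K) (i j k : I6) : K :=
  match fintype.split i, fintype.split j, fintype.split k with
  | inl _, inl _, inl _ => p
  | inl a, inl b, inr c => sgn3 (third a b) * S (third a b) c
  | inl a, inr b, inr c => sgn3 (third b c) * T (third b c) a
  | inr _, inr _, inr _ => q
  | _, _, _ => 0
  end.

(* Coordinates on the third exterior power adapted to the decomposition of a
   3 x 6 matrix into two 3 x 3 blocks: [p] and [q] stand for the determinants
   of the blocks [P] and [Q], [S] and [T] for the matrices [adj P *m Q] and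
   [adj Q *m P], whose entries are the mixed minors by Cramer's rule. *)
Definition psi p S T q : W :=
  [ffun t => psi_coef p S T q (tnth (val t) o0) (tnth (val t) o1) (tnth (val t) o2)].

Lemma split_l (a : 'I_3) : fintype.split (lshift 3 a) = inl a :> 'I_3 + 'I_3.
Proof. exact: (unsplitK (inl a)). Qed.

Lemma split_r (a : 'I_3) : fintype.split (rshift 3 a) = inr a :> 'I_3 + 'I_3.
Proof. exact: (unsplitK (inr a)). Qed.

Inductive triple_spec : I6 -> I6 -> I6 -> Prop :=
| TripleP : triple_spec (lshift 3 o0) (lshift 3 o1) (lshift 3 o2)
| TripleS (a b c : 'I_3) : (a < b)%N -> triple_spec (lshift 3 a) (lshift 3 b) (rshift 3 c)
| TripleT (a b c : 'I_3) : (b < c)%N -> triple_spec (lshift 3 a) (rshift 3 b) (rshift 3 c)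
| TripleQ : triple_spec (rshift 3 o0) (rshift 3 o1) (rshift 3 o2).

Lemma tripleP (i j k : I6) : (i < j)%N -> (j < k)%N -> triple_spec i j k.
Proof.
have lr (a b : 'I_3) : (ltn (rshift 3 a) (lshift 3 b)) = false.
  by apply/negbTE; rewrite -leqNgt /= ltnW // (leq_trans (ltn_ord b)) // leq_addr.
rewrite -(splitK i) -(splitK j) -(splitK k).
case: (fintype.split i) => a; case: (fintype.split j) => b; case: (fintype.split k) => c /=.
all: rewrite ?ltn_add2l => ab bc.
- have [-> -> ->] : [/\ a = o0, b = o1 & c = o2].
    by move: ab bc; case: (ord3P a) => ->; case: (ord3P b) => ->; case: (ord3P c) => ->.
  exact: TripleP.
- exact: TripleS.
- by have := lr b c; rewrite /= bc.
- exact: TripleT.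
- by have := lr a b; rewrite /= ab.
- by have := lr a b; rewrite /= ab.
- by have := lr b c; rewrite /= bc.
- have [-> -> ->] : [/\ a = o0, b = o1 & c = o2].
    by move: ab bc; case: (ord3P a) => ->; case: (ord3P b) => ->; case: (ord3P c) => ->.
  exact: TripleQ.
Qed.

Lemma incr_tripleP (t : incr_tuple 3 (3 + 3)) :
  triple_spec (tnth (val t) o0) (tnth (val t) o1) (tnth (val t) o2).
Proof.
case: t => [[[|i [|j [|k [|]]]] //= ht] st]; rewrite /tnth /=.
by move: st; rewrite /= andbT => /andP[ij jk]; apply: tripleP.
Qed.

Lemma plucker_psi (P Q : 'M[K]_3) :
  plucker (row_mx P Q) = psi (\det P) (\adj P *m Q) (\adj Q *m P) (\det Q).
Proof.
apply/ffunP => t; rewrite !ffunE /psi_coef.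
have cE i j : colsub (tnth (val t)) (row_mx P Q) i j = row_mx P Q i (tnth (val t) j).
  by rewrite mxE.
rewrite det3 !cE.
case: (incr_tripleP t) => [|a b c ab|a b c bc|].
- by rewrite !split_l det3 !row_mxEl.
- rewrite !split_l split_r !row_mxEl !row_mxEr mulmx3 !adj3 /sgn3.
  by move: ab; case: (ord3P a) => ->; case: (ord3P b) => -> //= _; rewrite !nxE; ring.
- rewrite !split_r split_l !row_mxEl !row_mxEr mulmx3 !adj3 /sgn3.
  by move: bc; case: (ord3P b) => ->; case: (ord3P c) => -> //= _; rewrite !nxE; ring.
- by rewrite !split_r det3 !row_mxEr.
Qed.

Lemma psi_linear a p S T q p' S' T' q' :
  psi (a * p + p') (a *: S + S') (a *: T + T') (a * q + q') =
  a *: psi p S T q + psi p' S' T' q'.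
Proof.
apply/ffunP => t; rewrite !ffunE /psi_coef.
case: (incr_tripleP t) => [|b c d _|b c d _|]; rewrite ?split_l ?split_r //;
  by rewrite !mxE mulrDr /= /GRing.scale /= mulrCA.
Qed.

Lemma psi_scale a p S T q : psi (a * p) (a *: S) (a *: T) (a * q) = a *: psi p S T q.
Proof.
have := psi_linear a p S T q 0 0 0 0; rewrite !addr0 => ->.
rewrite -[RHS]addr0; congr (_ + _); apply/ffunP => t; rewrite !ffunE /psi_coef.
by case: (incr_tripleP t) => [|b c d _|b c d _|]; rewrite ?split_l ?split_r // mxE mulr0.
Qed.

Definition tripP : incr_tuple 3 (3 + 3) :=
  exist _ [tuple lshift 3 o0; lshift 3 o1; lshift 3 o2] isT.
Definition tripQ : incr_tuple 3 (3 + 3) :=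
  exist _ [tuple rshift 3 o0; rshift 3 o1; rshift 3 o2] isT.

Definition lo (r : 'I_3) : 'I_3 := if val r == 0%N then o1 else o0.
Definition hi (r : 'I_3) : 'I_3 := if val r == 2%N then o1 else o2.

Lemma sortedS r (c : 'I_3) :
  sorted ltn (map val [tuple lshift 3 (lo r); lshift 3 (hi r); rshift 3 c]).
Proof. by case: (ord3P r) => ->. Qed.

Lemma sortedT r (a : 'I_3) :
  sorted ltn (map val [tuple lshift 3 a; rshift 3 (lo r); rshift 3 (hi r)]).
Proof. by case: (ord3P r) => ->; case: (ord3P a) => ->. Qed.

Definition tripS r c : incr_tuple 3 (3 + 3) := 
  exist _ [tuple lshift 3 (lo r); lshift 3 (hi r); rshift 3 c] (sortedS r c).
Definition tripT r a : incr_tuple 3 (3 + 3) := 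
  exist _ [tuple lshift 3 a; rshift 3 (lo r); rshift 3 (hi r)] (sortedT r a).

Definition cS (w : W) : 'M[K]_3 := \matrix_(r, c) (sgn3 r * w (tripS r c)).
Definition cT (w : W) : 'M[K]_3 := \matrix_(r, a) (sgn3 r * w (tripT r a)).

Lemma sgn3K r (x : K) : sgn3 r * (sgn3 r * x) = x.
Proof. by rewrite /sgn3; case: ifP => _; ring. Qed.

Lemma third_lohi r : third (lo r) (hi r) = r.
Proof. by case: (ord3P r) => ->. Qed.

Lemma psi_coordK p S T q : let w := psi p S T q in
  [/\ w tripP = p, cS w = S, cT w = T & w tripQ = q].
Proof.
split; rewrite ?ffunE /psi_coef /=.
- by rewrite !split_l.
- apply/matrixP => r c; rewrite mxE ffunE /psi_coef /=.
  by rewrite !split_l split_r third_lohi sgn3K.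
- apply/matrixP => r c; rewrite mxE ffunE /psi_coef /=.
  by rewrite !split_r split_l third_lohi sgn3K.
- by rewrite !split_r.
Qed.

Lemma psi_coord (w : W) : psi (w tripP) (cS w) (cT w) (w tripQ) = w.
Proof.
apply/ffunP => t; rewrite !ffunE /psi_coef.
have tE (t' : incr_tuple 3 (3 + 3)) : tnth (val t) o0 = tnth (val t') o0 ->
    tnth (val t) o1 = tnth (val t') o1 -> tnth (val t) o2 = tnth (val t') o2 ->
    w t = w t'.
  move=> e0 e1 e2; congr (fun_of_fin w _); apply/val_inj/eq_from_tnth => i.
  by case: (ord3P i) => ->.
move: tE; case: (incr_tripleP t) => [|a b c ab|a b c bc|] tE;
  rewrite ?split_l ?split_r ?mxE ?sgn3K; apply/esym/tE => //=;
  by [move: ab; case: (ord3P a) => ->; case: (ord3P b) => -> |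
      move: bc; case: (ord3P b) => ->; case: (ord3P c) => ->].
Qed.

Lemma cSD a (w w' : W) : cS (a *: w + w') = a *: cS w + cS w'.
Proof. by apply/matrixP => i j; rewrite !mxE !ffunE mulrDr mulrCA. Qed.

Lemma cTD a (w w' : W) : cT (a *: w + w') = a *: cT w + cT w'.
Proof. by apply/matrixP => i j; rewrite !mxE !ffunE mulrDr mulrCA. Qed.

Lemma plucker_neq0 (M : 'M[K]_(3, 3 + 3)) : plucker M != 0 -> row_free M.
Proof.
apply: contraNT; rewrite -kermx_eq0 => /rowV0Pn[v /sub_kermxP vM v0].
apply/eqP/ffunP => t; rewrite !ffunE; apply/eqP/det0P; exists v => //.
apply/rowP => j; have /rowP/(_ (tnth (val t) j)) := vM; rewrite [RHS]mxE => H.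
rewrite [RHS]mxE -[RHS]H !mxE.
by apply: eq_bigr => i _; congr (_ * _); rewrite mxE.
Qed.

End Exterior.

(** * Bordered matrices and the cross product *)

Section Bordered.
Variables (K : comNzRingType) (n : nat).

Definition bordered (p : K) (a : 'I_n -> K) (N : 'M[K]_n) : 'M[K]_n.+1 :=
  \matrix_(i, j) match unlift 0 i, unlift 0 j with
                 | None, None => p
                 | None, Some j => a j
                 | Some i, None => a i
                 | Some i, Some j => N i j
                 end.

Lemma borderedE p a N :
  (bordered p a N 0 0 = p) * (forall j, bordered p a N 0 (lift 0 j) = a j)
  * (forall i, bordered p a N (lift 0 i) 0 = a i)
  * (forall i j, bordered p a N (lift 0 i) (lift 0 j) = N i j).
Proof. by repeat split; move=> *; rewrite mxE ?unlift_none ?liftK. Qed.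

Lemma matrix_bordered (M M' : 'M[K]_n.+1) : M 0 0 = M' 0 0 ->
  (forall j, M 0 (lift 0 j) = M' 0 (lift 0 j)) ->
  (forall j, M (lift 0 j) 0 = M' (lift 0 j) 0) ->
  (forall i j, M (lift 0 i) (lift 0 j) = M' (lift 0 i) (lift 0 j)) -> M = M'.
Proof.
move=> H00 H0 H1 H; apply/matrixP => i j.
by have [i' ->|->] := unliftP 0 i; have [j' ->|->] := unliftP 0 j.
Qed.

Lemma bordered_sym p a N : N^T = N -> (bordered p a N)^T = bordered p a N.
Proof.
move=> sN; apply: matrix_bordered => *; rewrite mxE !borderedE //.
by rewrite -{1}sN mxE.
Qed.

(** Clearing the first column with the unit corner subtracts the rank one matrix [a a^T] from the
    block and leaves [N]. *)
Lemma det_bordered a (N : 'M[K]_n) :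
  \det (bordered 1 a (\matrix_(i, j) (N i j + a i * a j))) = \det N.
Proof.
pose u : 'rV[K]_n := \row_j a j.
have -> : bordered 1 a (\matrix_(i, j) (N i j + a i * a j)) =
    (block_mx 1%:M 0 u^T 1%:M : 'M_(1 + n)) *m block_mx 1%:M u 0 N.
  have e0 : 0 = lshift n 0 :> 'I_(1 + n) by apply/val_inj.
  have el (i : 'I_n) : lift 0 i = rshift 1 i :> 'I_(1 + n) by apply/val_inj.
  rewrite mulmx_block !(mul1mx, mulmx1, mul0mx, mulmx0, addr0, add0r).
  set D := u^T *m u + N.
  apply: matrix_bordered => [|j|i|i j]; rewrite borderedE.
  - rewrite [in RHS]e0; apply: etrans (esym (block_mxEul 1%:M u u^T D 0 0)).
    by rewrite mxE.
  - rewrite el [in RHS]e0; apply: etrans (esym (block_mxEur 1%:M u u^T D 0 j)).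
    by rewrite mxE.
  - rewrite el [in RHS]e0; apply: etrans (esym (block_mxEdl 1%:M u u^T D i 0)).
    by rewrite !mxE.
  - rewrite !el; apply: etrans (esym (block_mxEdr 1%:M u u^T D i j)).
    by rewrite !mxE big_ord1 !mxE addrC.
rewrite det_mulmx -[RHS]mul1r; congr (_ * _).
  have := det_lblock (1%:M : 'M[K]_1) u^T (1%:M : 'M[K]_n).
  by rewrite !det1 mul1r; exact: id.
by have := det_ublock (1%:M : 'M[K]_1) u N; rewrite det1 mul1r; exact: id.
Qed.

End Bordered.

Lemma falg_bordered (K : fieldType) X (P : (X -> K) -> Prop) n (p : X -> K)
    (a : X -> 'I_n -> K) (N : X -> 'M[K]_n) :
  P p -> (forall i, P (fun x => a x i)) -> mxfun P N ->
  mxfun P (fun x => bordered (p x) (a x) (N x)).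
Proof.
move=> Pp Pa PN i j.
have -> : (fun x => bordered (p x) (a x) (N x) i j) = fun x =>
    match unlift 0 i, unlift 0 j with
    | None, None => p x | None, Some j => a x j
    | Some i, None => a x i | Some i, Some j => N x i j end.
  by apply/funext => x; rewrite mxE.
by case: (unlift 0 i) => [i'|]; case: (unlift 0 j) => [j'|].
Qed.

Section Cross.
Variable K : numFieldType.

(* The matrix of the cross product with [a]; [axial] is its left inverse. *)
Definition cross (a : 'I_3 -> K) : 'M[K]_3 :=
  \matrix_(i, j) (if j == nx i then - a (nx j) else if i == nx j then a (nx i) else 0).

Definition axial (M : 'M[K]_3) (k : 'I_3) : K :=
  (M (nx (nx k)) (nx k) - M (nx k) (nx (nx k))) / 2.

Definition sympart (M : 'M[K]_3) : 'M[K]_3 := 2^-1 *: (M + M^T).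

Lemma sympart_sym M : (sympart M)^T = sympart M.
Proof. by rewrite /sympart linearZ /= raddfD /= trmxK addrC. Qed.

Lemma two_neq0 : (2 : K) != 0. Proof. by rewrite pnatr_eq0. Qed.

Lemma sympart_cross M : sympart M + cross (axial M) = M.
Proof.
have t0 := two_neq0.
apply/matrixP => i j; rewrite !mxE /axial.
by case: (ord3P i) => ->; case: (ord3P j) => ->; rewrite !nxE /=; field.
Qed.

Lemma axial_cross N a k : N^T = N -> axial (N + cross a) k = a k.
Proof.
move=> sN; have t0 := two_neq0.
have NE i j : N i j = N j i by rewrite -{1}sN mxE.
rewrite /axial !mxE (NE (nx (nx k))).
by case: (ord3P k) => ->; rewrite !nxE /=; field.
Qed.

Lemma sympart_add_cross N a : N^T = N -> sympart (N + cross a) = N.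
Proof.
move=> sN; have t0 := two_neq0.
have NE i j : N i j = N j i by rewrite -{1}sN mxE.
apply/matrixP => i j; rewrite !mxE (NE j i).
by case: (ord3P i) => ->; case: (ord3P j) => ->; rewrite ?nxE /=; field.
Qed.

Lemma axialD a (M M' : 'M[K]_3) k : axial (a *: M + M') k = a * axial M k + axial M' k.
Proof. have t0 := two_neq0; by rewrite /axial !mxE; field. Qed.

Lemma sympartD a (M M' : 'M[K]_3) : sympart (a *: M + M') = a *: sympart M + sympart M'.
Proof. by apply/matrixP => i j; rewrite !mxE; ring. Qed.

Lemma det_adj3 (N : 'M[K]_3) : \det (\adj N) = \det N * \det N.
Proof. by rewrite !det3 !adj3 !nxE; ring. Qed.

End Cross.

(** * The case m = 4: the Grassmannian Gr(3, 6) *)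

Lemma bordered_linear (K : comNzRingType) n a p (x : 'I_n -> K) N p' (x' : 'I_n -> K) N' :
  bordered (a * p + p') (fun i => a * x i + x' i) (a *: N + N') =
  a *: bordered p x N + bordered p' x' N'.
Proof.
apply/matrixP => i j; rewrite !mxE.
by case: (unlift 0 i) => [i'|]; case: (unlift 0 j) => [j'|] //; rewrite !mxE.
Qed.

Lemma bordered_mulE (K : comNzRingType) n p (a : 'I_n -> K) N q b M
    (AB := bordered p a N *m bordered q b M) :
  (AB 0 0 = p * q + \sum_i a i * b i)
  * (forall j, AB 0 (lift 0 j) = p * b j + \sum_i a i * M i j)
  * (forall i, AB (lift 0 i) 0 = a i * q + \sum_k N i k * b k)
  * (forall i j, AB (lift 0 i) (lift 0 j) = a i * b j + \sum_k N i k * M k j).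
Proof.
by repeat split; move=> *; rewrite /AB mxE big_ord_recl !borderedE; congr (_ + _);
  apply: eq_bigr => k _; rewrite !borderedE.
Qed.

Section Gr36.
Variable K : numClosedFieldType.
Local Notation W := (extpow K 3 (3 + 3)).
Local Notation V := (Vsym K 4).
Local Notation Zinv := (@Zinv K 4).

(** Restricted to [C^3], each of [S^2 C^4] and its dual splits into pieces of dimensions 1, 3 and 6;
    a 3 x 3 block provides a 3 (its axial vector) and a 6 (its symmetric part). The two pieces of
    one block go to opposite sides. *)
Definition phiq (p : K) (S T : 'M[K]_3) (q : K) : V :=
  mkV (bordered p (axial S) (sympart T)) (bordered q (axial T) (sympart S)).

Lemma vA_phiq p S T q : vA (phiq p S T q) = bordered p (axial S) (sympart T).
Proof. by rewrite vA_mk // bordered_sym // sympart_sym. Qed.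

Lemma vB_phiq p S T q : vB (phiq p S T q) = bordered q (axial T) (sympart S).
Proof. by rewrite vB_mk // bordered_sym // sympart_sym. Qed.

Definition vrow (A : 'M[K]_4) (j : 'I_3) : K := A 0 (lift 0 j).
Definition vblock (A : 'M[K]_4) : 'M[K]_3 := \matrix_(i, j) A (lift 0 i) (lift 0 j).

Lemma vblock_sym A : A^T = A -> (vblock A)^T = vblock A.
Proof. by move=> sA; apply/matrixP => i j; rewrite !mxE -{1}sA mxE. Qed.

Lemma bordered_eta A : A^T = A -> bordered (A 0 0) (vrow A) (vblock A) = A.
Proof.
move=> sA; apply: matrix_bordered => *; rewrite !borderedE ?mxE //.
by rewrite /vrow -{1}sA mxE.
Qed.

Lemma bordered_eq n p (a b : 'I_n -> K) N : a =1 b -> bordered p a N = bordered p b N.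
Proof. by move=> ab; congr bordered; apply/funext. Qed.

Lemma phiq_eta v : phiq (vA v 0 0) (vblock (vB v) + cross (vrow (vA v)))
  (vblock (vA v) + cross (vrow (vB v))) (vB v 0 0) = v.
Proof.
have sA := vA_sym v; have sB := vB_sym v.
apply: Vsym_eq; rewrite ?vA_phiq ?vB_phiq sympart_add_cross ?vblock_sym //.
  by rewrite -[RHS]bordered_eta //; apply: bordered_eq => i; rewrite axial_cross // vblock_sym.
by rewrite -[RHS]bordered_eta //; apply: bordered_eq => i; rewrite axial_cross // vblock_sym.
Qed.

Lemma phiq_linear a p S T q p' S' T' q' :
  phiq (a * p + p') (a *: S + S') (a *: T + T') (a * q + q') =
  a *: phiq p S T q + phiq p' S' T' q'.
Proof.
apply: Vsym_eq; rewrite ?vAD ?vBD ?vAZ ?vBZ !(vA_phiq, vB_phiq) sympartD -bordered_linear;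
  by apply: bordered_eq => i; rewrite axialD.
Qed.

Lemma phiq_scale a p S T q : phiq (a * p) (a *: S) (a *: T) (a * q) = a *: phiq p S T q.
Proof.
have := phiq_linear a p S T q 0 0 0 0; rewrite !addr0 => ->.
rewrite -[RHS]addr0; congr (_ + _).
apply: Vsym_eq; rewrite !(vA_phiq, vB_phiq) ?vA0 ?vB0; apply: matrix_bordered => *;
  by rewrite borderedE [RHS]mxE // /axial ?mxE ?subrr ?mul0r ?addr0 ?mulr0.
Qed.

Lemma phiq_inj p S T q p' S' T' q' : phiq p S T q = phiq p' S' T' q' ->
  [/\ p = p', S = S', T = T' & q = q'].
Proof.
move=> E; have EA := congr1 (@vA K 4) E; have EB := congr1 (@vB K 4) E.
rewrite !vA_phiq in EA; rewrite !vB_phiq in EB.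
have e00 (M M' : 'M[K]_4) i j : M = M' -> M i j = M' i j by move=> ->.
split.
- by have := e00 _ _ 0 0 EA; rewrite !borderedE.
- rewrite -(sympart_cross S) -(sympart_cross S'); congr (_ + cross _).
    apply/matrixP => i j; have := e00 _ _ (lift 0 i) (lift 0 j) EB.
    by rewrite !borderedE.
  by apply/funext => i; have := e00 _ _ 0 (lift 0 i) EA; rewrite !borderedE.
- rewrite -(sympart_cross T) -(sympart_cross T'); congr (_ + cross _).
    apply/matrixP => i j; have := e00 _ _ (lift 0 i) (lift 0 j) EA.
    by rewrite !borderedE.
  by apply/funext => i; have := e00 _ _ 0 (lift 0 i) EB; rewrite !borderedE.
- by have := e00 _ _ 0 0 EB; rewrite !borderedE.
Qed.

(* The chart [P = 1], [Q = N + cross a] of the Grassmannian. *)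
Definition chartA (N : 'M[K]_3) (a : 'I_3 -> K) : 'M[K]_4 :=
  bordered 1 a (\matrix_(i, j) (\adj N i j + a i * a j)).
Definition chartB (N : 'M[K]_3) (a : 'I_3 -> K) : 'M[K]_4 :=
  bordered (\det N + \sum_i a i * \sum_j N i j * a j) (fun i => - \sum_j N i j * a j) N.

(** For [S = N + [a]_x] the adjugate has symmetric part [adj N + a a^T] and axial vector [- N a],
    and the determinant is [det N + a^T N a]. *)
Lemma phiq_chart N a : N^T = N -> let S := N + cross a in
  phiq 1 S (\adj S) (\det S) = mkV (chartA N a) (chartB N a).
Proof.
move=> sN S; have t0 := two_neq0 K.
have [e10 e20 e21] : [/\ N o1 o0 = N o0 o1, N o2 o0 = N o0 o2 & N o2 o1 = N o1 o2].
  by split; rewrite -{1}sN mxE.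
rewrite /phiq {}/S; congr mkV.
  rewrite /chartA; congr (bordered _ _ _).
    by apply/funext => i; rewrite axial_cross.
  apply/matrixP => i j; rewrite !mxE !cofactor3 !mxE.
  by case: (ord3P i) => ->; case: (ord3P j) => ->; rewrite !nxE /= ?e10 ?e20 ?e21; field.
rewrite /chartB sympart_add_cross //; congr (bordered _ _ _).
  by rewrite !det3 !big3 !mxE /= e10 e20 e21; ring.
apply/funext => k; rewrite big3 /axial !adj3 !mxE.
by case: (ord3P k) => ->; rewrite !nxE /= ?e10 ?e20 ?e21; field.
Qed.

Lemma chartA_sym N a : N^T = N -> (chartA N a)^T = chartA N a.
Proof.
move=> sN; have sadj : (\adj N)^T = \adj N by rewrite trmx_adj sN.
apply/bordered_sym/matrixP => i j; rewrite [LHS]mxE [LHS]mxE [RHS]mxE mulrC.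
by congr (_ + _); rewrite -{1}sadj [LHS]mxE.
Qed.

Lemma chart_AB N a : N^T = N -> chartA N a *m chartB N a = (\det N)%:M.
Proof.
move=> sN.
have [e10 e20 e21] : [/\ N o1 o0 = N o0 o1, N o2 o0 = N o0 o2 & N o2 o1 = N o1 o2].
  by split; rewrite -{1}sN mxE.
apply: matrix_bordered => [|j|j|i j]; rewrite /chartA /chartB bordered_mulE;
  rewrite [RHS]mxE ?eq_liftF ?(inj_eq lift_inj) ?[_ == 0]eq_sym ?eq_liftF /=.
- rewrite !big3 mulr1n; ring.
- rewrite !big3 mulr0n; case: (ord3P j) => ->; rewrite ?e10 ?e20 ?e21; ring.
- rewrite !big3 !mxE !cofactor3 det3.
  by case: (ord3P j) => ->; rewrite !nxE /= ?e10 ?e20 ?e21; ring.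
- rewrite !big3 !mxE !cofactor3 det3.
  by case: (ord3P i) => ->; case: (ord3P j) => ->; rewrite !nxE /= ?e10 ?e20 ?e21; ring.
Qed.

(** With [s] a square root of [det N], the pair has [A B = s^2] and
    [det A = det (adj N) = (det N)^2 = s^4]. *)
Lemma Zinv_chart_nz S : \det (sympart S) != 0 -> Zinv (phiq 1 S (\adj S) (\det S)).
Proof.
set N := sympart S => N0; have sN : N^T = N by exact: sympart_sym.
rewrite -(sympart_cross S) -/N phiq_chart //; set a := axial S.
have sq : sqrtC (\det N) ^+ 2 = \det N by rewrite sqrtCK.
apply: INVc_Zinv => //; apply: (INVc_crit (s := sqrtC (\det N))).
- by rewrite sqrtC_eq0.
- exact: chartA_sym.
- rewrite /chartA det_bordered det_adj3 -[in LHS]sq -exprD //.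
- by rewrite chart_AB // -expr2 sq.
Qed.

Lemma upoly_shift (M : 'M[K]_3) : mxfun (@upoly K) (fun t => M + t%:M).
Proof.
move=> i j; have HP := upolyP K.
have -> : (fun t => (M + t%:M) i j) = fun t => M i j + t * (i == j)%:R.
  by apply/funext => t; rewrite !mxE mulr_natr.
apply: (falgD HP); first exact: falgC.
by apply: (falgM HP); [exact: upoly_id | exact: falgC].
Qed.

Lemma falg_axial X (P : (X -> K) -> Prop) (M : X -> 'M[K]_3) : falg P -> mxfun P M ->
  forall k, P (fun x => axial (M x) k).
Proof. by move=> HP PM k; apply: (falgM HP); [exact: falgB | exact: falgC]. Qed.

Lemma mxfun_sympart X (P : (X -> K) -> Prop) (M : X -> 'M[K]_3) : falg P -> mxfun P M ->
  mxfun P (fun x => sympart (M x)).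
Proof.
move=> HP PM; apply: (mxfunZ HP); first exact: falgC.
by apply: (mxfunD HP) => //; exact: mxfun_tr.
Qed.

Lemma Zinv_phiq_limit (p q : K -> K) (S T : K -> 'M[K]_3) (r : {poly K}) :
  upoly p -> upoly q -> mxfun (@upoly K) S -> mxfun (@upoly K) T -> r != 0 ->
  (forall t, r.[t] != 0 -> Zinv (phiq (p t) (S t) (T t) (q t))) ->
  forall t, Zinv (phiq (p t) (S t) (T t) (q t)).
Proof.
move=> pp pq pS pT r0 H; have HP := upolyP K.
apply: (Zinv_limit (ltn0Sn 3) _ _ _ _ r0 H).
- by apply: falg_bordered => //; [exact: falg_axial | exact: mxfun_sympart].
- by apply: falg_bordered => //; [exact: falg_axial | exact: mxfun_sympart].
- by move=> t; rewrite bordered_sym // sympart_sym.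
- by move=> t; rewrite bordered_sym // sympart_sym.
Qed.

Lemma Zinv_chart S : Zinv (phiq 1 S (\adj S) (\det S)).
Proof.
have HP := upolyP K; have pS := upoly_shift S.
have [r r0 Hr] := det_shift (sympart S).
have E : S = S + 0%:M by rewrite raddf0 addr0.
rewrite E; apply: (Zinv_phiq_limit (p := fun=> 1) (q := fun t => \det (S + t%:M))
  (S := fun t => S + t%:M) (T := fun t => \adj (S + t%:M)) _ _ _ _ r0).
- exact: falgC.
- exact: falg_det.
- exact: pS.
- exact: mxfun_adj.
move=> t rt; apply: Zinv_chart_nz; move: rt; rewrite Hr; congr (\det _ != 0).
apply/matrixP => i j; have t0 := two_neq0 K; rewrite !mxE (eq_sym j).
by case: (i == j); rewrite ?mulr1n ?mulr0n; field.
Qed.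

(** For invertible [P] the row space of [(P | Q)] is that of [(1 | S)] with [S = P^-1 Q], and the
    coordinates are multiplied by [det P]. A singular [P] is the limit of [P + t]. *)
Lemma Zinv_plucker (P Q : 'M[K]_3) :
  Zinv (phiq (\det P) (\adj P *m Q) (\adj Q *m P) (\det Q)).
Proof.
have nz (P' : 'M[K]_3) : \det P' != 0 ->
    Zinv (phiq (\det P') (\adj P' *m Q) (\adj Q *m P') (\det Q)).
  move=> d0; pose d := \det P'; pose S := d^-1 *: (\adj P' *m Q).
  have -> : phiq (\det P') (\adj P' *m Q) (\adj Q *m P') (\det Q) =
      d *: phiq 1 S (\adj S) (\det S).
    rewrite -phiq_scale; congr phiq.
    - by rewrite mulr1.
    - by rewrite /S scalerA divff // scale1r.
    - rewrite /S adjZ /= adj_mul3 adj_adj3 -scalemxAr !scalerA -/d.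
      rewrite (_ : d * d^-1 ^+ 2 * d = 1) ?scale1r // expr2 mulrA divff // mul1r mulVf //.
    - rewrite /S detZ det_mulmx det_adj3 -/d.
      by field.
  by apply: ZinvZ; exact: Zinv_chart.
have HP := upolyP K; have pP := upoly_shift P.
have [r r0 Hr] := det_shift P.
have -> : P = P + 0%:M by rewrite raddf0 addr0.
apply: (Zinv_phiq_limit (p := fun t => \det (P + t%:M)) (q := fun=> \det Q)
  (S := fun t => \adj (P + t%:M) *m Q) (T := fun t => \adj Q *m (P + t%:M)) _ _ _ _ r0).
- exact: falg_det.
- exact: falgC.
- apply: (mxfunM HP); [exact: mxfun_adj | exact: mxfunC].
- by apply: (mxfunM HP); [exact: mxfunC | exact: pP].
by move=> t; rewrite Hr; exact: nz.
Qed.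

(** The equations determine [v] from [N] and [a]: Jacobi's identity gives the block of [A], the
    first row of the scalar matrix [A B] gives the row of [B], and equality of two diagonal entries
    of [A B] gives its corner, [det N] entering through [adj N *m N]. *)
Lemma Zinv4_chart v : Zinv v -> vA v 0 0 = 1 ->
  let S := vblock (vB v) + cross (vrow (vA v)) in v = phiq 1 S (\adj S) (\det S).
Proof.
move=> Zv A1; have sA := vA_sym v; have sB := vB_sym v.
set N := vblock (vB v); set a := vrow (vA v) => S.
have sN : N^T = N by exact: vblock_sym.
have lowE : lower (vB v) = N by apply/matrixP => i j; rewrite !mxE.
have blockA i j : vA v (lift 0 i) (lift 0 j) = \adj N i j + a i * a j.
  have /matrixP/(_ i j) := Zinv4_schur Zv; rewrite lowE [LHS]mxE A1 mul1r => <-.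
  by rewrite (vAC v (lift 0 i) 0) subrK.
have AB i j : (vA v *m vB v) i j = (i == j)%:R * (vA v *m vB v) 0 0.
  by rewrite {1}(Zinv_AB Zv) mxE mulr_natl.
have mulE i j : (vA v *m vB v) i j =
    vA v i 0 * vB v 0 j + \sum_k vA v i (lift 0 k) * vB v (lift 0 k) j.
  by rewrite mxE big_ord_recl.
have rowB j : vB v 0 (lift 0 j) = - \sum_k N j k * a k.
  have := AB 0 (lift 0 j); rewrite eq_liftF mul0r mulE A1 mul1r.
  move/eqP; rewrite addr_eq0 => /eqP ->; congr (- _); apply: eq_bigr => k _.
  by rewrite -[in RHS]sN !mxE mulrC.
have B00 : vB v 0 0 = \det N + \sum_i a i * \sum_j N i j * a j.
  have := AB (lift 0 o0) (lift 0 o0); rewrite eqxx mul1r !mulE A1 mul1r.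
  have adjN := mul_adj_mx N.
  under eq_bigr do rewrite blockA mulrDl.
  rewrite big_split /= => E.
  have E1 : \sum_k \adj N o0 k * vB v (lift 0 k) (lift 0 o0) = \det N.
    have /matrixP/(_ o0 o0) := adjN; rewrite !mxE eqxx mulr1n => <-.
    by apply: eq_bigr => k _; rewrite !mxE.
  have E2 : \sum_k vA v 0 (lift 0 k) * vB v (lift 0 k) 0 = - \sum_i a i * \sum_j N i j * a j.
    by rewrite -sumrN; apply: eq_bigr => k _; rewrite vBC rowB mulrN.
  have E3 : \sum_k a o0 * a k * vB v (lift 0 k) (lift 0 o0) = a o0 * \sum_j N o0 j * a j.
    rewrite mulr_sumr; apply: eq_bigr => k _.
    by rewrite -[in RHS]sN !mxE; ring.
  move: E; rewrite E1 E2 E3 rowB.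
  rewrite (vAC v _ 0) -/(a o0) => E.
  move/eqP: E; rewrite eq_sym subr_eq => /eqP ->; rewrite [vA v 0 (lift 0 o0)](_ : _ = a o0) //; ring.
have vAE : vA v = chartA N a.
  apply: matrix_bordered => [|j|i|i j]; rewrite borderedE //.
    by rewrite vAC.
  by rewrite blockA [RHS]mxE.
have vBE : vB v = chartB N a.
  apply: matrix_bordered => *; rewrite borderedE //.
  - by rewrite vBC.
  - by rewrite /N mxE.
by rewrite /S phiq_chart // -vAE -vBE mkV_eta.
Qed.

End Gr36.

Section ShearEntries.
Variables (K : numClosedFieldType) (n : nat) (c : 'rV[K]_n.+1).
Hypothesis c0 : c 0 0 = 0.

Lemma shearE :
  (shear c 0 0 = 1) * (forall j, shear c 0 (lift 0 j) = c 0 (lift 0 j))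
  * (forall i, shear c (lift 0 i) 0 = 0)
  * (forall i j, shear c (lift 0 i) (lift 0 j) = (i == j)%:R).
Proof.
have E i j : shear c i j = (i == j)%:R + (i == 0)%:R * c 0 j.
  by rewrite /shear !mxE big_ord1 !mxE andbT.
have n1 i : (lift 0 i == 0 :> 'I_n.+1) = false by rewrite eq_sym eq_liftF.
by repeat split; move=> *;
  rewrite E ?c0 ?n1 ?eq_liftF ?(inj_eq lift_inj) ?eqxx ?mulr0 ?mul0r ?mul1r ?addr0 ?add0r.
Qed.

Lemma sum_delta (F : 'I_n -> K) j : \sum_i F i * (i == j)%:R = F j.
Proof.
rewrite (bigD1 j) //= eqxx mulr1 big1 ?addr0 // => i /negPf ->.
by rewrite mulr0.
Qed.

Lemma shear_mul (M : 'M[K]_n.+1) :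
  (forall j, (shear c *m M) 0 j = M 0 j + \sum_k c 0 (lift 0 k) * M (lift 0 k) j)
  * (forall i j, (shear c *m M) (lift 0 i) j = M (lift 0 i) j).
Proof.
split=> [j | i j]; rewrite mxE big_ord_recl !shearE.
  by rewrite mul1r; congr (_ + _); apply: eq_bigr => k _; rewrite shearE.
rewrite mul0r add0r -[RHS](sum_delta (fun k => M (lift 0 k) j)).
by apply: eq_bigr => k _; rewrite shearE eq_sym mulrC.
Qed.

Lemma mul_shear (M : 'M[K]_n.+1) :
  (forall i, (M *m shear c) i 0 = M i 0)
  * (forall i j, (M *m shear c) i (lift 0 j) = M i (lift 0 j) + M i 0 * c 0 (lift 0 j)).
Proof.
split=> [i | i j]; rewrite mxE big_ord_recl !shearE.
  by rewrite mulr1 big1 ?addr0 // => k _; rewrite shearE mulr0.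
rewrite addrC -[in RHS](sum_delta (fun k => M i (lift 0 k))); congr (_ + _).
by apply: eq_bigr => k _; rewrite shearE.
Qed.

Lemma mul_shear_tr (M : 'M[K]_n.+1) :
  (forall i, (M *m (shear c)^T) i 0 = M i 0 + \sum_k c 0 (lift 0 k) * M i (lift 0 k))
  * (forall i j, (M *m (shear c)^T) i (lift 0 j) = M i (lift 0 j)).
Proof.
have E i j : (M *m (shear c)^T) i j = (shear c *m M^T) j i.
  by rewrite -[M in LHS]trmxK -trmx_mul mxE.
split=> *; rewrite E shear_mul mxE //; congr (_ + _).
by apply: eq_bigr => k _; rewrite mxE.
Qed.

Lemma shear_tr_mul (M : 'M[K]_n.+1) :
  (forall j, ((shear c)^T *m M) 0 j = M 0 j)
  * (forall i j, ((shear c)^T *m M) (lift 0 i) j = M (lift 0 i) j + M 0 j * c 0 (lift 0 i)).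
Proof.
have E i j : ((shear c)^T *m M) i j = (M^T *m shear c) j i.
  by rewrite -[M in LHS]trmxK -trmx_mul mxE.
by split=> *; rewrite E mul_shear !mxE.
Qed.

End ShearEntries.

Section Gr36Equivalence.
Variable K : numClosedFieldType.
Local Notation W := (extpow K 3 (3 + 3)).
Local Notation V := (Vsym K 4).
Local Notation Zinv := (@Zinv K 4).

(* A shear acts on the Grassmannian by [P |-> P - Q *m cross c], [Q |-> Q]. *)
Lemma phiq_shear (S : 'M[K]_3) (c : 'rV[K]_4) (v : V) : c 0 0 = 0 ->
  let w := phiq 1 S (\adj S) (\det S) in
  let P := 1%:M - S *m cross (fun j => c 0 (lift 0 j)) in
  vA v = shear c *m vA w *m (shear c)^T ->
  vB v = (shear (- c))^T *m vB w *m shear (- c) ->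
  v = phiq (\det P) (\adj P *m S) (\adj S *m P) (\det S).
Proof.
move=> c0; rewrite -(sympart_cross S).
move: (axial S) (sympart_sym S); move: (sympart S) => N a sN.
set g := fun j => c 0 (lift 0 j).
have [e10 e20 e21] : [/\ N o1 o0 = N o0 o1, N o2 o0 = N o0 o2 & N o2 o1 = N o1 o2].
  by split; rewrite -{1}sN mxE.
have sA := chartA_sym a sN.
move=> w P; rewrite {}/w {}/P phiq_chart // vA_mk ?vB_mk ?sA ?bordered_sym // => Av Bv.
have nc0 : (- c) 0 0 = 0 by rewrite mxE c0 oppr0.
have ncE j : (- c) 0 (lift 0 j) = - g j by rewrite mxE.
have A00 : vA v 0 0 = 1 + \sum_k g k * a k
    + \sum_l g l * (a l + \sum_k g k * (\adj N k l + a k * a l)).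
  rewrite Av (mul_shear_tr c0) !(shear_mul c0) /chartA !borderedE; congr (_ + _ + _).
    by apply: eq_bigr => k _; rewrite borderedE.
  apply: eq_bigr => l _; rewrite (shear_mul c0) borderedE; congr (_ * (_ + _)).
  by apply: eq_bigr => k _; rewrite borderedE mxE.
have A0j : vrow (vA v) = fun j => a j + \sum_k g k * (\adj N k j + a k * a j).
  apply/funext => j; rewrite /vrow Av (mul_shear_tr c0) (shear_mul c0) borderedE.
  by congr (_ + _); apply: eq_bigr => k _; rewrite borderedE mxE.
have Aij : vblock (vA v) = \matrix_(i, j) (\adj N i j + a i * a j).
  apply/matrixP => i j; rewrite mxE Av (mul_shear_tr c0) (shear_mul c0) borderedE.
  by rewrite !mxE.
have B00 : vB v 0 0 = \det N + \sum_i a i * \sum_j N i j * a j.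
  by rewrite Bv (mul_shear nc0) (shear_tr_mul nc0) borderedE.
have B0j : vrow (vB v) = fun j => - (\sum_k N j k * a k)
    - (\det N + \sum_i a i * \sum_j N i j * a j) * g j.
  apply/funext => j; rewrite /vrow Bv (mul_shear nc0) !(shear_tr_mul nc0) !borderedE.
  by rewrite ncE mulrN.
have Bij : vblock (vB v) = \matrix_(i, j) (N i j + (\sum_k N j k * a k) * g i
   + ((\sum_k N i k * a k) + (\det N + \sum_i a i * \sum_j N i j * a j) * g i) * g j).
  apply/matrixP => i j; rewrite [LHS]mxE [RHS]mxE Bv (mul_shear nc0) !(shear_tr_mul nc0) !borderedE.
  by rewrite !ncE; ring.
rewrite -[v in LHS]phiq_eta; congr phiq.
- by rewrite A00 det3 !mxE !big3 !adj3 !mxE !nxE /= ?e10 ?e20 ?e21; ring.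
- rewrite Bij A0j; apply/matrixP => i j.
  rewrite mulmx3 !adj3 !mxE !big3 det3 !adj3 !mxE.
  by case: (ord3P i) => ->; case: (ord3P j) => ->; rewrite !nxE /= ?e10 ?e20 ?e21; ring.
- rewrite Aij B0j; apply/matrixP => i j.
  rewrite mulmx3 !mxE !cofactor3 !mxE !big3 det3 !mxE.
  by case: (ord3P i) => ->; case: (ord3P j) => ->; rewrite !nxE /= ?e10 ?e20 ?e21; ring.
- by rewrite B00 !det3 !big3 !mxE /= ?e10 ?e20 ?e21; ring.
Qed.

Lemma row_free_chart (P S X Y : 'M[K]_3) : P *m X + S *m Y = 1%:M -> row_free (row_mx P S).
Proof. by move=> E; apply/row_freeP; exists (col_mx X Y); rewrite mul_row_col. Qed.

Definition is_plucker (v : V) := exists (P Q : 'M[K]_3) (a : K),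
  [/\ row_free (row_mx P Q), a != 0 &
      phiq (\det P) (\adj P *m Q) (\adj Q *m P) (\det Q) = a *: v].

Lemma is_plucker_scale b v : b != 0 -> is_plucker (b *: v) -> is_plucker v.
Proof.
move=> b0 [P [Q [a [fr a0 E]]]]; exists P, Q, (a * b); split=> //.
  by rewrite mulf_neq0.
by rewrite E scalerA.
Qed.

Lemma is_plucker_A v : Zinv v -> vA v != 0 -> is_plucker v.
Proof.
move=> Zv vn0; have [c c0 Hc] := shear_neq0 (vA_sym v) vn0.
have nc0 : (- c) 0 0 = 0 by rewrite mxE c0 oppr0.
have [F [FA FB FZ _]] := conj_map (det_shear c0) (shearK c0).
have Zw := ZinvZ (vA (F v) 0 0)^-1 (FZ v Zv).
have Fv0 : vA (F v) 0 0 != 0 by rewrite FA.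
set b := vA (F v) 0 0 in Zw Fv0; set w := _ *: _ in Zw.
have w1 : vA w 0 0 = 1 by rewrite vAZ mxE mulVf.
have := Zinv4_chart Zw w1; set S := (_ + _) => wE.
apply: (@is_plucker_scale b^-1); first by rewrite invr_neq0.
have gK : shear (- c) *m shear c = 1%:M by have := shearK nc0; rewrite opprK.
have := @phiq_shear S (- c) (b^-1 *: v) nc0; rewrite /= -wE opprK.
have -> : vA (b^-1 *: v) = shear (- c) *m vA w *m (shear (- c))^T.
  rewrite !vAZ FA -scalemxAr -scalemxAl !mulmxA gK mul1mx.
  by rewrite -mulmxA -trmx_mul gK trmx1 mulmx1.
have -> : vB (b^-1 *: v) = (shear c)^T *m vB w *m shear c.
  rewrite !vBZ FB -scalemxAr -scalemxAl !mulmxA -trmx_mul gK trmx1 mul1mx.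
  by rewrite -mulmxA gK mulmx1.
move=> /(_ erefl erefl); set P := 1%:M - _ => E.
exists P, S, 1; split; [ | exact: oner_neq0 | by rewrite scale1r -E].
(* [P] may be singular; by its definition [P + S *m cross _ = 1], which exhibits a right inverse of
   [(P | S)]. *)
apply: (@row_free_chart P S 1%:M (cross (fun j => (- c) 0 (lift 0 j)))).
by rewrite mulmx1 subrK.
Qed.

(** If [A = 0], the exchange of [A] and [B] is used; on the Grassmannian it is the exchange of [P]
    and [Q]. *)
Lemma is_plucker_Zinv v : Zinv v -> v != 0 -> is_plucker v.
Proof.
move=> Zv v0; have [A0|] := eqVneq (vA v) 0; last exact: is_plucker_A.
have [F [FA FB FZ _]] := swap_map K 3.
have B0 : vA (F v) != 0.
  by rewrite FA; apply: contraNneq v0 => B0; apply/eqP/Vsym_eq; rewrite ?vA0 ?vB0.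
have [P [Q [a [fr a0 E]]]] := is_plucker_A (FZ v Zv) B0.
exists Q, P, a; split=> //.
  have /row_freeP[X XE] := fr; apply: (@row_free_chart Q P (dsubmx X) (usubmx X)).
  by rewrite addrC -mul_row_col vsubmxK.
apply: Vsym_eq.
  by have := congr1 (@vB K 4) E; rewrite vAZ vBZ FB vA_phiq vB_phiq.
by have := congr1 (@vA K 4) E; rewrite vAZ vBZ FA vA_phiq vB_phiq.
Qed.

Lemma phi_equivalence : exists phi : 'Hom(W, V),
  [/\ lker phi = 0%VS, limg phi = fullv &
    forall w, phi w = phiq (w tripP) (cS w) (cT w) (w tripQ)].
Proof.
have [|phi Hphi] := @linear_hom K W V (fun w => phiq (w tripP) (cS w) (cT w) (w tripQ)).
  by move=> a u w; rewrite cSD cTD !ffunE phiq_linear.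
exists phi; split=> //.
  apply/eqP/lker0P => u w; rewrite !Hphi => /phiq_inj[e1 e2 e3 e4].
  by rewrite -(psi_coord u) -(psi_coord w) e1 e2 e3 e4.
apply/eqP; rewrite eqEsubv subvf; apply/subvP => v _.
pose w := psi (vA v 0 0) (vblock (vB v) + cross (vrow (vA v)))
  (vblock (vA v) + cross (vrow (vB v))) (vB v 0 0).
have [e1 e2 e3 e4] : [/\ w tripP = vA v 0 0, cS w = vblock (vB v) + cross (vrow (vA v)),
    cT w = vblock (vA v) + cross (vrow (vB v)) & w tripQ = vB v 0 0] by exact: psi_coordK.
apply/memv_imgP; exists w; first exact: memvf.
by rewrite Hphi e1 e2 e3 e4 phiq_eta.
Qed.

Lemma Xinv4_equivalent : proj_equivalent (Gr K 3 6) (Xinv_sym K 4).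
Proof.
have [phi [ker img Hphi]] := phi_equivalence; exists phi; split=> // x y yx.
have inj : injective phi by apply/lker0P; rewrite ker.
have [u xu] := homog_coord_ex x.
have yu : homog_coord y (phi u).
  split; first by rewrite yx memv_img //; case: xu.
  by apply: contraNneq (xu.2) => e; apply/eqP/inj; rewrite e linear0.
have phiE (P Q : 'M[K]_3) : phi (plucker (row_mx P Q)) =
    phiq (\det P) (\adj P *m Q) (\adj Q *m P) (\det Q).
  by rewrite Hphi plucker_psi; have [-> -> -> ->] := psi_coordK (\det P) (\adj P *m Q) (\adj Q *m P) (\det Q).
split=> [[M [fM xM]] | Yy].
  apply/(XinvP yu); have [a a0 uE] := (homog_coordP _ xM).1 xu.
  rewrite uE linearZ; apply: ZinvZ.
  pose M' : 'M[K]_(3, 3 + 3) := M.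
  have := Zinv_plucker (lsubmx M') (rsubmx M').
  by rewrite -phiE hsubmxK.
have [P [Q [a [fr a0 E]]]] := is_plucker_Zinv ((XinvP yu).1 Yy) (yu.2).
exists (row_mx P Q); split=> //.
apply/(homog_coordP _ xu); exists a => //; apply: inj.
by rewrite phiE E linearZ.
Qed.

Lemma dim_Vsym4 : \dim {:V} = 20.
Proof.
have [phi [ker img _]] := phi_equivalence.
rewrite -img (@limg_dim_eq _ _ _ phi fullv) ?ker ?capv0 // dimvf.
rewrite [LHS](_ : _ = #|incr_tuple 3 (3 + 3)| * 1)%N // muln1 card_sig.
by rewrite -[RHS](card_ltn_sorted_tuples 3 6) cardsE.
Qed.

Lemma Xinv4_dim : has_pdim (Xinv_sym K 4) 9.
Proof.
have [U [inU dU]] := half_space K 4.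
have := has_dim_Zinv inU; rewrite (_ : \dim {:subvs_of U} = 10%N) //.
by rewrite dimvf; move: dU; rewrite dim_Vsym4; rewrite [dim _](_ : _ = \dim U) //; lia.
Qed.

End Gr36Equivalence.

(** * The case m = 3: the Lagrangian Grassmannian *)

Section Relations.
Variable K : numClosedFieldType.
Local Notation V := (Vsym K 3).
Local Notation Zinv := (@Zinv K 3).
Implicit Types (A B P Q : 'M[K]_3) (s : K).

(* The homogeneous form of [B = A ^-1], [det A = 1]; on a nonzero pair [(A, B)]
   it determines [s], which is thus a regular function not induced by a linear
   form. *)
Definition Rel3 A B s := [/\ s *: A = \adj B, s *: B = \adj A & A *m B = (s * s)%:M].


Lemma Rel3_scale b A B s : Rel3 A B s -> Rel3 (b *: A) (b *: B) (b * s).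
Proof.
move=> [sA sB AB]; split; rewrite ?adjZ -?sA -?sB ?scalerA /=; try by congr (_ *: _); ring.
by rewrite -scalemxAl -scalemxAr AB !scale_scalar_mx; congr (_%:M); ring.
Qed.

Lemma Rel3_swap A B s : A^T = A -> B^T = B -> Rel3 A B s -> Rel3 B A s.
Proof.
move=> symA symB [sA sB AB]; split=> //.
by rewrite -[LHS]trmxK trmx_mul symA symB AB tr_scalar_mx.
Qed.

Lemma adj_inv (g h : 'M[K]_3) : \det g = 1 -> g *m h = 1%:M -> \adj g = h /\ \adj h = g.
Proof.
move=> dg gh; split; first by rewrite (inv_adj dg gh).
have dh : \det h = 1 by have := congr1 determinant gh; rewrite det_mulmx dg mul1r det1.
by rewrite -(inv_adj dh (mulmx1C gh)).
Qed.

Lemma Rel3_conj g h A B s : \det g = 1 -> g *m h = 1%:M -> Rel3 A B s ->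
  Rel3 (g *m A *m g^T) (h^T *m B *m h) s.
Proof.
move=> dg gh [sA sB AB]; have [ag ah] := adj_inv dg gh; have hg := mulmx1C gh.
split.
- by rewrite !adj_mul3 -trmx_adj ah -sA -scalemxAl -scalemxAr mulmxA.
- by rewrite !adj_mul3 -trmx_adj ag -sB -scalemxAl -scalemxAr mulmxA.
rewrite !mulmxA -(mulmxA _ g^T) -trmx_mul hg trmx1 mulmx1.
by rewrite -(mulmxA _ A) AB mul_mx_scalar -scalemxAl gh scalemx1.
Qed.

(** Reduction to the chart [A o0 o0 = 1]: a shear makes the corner of a nonzero [A] nonzero, a
    scaling makes it 1, and the exchange covers [A = 0]. It includes the triples with [s = 0], where
    no inverse exists. *)
Lemma Rel3_ind (F : 'M[K]_3 -> 'M[K]_3 -> K -> Prop) :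
  (forall g h A B s, \det g = 1 -> g *m h = 1%:M ->
     F (g *m A *m g^T) (h^T *m B *m h) s -> F A B s) ->
  (forall A B s, F B A s -> F A B s) ->
  (forall b A B s, b != 0 -> F (b *: A) (b *: B) (b * s) -> F A B s) ->
  (forall A B s, A^T = A -> B^T = B -> Rel3 A B s -> A o0 o0 = 1 -> F A B s) ->
  forall A B s, A^T = A -> B^T = B -> (A != 0) || (B != 0) -> Rel3 A B s -> F A B s.
Proof.
move=> Fconj Fswap Fscale F1.
have FA A B s : A^T = A -> B^T = B -> A != 0 -> Rel3 A B s -> F A B s.
  move=> sA sB A0 R; have [c c0 Hc] := shear_neq0 sA A0.
  apply: (Fconj _ _ _ _ _ (det_shear c0) (shearK c0)).
  have R' := Rel3_conj (det_shear c0) (shearK c0) R.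
  set g := shear c in Hc R' *; set h := shear (- c) in R' *.
  set A' := g *m A *m g^T in Hc R' *; set B' := h^T *m B *m h in R' *.
  have A'0 : (A' 0 0)^-1 != 0 by rewrite invr_eq0.
  apply: (Fscale _ _ _ _ A'0); apply: F1.
  - by rewrite linearZ /= /A' !trmx_mul trmxK sA mulmxA.
  - by rewrite linearZ /= /B' !trmx_mul trmxK sB mulmxA.
  - exact: Rel3_scale.
  - have -> : o0 = 0 by apply/val_inj.
    by rewrite mxE mulVf.
move=> A B s sA sB /orP[A0|B0] R; first exact: FA.
by apply/Fswap/FA => //; exact: Rel3_swap.
Qed.

(** In the chart the relations become a graph over five free parameters: the corner of [s A = adj B]
    gives [s], the lower block of [s B = adj A] gives that of [A], and the first row of [A B] gives
    that of [B]. *)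
Lemma Rel3_chart A B s : A^T = A -> B^T = B -> Rel3 A B s -> A o0 o0 = 1 ->
  let a1 := A o0 o1 in let a2 := A o0 o2 in
  let x := B o1 o1 in let y := B o1 o2 in let z := B o2 o2 in
  [/\ s = x * z - y * y, A o1 o1 = a1 * a1 + s * z, A o1 o2 = a1 * a2 - s * y,
      A o2 o2 = a2 * a2 + s * x &
   [/\ B o0 o1 = - (a1 * x + a2 * y), B o0 o2 = - (a1 * y + a2 * z) &
      B o0 o0 = s * s + a1 * (a1 * x + a2 * y) + a2 * (a1 * y + a2 * z)]].
Proof.
move=> symA symB [sA sB AB] A1 a1 a2 x y z.
have AE i j : A i j = A j i by rewrite -{1}symA mxE.
have BE i j : B i j = B j i by rewrite -{1}symB mxE.
have eA i j : s * A i j = \adj B i j by rewrite -sA mxE.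
have eB i j : s * B i j = \adj A i j by rewrite -sB mxE.
have eAB i j : (A *m B) i j = (s * s) *+ (i == j) by rewrite AB mxE.
have E1 := eA o0 o0; have E2 := eB o2 o2; have E3 := eB o1 o2; have E4 := eB o1 o1.
rewrite adj3 !nxE A1 (BE o2 o1) -/x -/y -/z mulr1 in E1.
rewrite adj3 !nxE A1 (AE o1 o0) -/a1 -/z in E2.
rewrite adj3 !nxE A1 (AE o1 o0) -/a1 -/a2 -/y in E3.
rewrite adj3 !nxE A1 (AE o2 o0) -/a2 -/x in E4.
have E5 := eAB o0 o1; have E6 := eAB o0 o2; have E7 := eAB o0 o0.
rewrite mulmx3 A1 -/a1 -/a2 -/x (BE o2 o1) -/y /= mulr0n in E5.
rewrite mulmx3 A1 -/a1 -/a2 -/y -/z /= mulr0n in E6.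
rewrite mulmx3 A1 -/a1 -/a2 (BE o1 o0) (BE o2 o0) /= mulr1n in E7.
have B01 : B o0 o1 = - (a1 * x + a2 * y).
  by apply/eqP; rewrite -subr_eq0 -[X in _ == X]E5; apply/eqP; ring.
have B02 : B o0 o2 = - (a1 * y + a2 * z).
  by apply/eqP; rewrite -subr_eq0 -[X in _ == X]E6; apply/eqP; ring.
split; first exact: E1.
- by rewrite E2; ring.
- by rewrite E3; ring.
- by rewrite E4; ring.
split=> //; rewrite -E7 B01 B02; ring.
Qed.

Lemma adj_zero3 : \adj (0 : 'M[K]_3) = 0.
Proof. by apply/matrixP => i j; rewrite adj3 !mxE; ring. Qed.

(** No polynomial in the entries of the pair is at hand for [s], so the relations are passed to the
    closure in cross-multiplied form, and [s] is recovered as a quotient at a nonzero entry of [A].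
    If [A = 0], then [r3] forces [adj B = 0], and [s = 0] does. *)
Lemma Rel3_of_Zinv v : Zinv v -> exists s, Rel3 (vA v) (vB v) s.
Proof.
move=> Zv; have m0 := ltn0Sn 2; have HP := pfunP V.
have pA : mxfun (@pfun K V) (fun v => vA v) := @pfun_vA K 3.
have pB : mxfun (@pfun K V) (fun v => vB v) := @pfun_vB K 3.
have pa := mxfun_adj HP pA; have pb := mxfun_adj HP pB; have pAB := @mxfun_AB K 2.
have onINV u : INVc u -> exists t A B, [/\ A *m B = 1%:M, vA u = t *: A, vB u = t *: B,
    \adj (vA u) = (t * t) *: B & \adj (vB u) = (t * t) *: A].
  move=> [t [A [B [sA dA AB -> ->]]]]; exists t, A, B; split=> //.
    by rewrite adjZ (adj_inv dA AB).1.
  by rewrite adjZ (adj_inv dA AB).2.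
have r1 i j k l : \adj (vB v) i j * vA v k l - \adj (vB v) k l * vA v i j = 0.
  apply: (Zinv_pfun m0 (h := fun v : V => \adj (vB v) i j * vA v k l - \adj (vB v) k l * vA v i j)) Zv.
    by apply: (falgB HP); apply: (falgM HP).
  by move=> u /onINV[t [A [B [_ -> -> _ ->]]]]; rewrite !mxE; ring.
have r3 i j k l : \adj (vB v) i j * vB v k l - \adj (vA v) k l * vA v i j = 0.
  apply: (Zinv_pfun m0 (h := fun v : V => \adj (vB v) i j * vB v k l - \adj (vA v) k l * vA v i j)) Zv.
    by apply: (falgB HP); apply: (falgM HP).
  by move=> u /onINV[t [A [B [_ -> -> -> ->]]]]; rewrite !mxE; ring.
have r4 i j k l : (vA v *m vB v) i j * (vA v k l * vA v k l)
    - (i == j)%:R * (\adj (vB v) k l * \adj (vB v) k l) = 0.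
  apply: (Zinv_pfun m0 (h := fun v : V => (vA v *m vB v) i j * (vA v k l * vA v k l)
    - (i == j)%:R * (\adj (vB v) k l * \adj (vB v) k l))) Zv.
    by apply: (falgB HP); repeat apply: (falgM HP) => //; exact: falgC.
  move=> u /onINV[t [A [B [AB -> -> _ ->]]]].
  by rewrite -scalemxAl -scalemxAr AB !mxE -mulr_natr; ring.
have [A0|A0] := eqVneq (vA v) 0.
  have [B0|B0] := eqVneq (vB v) 0.
    exists 0; rewrite A0 B0; split; rewrite ?scale0r ?adj_zero3 ?mulmx0 ?mulr0 ?raddf0 //.
  have /matrix0Pn[k [l Bkl]] := B0.
  exists 0; split; rewrite ?scale0r ?A0 ?mul0mx ?mulr0 ?raddf0 ?adj_zero3 //.
    apply/matrixP => i j; rewrite [LHS]mxE.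
    have /eqP := r3 i j k l; rewrite A0 [(0 : 'M[K]_3) i j]mxE mulr0 subr0.
    by rewrite mulf_eq0 (negPf Bkl) orbF => /eqP ->.
have /matrix0Pn[k [l Akl]] := A0.
exists (\adj (vB v) k l / vA v k l); split; apply/matrixP => i j.
- rewrite [LHS]mxE; apply: (mulIf Akl); have /eqP := r1 i j k l; rewrite subr_eq0 => /eqP ->.
  by rewrite mulrAC divfK.
- rewrite [LHS]mxE; apply: (mulIf Akl); have /eqP := r3 k l i j; rewrite subr_eq0 => /eqP <-.
  by rewrite mulrAC divfK.
have AA : vA v k l * vA v k l != 0 by rewrite mulf_neq0.
apply: (mulIf AA); have /eqP := r4 i j k l; rewrite subr_eq0 => /eqP ->.
have sc (c : K) : (c%:M : 'M[K]_3) i j = (i == j)%:R * c by rewrite mxE mulr_natl.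
by rewrite sc -mulrA; congr (_ * _); field.
Qed.

Definition mx3 (a b c d e f g h i : K) : 'M[K]_3 :=
  \matrix_(k, l) nth 0 (nth [::] [:: [:: a; b; c]; [:: d; e; f]; [:: g; h; i]] k) l.

Lemma mx3E a b c d e f g h i (M := mx3 a b c d e f g h i) :
  (M o0 o0 = a) * (M o0 o1 = b) * (M o0 o2 = c) * (M o1 o0 = d) * (M o1 o1 = e)
  * (M o1 o2 = f) * (M o2 o0 = g) * (M o2 o1 = h) * (M o2 o2 = i).
Proof. by repeat split; rewrite mxE. Qed.

Lemma matrix3P (M N : 'M[K]_3) :
  M o0 o0 = N o0 o0 -> M o0 o1 = N o0 o1 -> M o0 o2 = N o0 o2 ->
  M o1 o0 = N o1 o0 -> M o1 o1 = N o1 o1 -> M o1 o2 = N o1 o2 ->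
  M o2 o0 = N o2 o0 -> M o2 o1 = N o2 o1 -> M o2 o2 = N o2 o2 -> M = N.
Proof.
move=> *; apply/matrixP => i j.
by case: (ord3P i) => ->; case: (ord3P j) => ->.
Qed.

Lemma mxfun_mx3 X (P : (X -> K) -> Prop) a b c d e f g h i :
  P a -> P b -> P c -> P d -> P e -> P f -> P g -> P h -> P i ->
  mxfun P (fun x => mx3 (a x) (b x) (c x) (d x) (e x) (f x) (g x) (h x) (i x)).
Proof.
move=> Pa Pb Pc Pd Pe Pf Pg Ph Pi k l.
by case: (ord3P k) => ->; case: (ord3P l) => ->;
  under [X in P X]funext do rewrite mx3E.
Qed.

Definition chart3A (a1 a2 x y z s : K) := mx3 1 a1 a2
  a1 (a1 * a1 + s * z) (a1 * a2 - s * y) a2 (a1 * a2 - s * y) (a2 * a2 + s * x).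
Definition chart3B (a1 a2 x y z s : K) :=
  mx3 (s * s + a1 * (a1 * x + a2 * y) + a2 * (a1 * y + a2 * z))
    (- (a1 * x + a2 * y)) (- (a1 * y + a2 * z))
    (- (a1 * x + a2 * y)) x y (- (a1 * y + a2 * z)) y z.

Lemma Rel3_chartE A B s : A^T = A -> B^T = B -> Rel3 A B s -> A o0 o0 = 1 ->
  exists a1 a2 x y z, [/\ s = x * z - y * y,
    A = chart3A a1 a2 x y z s & B = chart3B a1 a2 x y z s].
Proof.
move=> sA sB R A1; have [Es E11 E12 E22 [F1 F2 F0]] := Rel3_chart sA sB R A1.
have AE i j : A i j = A j i by rewrite -{1}sA mxE.
have BE i j : B i j = B j i by rewrite -{1}sB mxE.
exists (A o0 o1), (A o0 o2), (B o1 o1), (B o1 o2), (B o2 o2); split=> //.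
  by apply: matrix3P; rewrite mx3E // AE.
by apply: matrix3P; rewrite mx3E // BE.
Qed.

(** If [s != 0], the pair satisfies [det A = s^3] and [A B = s^2]. Shifting [x] and [z] by [t] turns
    [s] into a monic quadratic polynomial in [t], so the general case is a limit. *)
Lemma Zinv_chart3 a1 a2 x y z (s := x * z - y * y) :
  Zinv (mkV (chart3A a1 a2 x y z s) (chart3B a1 a2 x y z s)).
Proof.
pose st t := (x + t) * (z + t) - y * y.
pose r : {poly K} := 'X^2 + (x + z) *: 'X + s%:P.
have rE t : r.[t] = st t.
  by rewrite /r !hornerD hornerXn hornerZ hornerX hornerC /st /s; ring.
have r0 : r != 0.
  apply/eqP => /(congr1 (fun q : {poly K} => q`_2)).
  rewrite /r !coefD coefXn coefZ coefX coefC coef0 /= mulr0 !addr0.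
  by move/eqP; rewrite oner_eq0.
have HP := upolyP K.
have -> : mkV (chart3A a1 a2 x y z s) (chart3B a1 a2 x y z s) =
    mkV (chart3A a1 a2 (x + 0) y (z + 0) (st 0)) (chart3B a1 a2 (x + 0) y (z + 0) (st 0)).
  by rewrite /st !addr0.
apply: (Zinv_limit (ltn0Sn 2)
  (A := fun t => chart3A a1 a2 (x + t) y (z + t) (st t))
  (B := fun t => chart3B a1 a2 (x + t) y (z + t) (st t)) _ _ _ _ r0).
- apply: mxfun_mx3; rewrite /st; do ![exact: (falgC HP) | exact: upoly_id | apply: (falgD HP)
    | apply: (falgN HP) | apply: (falgM HP)].
- apply: mxfun_mx3; rewrite /st; do ![exact: (falgC HP) | exact: upoly_id | apply: (falgD HP)
    | apply: (falgN HP) | apply: (falgM HP)].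
- by move=> t; apply: matrix3P; rewrite mxE !mx3E.
- by move=> t; apply: matrix3P; rewrite mxE !mx3E.
move=> t; rewrite rE => st0; apply: INVc_Zinv => //; apply: (INVc_crit st0).
- by apply: matrix3P; rewrite mxE !mx3E.
- by rewrite det3 !mx3E /st; ring.
- by apply: matrix3P; rewrite mulmx3 !mx3E [RHS]mxE /= /st ?mulr1n ?mulr0n; ring.
Qed.

Lemma Zinv_of_Rel3 A B s : A^T = A -> B^T = B -> Rel3 A B s -> Zinv (mkV A B).
Proof.
move=> sA sB R; have [nz|] := boolP ((A != 0) || (B != 0)); last first.
  rewrite negb_or !negbK => /andP[/eqP A0 /eqP B0].
  have -> : mkV A B = 0 by apply: Vsym_eq; rewrite ?vA_mk ?vB_mk ?vA0 ?vB0.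
  by left.
apply: (@Rel3_ind (fun A B s => A^T = A -> B^T = B -> Zinv (mkV A B))) (R) (sA) (sB);
  [| | | | exact: sA | exact: sB | exact: nz].
- move=> g h A' B' _ dg gh H sA' sB'; have hg := mulmx1C gh.
  have dh : \det h = 1 by have := congr1 determinant gh; rewrite det_mulmx dg mul1r det1.
  have [F [FA FB FZ _]] := conj_map dh hg.
  have sA'' : (g *m A' *m g^T)^T = g *m A' *m g^T by rewrite !trmx_mul trmxK sA' mulmxA.
  have sB'' : (h^T *m B' *m h)^T = h^T *m B' *m h by rewrite !trmx_mul trmxK sB' mulmxA.
  have := FZ _ (H sA'' sB''); congr (cone _ _).
  apply: Vsym_eq; rewrite ?FA ?FB !(vA_mk, vB_mk) //.
    by rewrite !mulmxA hg mul1mx -mulmxA -trmx_mul hg trmx1 mulmx1.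
  by rewrite !mulmxA -trmx_mul hg trmx1 mul1mx -mulmxA hg mulmx1.
- move=> A' B' _ H sA' sB'; have [F [FA FB FZ _]] := swap_map K 2.
  have := FZ _ (H sB' sA'); congr (cone _ _).
  by apply: Vsym_eq; rewrite ?FA ?FB !(vA_mk, vB_mk).
- move=> b A' B' _ b0 H sA' sB'.
  have sA'' : (b *: A')^T = b *: A' by rewrite linearZ /= sA'.
  have sB'' : (b *: B')^T = b *: B' by rewrite linearZ /= sB'.
  have := ZinvZ b^-1 (H sA'' sB''); congr (cone _ _).
  by apply: Vsym_eq; rewrite ?vAZ ?vBZ !(vA_mk, vB_mk) // scalerA mulVf // scale1r.
- move=> A' B' s' sA' sB' R' A1 _ _.
  have [a1 [a2 [x [y [z [-> -> ->]]]]]] := Rel3_chartE sA' sB' R' A1.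
  exact: Zinv_chart3.
Qed.

Lemma Rel3_uniq A B s t : (A != 0) || (B != 0) -> Rel3 A B s -> Rel3 A B t -> s = t.
Proof.
have H (C : 'M[K]_3) : C != 0 -> s *: C = t *: C -> s = t.
  move=> C0 /eqP; rewrite -subr_eq0 -scalerBl scaler_eq0 (negPf C0) orbF subr_eq0.
  by move/eqP.
move=> /orP[A0|B0] [eA eB _] [eA' eB' _]; first by apply: (H A) => //; rewrite eA.
by apply: (H B) => //; rewrite eB.
Qed.

(* [A], [B], [s] are, up to a common factor, the Pluecker coordinates of a
   Lagrangian row space [(P | Q)] with [det P = det Q]. *)
Definition lagr3 A B s := exists P Q a, [/\ a != 0, P *m Q^T = Q *m P^T, \det P = a * s,
  \adj P *m Q = a *: A & \adj Q *m P = a *: B /\ \det Q = a * s].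

Lemma lagr3_of_Rel3 A B s : A^T = A -> B^T = B -> (A != 0) || (B != 0) ->
  Rel3 A B s -> lagr3 A B s.
Proof.
apply: Rel3_ind => {A B s}.
- move=> g h A B s dg gh [P [Q [a [a0 PQ dP S [T dQ]]]]].
  have hg := mulmx1C gh; have [ag ah] := adj_inv dg gh.
  have dh : \det h = 1 by have := congr1 determinant gh; rewrite det_mulmx dg mul1r det1.
  exists (P *m g), (Q *m h^T), a; rewrite !det_mulmx det_tr dg dh !mulr1; split=> //.
  + rewrite !trmx_mul trmxK !mulmxA -(mulmxA P) gh mulmx1.
    by rewrite -(mulmxA Q) -trmx_mul gh trmx1 mulmx1.
  + rewrite adj_mul3 ag -mulmxA (mulmxA (\adj P)) S -scalemxAl -scalemxAr; congr (_ *: _).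
    by rewrite !mulmxA hg mul1mx -mulmxA -trmx_mul hg trmx1 mulmx1.
  + split=> //; rewrite adj_mul3 -trmx_adj ah -mulmxA (mulmxA (\adj Q)) T -scalemxAl -scalemxAr.
    congr (_ *: _).
    by rewrite !mulmxA -trmx_mul hg trmx1 mul1mx -mulmxA hg mulmx1.
- move=> A B s [P [Q [a [a0 PQ dP S [T dQ]]]]].
  by exists Q, P, a; split.
- move=> b A B s b0 [P [Q [a [a0 PQ dP S [T dQ]]]]].
  exists P, Q, (a * b); rewrite mulf_neq0 // -!mulrA -!scalerA; split=> //.
- move=> A B s sA sB R A1.
  have [a1 [a2 [x [y [z [sE -> ->]]]]]] := Rel3_chartE sA sB R A1.
  (* Row reduction of [(s | A)]: multiples of the first row are subtracted from the other two, which
     are then divisible by [s] and are divided by it. The result keeps rank 3 at [s = 0]. *)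
  exists (mx3 s 0 0 (- a1) 1 0 (- a2) 0 1), (mx3 1 a1 a2 0 z (- y) 0 (- y) x), 1.
  rewrite oner_neq0 !mul1r !scale1r; split=> //.
  + by apply: matrix3P; rewrite !mulmx3 ![(_^T) _ _]mxE !mx3E; ring.
  + by rewrite det3 !mx3E; ring.
  + by apply: matrix3P; rewrite mulmx3 !adj3 !nxE !mx3E; ring.
  split; last by rewrite det3 !mx3E sE; ring.
  by apply: matrix3P; rewrite mulmx3 !adj3 !nxE !mx3E ?sE; ring.
Qed.

(** For invertible [P] this is the symmetry of [P^-1 Q]. In general, the antisymmetric part of
    [adj P *m Q] is linear in that of [P *m Q^T], with coefficients from [P]. *)
Lemma lagr3_sym P Q : P *m Q^T = Q *m P^T -> (\adj P *m Q)^T = \adj P *m Q.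
Proof.
move=> PQ; pose E i j := (P *m Q^T) i j - (P *m Q^T) j i.
have E0 i j : E i j = 0.
  rewrite /E; apply/eqP; rewrite subr_eq0; apply/eqP.
  by rewrite {1}PQ -[P in RHS]trmxK -trmx_mul [RHS]mxE.
have key i : (\adj P *m Q) (nx i) (nx (nx i)) - (\adj P *m Q) (nx (nx i)) (nx i) =
    - (P o0 i * E o1 o2 + P o1 i * E o2 o0 + P o2 i * E o0 o1).
  rewrite /E !mulmx3 !adj3 ![(_^T) _ _]mxE.
  by case: (ord3P i) => ->; rewrite !nxE; ring.
have key0 i : (\adj P *m Q) (nx i) (nx (nx i)) = (\adj P *m Q) (nx (nx i)) (nx i).
  by apply/eqP; rewrite -subr_eq0 key !E0 !mulr0 !addr0 oppr0.
have := key0 o0; have := key0 o1; have := key0 o2; rewrite !nxE => k2 k1 k0.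
by apply: matrix3P; rewrite mxE // ?k0 ?k1 ?k2.
Qed.

Lemma Rel3_of_lagr3 P Q s : \det P = s -> \det Q = s ->
  Rel3 (\adj P *m Q) (\adj Q *m P) s.
Proof.
move=> dP dQ; split.
- by rewrite adj_mul3 adj_adj3 dQ -scalemxAr.
- by rewrite adj_mul3 adj_adj3 dP -scalemxAr.
by rewrite mulmxA -(mulmxA _ Q) mul_mx_adj dQ mul_mx_scalar -scalemxAl mul_adj_mx dP scale_scalar_mx.
Qed.

End Relations.

Section LinearSpan.
Variables (K : fieldType) (V : vectType K).

Lemma linear_span_ex (X : set (proj V)) : exists U, linear_span X U.
Proof.
pose Q n := `[< exists U : {vspace V}, \dim U = n /\ X `<=` psubspace U >].
have Q0 : exists n, Q n.
  exists (\dim {:V}); apply/asboolP; exists {:V}%VS; split=> // x _.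
  by rewrite /psubspace /=; exact: subvf.
case: (ex_minnP Q0) => n /asboolP[U [dU XU]] nmin; exists U; split=> // U' XU'.
have : Q (\dim (U :&: U')%VS).
  apply/asboolP; exists (U :&: U')%VS; split=> // x Xx.
  by change (is_true (val x <= U :&: U')%VS); rewrite subv_cap; apply/andP; split; [exact: XU | exact: XU'].
move/nmin; rewrite -dU => dle; have := capvSl U U' => cle.
have /eqP <- : (U :&: U')%VS == U by rewrite -(dimv_leqif_eq cle) eqn_leq dle (dimvS cle).
exact: capvSr.
Qed.

End LinearSpan.

Section RegularMaps.
Variables (K : fieldType) (V W : vectType K).

Lemma polymap_ex d (h : V -> W) : (forall i, hfun d (fun v => coord (vbasis {:W}) i (h v))) ->
  exists2 F : 'I_(\dim {:W}) -> {mpoly K[\dim {:V}]}, (forall j, F j \is d.-homog) &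
    forall v, polymap F v = h v.
Proof.
move=> H; have /choice[F HF] j : exists p : {mpoly K[\dim {:V}]}, p \is d.-homog /\
    forall v, polyfun p v = coord (vbasis {:W}) j (h v).
  by have [p hp Hp] := H j; exists p.
exists F => [j | v]; first by case: (HF j).
rewrite /polymap [RHS](coord_vbasis (memvf _)).
by apply: eq_bigr => j _; case: (HF j) => _ ->.
Qed.

Lemma hfun_ext d (f g : V -> K) : hfun d f -> f =1 g -> hfun d g.
Proof. by move=> [p hp Hp] fg; exists p => // v; rewrite Hp. Qed.

Lemma hfunZ d a (f : V -> K) : hfun d f -> hfun d (fun v => a * f v).
Proof.
move=> [p hp Hp]; exists (a *: p); first exact: dhomogZ.
by move=> v; rewrite /polyfun mevalZ -Hp.
Qed.

Lemma hfun_sum d (I : Type) (r : seq I) (f : I -> V -> K) :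
  (forall i, hfun d (f i)) -> hfun d (fun v => \sum_(i <- r) f i v).
Proof.
move=> H; elim: r => [|i r IH].
  by apply: (hfun_ext (hfun0 V d)) => v; rewrite big_nil.
by apply: (hfun_ext (hfunD (H i) IH)) => v; rewrite big_cons.
Qed.

Lemma pclosed_zero_locus d (h : V -> K) : hfun d h ->
  pclosed [set x : proj V | forall v, homog_coord x v -> h v = 0].
Proof.
move=> [p hp Hp]; exists [set q | q = p]; split; first by move=> q ->; exists d.
apply/seteqP; split=> x H /=; first by move=> q v -> xv; rewrite Hp; exact: H.
by move=> v xv; rewrite -Hp; exact: H.
Qed.

Lemma pclosed0 : pclosed (set0 : set (proj V)).
Proof.
exists [set 1%R]; split; first by move=> q ->; exists 0%N; exact: dhomog1.
apply/seteqP; split=> x //= H; have [v xv] := homog_coord_ex x.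
by have := H 1 v erefl xv; rewrite /polyfun meval1 => /eqP; rewrite oner_eq0.
Qed.

End RegularMaps.

(** * The hyperplane section where det P = det Q *)

Section HyperplaneSection.
Variable K : numClosedFieldType.
Local Notation W := (extpow K 3 (3 + 3)).
Local Notation V := (Vsym K 3).
Local Notation Zinv := (@Zinv K 3).

Lemma stdsymp_mul (P Q P' Q' : 'M[K]_3) :
  row_mx P Q *m stdsymp K 3 *m (row_mx P' Q')^T = P *m Q'^T - Q *m P'^T.
Proof.
rewrite /stdsymp mul_row_block !mulmx0 !mulmx1 add0r addr0 mulmxN mulmx1.
by rewrite tr_row_mx mul_row_col mulNmx addrC.
Qed.

(** An isotropic row space of rank 3 is contained in its perpendicular, which also has rank 3 as
    [stdsymp] is invertible; so they coincide. *)
Lemma lagrangian_rowsP (P Q : 'M[K]_3) : row_free (row_mx P Q) ->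
  lagrangian_rows (row_mx P Q) <-> P *m Q^T = Q *m P^T.
Proof.
move=> fr; set M := row_mx P Q; split=> [L | PQ].
  apply/eqP; rewrite -subr_eq0 -stdsymp_mul -/M; apply/eqP/matrixP => k i.
  have := (L (row i M)).1 (row_sub i M) => /matrixP/(_ k 0).
  move=> H; transitivity ((M *m stdsymp K 3 *m (row i M)^T) k 0); last by rewrite H !mxE.
  rewrite [LHS]mxE [RHS]mxE; apply: eq_bigr => l _.
  by congr (_ * _); rewrite !mxE.
have J1 : stdsymp K 3 *m - stdsymp K 3 = 1%:M.
  rewrite /stdsymp opp_block_mx mulmx_block !(mul0mx, mulmx0, mul1mx, mulmx1, oppr0).
  by rewrite !(mulmxN, mulNmx, mul1mx, opprK, addr0, add0r, oppr0) -scalar_mx_block.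
have J_free : row_free (stdsymp K 3) by apply/row_freeP; exists (- stdsymp K 3).
pose N := kermx (M *m stdsymp K 3)^T.
have inN (v : 'rV[K]_(3 + 3)) : (v <= N)%MS <-> M *m stdsymp K 3 *m v^T = 0.
  split=> [/sub_kermxP H | H]; first by apply: trmx_inj; rewrite trmx_mul trmxK H trmx0.
  by apply/sub_kermxP/trmx_inj; rewrite trmx_mul trmxK H trmx0.
have MN : (M <= N)%MS.
  apply/sub_kermxP/trmx_inj; rewrite trmx_mul trmxK trmx0 stdsymp_mul PQ subrr.
  by [].
have rN : \rank N = \rank M.
  by rewrite mxrank_ker mxrank_tr mxrankMfree // (eqP fr).
have NM : (N <= M)%MS by rewrite -(mxrank_leqif_sup MN) rN.
move=> v; split=> [vM | /inN vN]; last exact: submx_trans vN NM.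
by apply/inN; exact: submx_trans vM MN.
Qed.

Lemma hfun_extpow d (h : V -> W) : (forall t, hfun d (fun v => h v t : K)) ->
  forall l : W -> K, linform l -> hfun d (fun v => l (h v)).
Proof.
move=> H l Hl.
pose e t : W := [ffun u => (u == t)%:R].
have dec w : l w = \sum_t l (e t) * (w t : K).
  have l0 : l 0 = 0 by have := Hl (-1) 0 0; rewrite scaler0 addr0 mulN1r addNr.
  have lD x y : l (x + y) = l x + l y by have := Hl 1 x y; rewrite scale1r mul1r.
  have lZ b x : l (b *: x) = b * l x by have := Hl b x 0; rewrite l0 !addr0.
  have -> : l w = l (\sum_t (w t : K) *: e t).
    congr l; apply/ffunP => u; rewrite sum_ffunE (bigD1 u) //= !ffunE eqxx big1 ?addr0.
      by rewrite /GRing.scale /= mulr1.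
    by move=> t tu; rewrite !ffunE eq_sym (negPf tu) scaler0.
  rewrite (big_morph l lD l0); apply: eq_bigr => t _.
  by rewrite lZ mulrC.
apply: (hfun_ext (f := fun v => \sum_t l (e t) * (h v t : K))) => [|v]; last by rewrite -dec.
by apply: hfun_sum => t; apply: hfunZ.
Qed.

Lemma hfun_psi d (p q : V -> K) (S T : V -> 'M[K]_3) : hfun d p -> hfun d q ->
  (forall i j, hfun d (fun v => S v i j)) -> (forall i j, hfun d (fun v => T v i j)) ->
  forall t, hfun d (fun v => psi (p v) (S v) (T v) (q v) t : K).
Proof.
move=> hp hq hS hT t.
apply: (hfun_ext (f := fun v => psi_coef (p v) (S v) (T v) (q v)
  (tnth (val t) o0) (tnth (val t) o1) (tnth (val t) o2))) => [|v]; last by rewrite ffunE.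
rewrite /psi_coef; case: (incr_tripleP t) => [|a b c _|a b c _|]; rewrite ?split_l ?split_r //.
  exact: hfunZ.
exact: hfunZ.
Qed.

Lemma hfun_adj3 (M : V -> 'M[K]_3) : (forall i j, hfun 1 (fun v => M v i j)) ->
  forall i j, hfun 2 (fun v => \adj (M v) i j).
Proof.
move=> HM i j.
apply: (hfun_ext (f := fun v => M v (nx j) (nx i) * M v (nx (nx j)) (nx (nx i))
   + - (M v (nx j) (nx (nx i)) * M v (nx (nx j)) (nx i)))) => [|v]; last by rewrite adj3.
by apply: hfunD; [|apply: hfunN]; apply: (@hfunM _ _ 1 1).
Qed.

Lemma hfun_vA i j : hfun 1 (fun v : V => vA v i j).
Proof. exact: hfun_linform (@linform_vA K 3 i j). Qed.

Lemma hfun_vB i j : hfun 1 (fun v : V => vB v i j).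
Proof. exact: hfun_linform (@linform_vB K 3 i j). Qed.

(** Symmetrising makes this a linear map on the whole space; on [section3] both blocks are symmetric
    already. *)
Definition backV (w : W) : V := mkV (sympart (cS w)) (sympart (cT w)).

Lemma sympart_id (M : 'M[K]_3) : M^T = M -> sympart M = M.
Proof.
by move=> sM; rewrite /sympart sM -mulr2n -scaler_nat scalerA mulVf ?scale1r // pnatr_eq0.
Qed.

Lemma backV_psi (p : K) (S T : 'M[K]_3) (q : K) : S^T = S -> T^T = T -> backV (psi p S T q) = mkV S T.
Proof.
by move=> sS sT; have [_ eS eT _] := psi_coordK p S T q; rewrite /backV eS eT !sympart_id.
Qed.

Lemma backV_linear : linear backV.
Proof.
move=> a u v; rewrite /backV cSD cTD.
by apply: Vsym_eq; rewrite ?vAD ?vBD ?vAZ ?vBZ !(vA_mk, vB_mk) ?sympart_sym // sympartD.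
Qed.

Lemma psi_neq0 (p : K) (S T : 'M[K]_3) (q : K) : (S != 0) || (T != 0) -> psi p S T q != 0.
Proof.
move=> nz; apply/eqP => E; have [_ eS eT _] := psi_coordK p S T q.
have c0 : cS (0 : W) = 0 /\ cT (0 : W) = 0.
  by split; apply/matrixP => i j; rewrite !mxE !ffunE mulr0.
rewrite E in eS eT.
by move: nz; rewrite -eS -eT c0.1 c0.2 eqxx.
Qed.

Lemma vAB_neq0 (v : V) : v != 0 -> (vA v != 0) || (vB v != 0).
Proof.
apply: contraNT; rewrite negb_or !negbK => /andP[/eqP A0 /eqP B0].
by apply/eqP/Vsym_eq; rewrite ?A0 ?B0 ?vA0 ?vB0.
Qed.

Lemma mkV_neq0 (A B : 'M[K]_3) : A^T = A -> B^T = B -> (A != 0) || (B != 0) -> mkV A B != 0.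
Proof.
move=> sA sB; apply: contraTneq => E.
have := congr1 (@vA K 3) E; have := congr1 (@vB K 3) E.
by rewrite vA_mk ?vB_mk // vA0 vB0 => -> ->; rewrite eqxx.
Qed.

Definition section3 : set (proj W) := [set y | exists A B s,
  [/\ A^T = A, B^T = B, (A != 0) || (B != 0), Rel3 A B s & homog_coord y (psi s A B s)]].

Lemma section3_hyperplane : hyperplane_section (GrL K 3) section3.
Proof.
have [U spanU] := linear_span_ex (GrL K 3).
have [|l Hl] := @linear_hom K W K^o (fun w => w tripP - w tripQ).
  by move=> a u v; rewrite !ffunE scalerBr opprD addrACA.
have GrLE (P Q : 'M[K]_3) x : row_free (row_mx P Q) -> P *m Q^T = Q *m P^T ->
    homog_coord x (plucker (row_mx P Q)) -> GrL K 3 x.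
  by move=> fr /lagrangian_rowsP L xM; exists (row_mx P Q); split=> //; exact: L.
have fr10 : row_free (row_mx 1%:M 0 : 'M[K]_(3, 3 + 3)).
  by apply/row_freeP; exists (col_mx 1%:M 0); rewrite mul_row_col mul1mx mul0mx addr0.
pose w1 : W := plucker (row_mx 1%:M 0).
(* The Lagrangian subspace with [P = 1], [Q = 0] lies off the hyperplane, so the latter cuts the
   linear span in codimension exactly one. *)
have lw1 : l w1 = 1.
  rewrite Hl /w1 plucker_psi; have [-> _ _ ->] := psi_coordK (\det (1%:M : 'M[K]_3)) (\adj 1%:M *m 0) (\adj 0 *m 1%:M) (\det (0 : 'M[K]_3)).
  by rewrite det1 det0 subr0.
have w10 : w1 != 0 by apply: contra_eqN lw1 => /eqP ->; rewrite linear0 eq_sym oner_eq0.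
have w1U : w1 \in U.
  have : psubspace U (line w10).
    apply: spanU.1; apply: (GrLE 1%:M 0) => //; last exact: homog_coord_line.
    by rewrite trmx0 mulmx0 mul0mx.
  by rewrite memvE.
exists U, (U :&: lker l)%VS; split=> //; first exact: capvSl.
  rewrite -(limg_ker_dim l U) -addn1; congr (_ + _)%N.
  apply/eqP; rewrite eq_sym eqn_leq; apply/andP; split.
    by apply: leq_trans (dimvS (subvf _)) _; rewrite dimvf.
  rewrite lt0n dimv_eq0; apply: contraNneq (oner_neq0 K) => l0.
  have : l w1 \in (l @: U)%VS by exact: memv_img.
  by rewrite l0 memv0 lw1.
apply/seteqP; split=> y.
  move=> [A [B [s [sA sB nz R yw]]]].
  have [P [Q [a [a0 PQ dP S [T dQ]]]]] := lagr3_of_Rel3 sA sB nz R.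
  have plE : plucker (row_mx P Q) = a *: psi s A B s by rewrite plucker_psi dP dQ S T psi_scale.
  have yM : homog_coord y (plucker (row_mx P Q)) by rewrite plE; apply/(homog_coordZ _ _ a0).
  have Gy : GrL K 3 y by apply: (GrLE P Q) => //; apply: plucker_neq0; case: yM.
  split=> //; change (is_true (val y <= U :&: lker l)%VS).
  rewrite subv_cap; apply/andP; split; first exact: spanU.1 Gy.
  rewrite (homog_coordE yw) -memvE memv_ker Hl.
  by have [-> _ _ ->] := psi_coordK s A B s; rewrite subrr.
move=> [[M [frM LM yM]] yH].
pose P := lsubmx M; pose Q := rsubmx M; have ME : M = row_mx P Q by rewrite hsubmxK.
rewrite ME in frM LM yM; have PQ := (lagrangian_rowsP frM).1 LM.
have dPQ : \det P = \det Q.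
  have : plucker (row_mx P Q) \in lker l.
    have : (val y <= U :&: lker l)%VS by exact: yH.
    by rewrite (homog_coordE yM) -memvE memv_cap => /andP[].
  rewrite memv_ker Hl plucker_psi.
  have [-> _ _ ->] := psi_coordK (\det P) (\adj P *m Q) (\adj Q *m P) (\det Q).
  by rewrite subr_eq0 => /eqP.
have R := Rel3_of_lagr3 (erefl (\det P)) (esym dPQ).
exists (\adj P *m Q), (\adj Q *m P), (\det P); split=> //.
- exact: lagr3_sym.
- exact: lagr3_sym (esym PQ).
- apply: contraT; rewrite negb_or !negbK => /andP[/eqP S0 /eqP T0].
  case: yM => _; rewrite plucker_psi -dPQ S0 T0.
  have [_ _ ST] := R; move/matrixP/(_ o0 o0): ST; rewrite S0 mul0mx !mxE mulr1n.
  move/esym/eqP; rewrite mulf_eq0 orbb => /eqP ->.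
  case/eqP; apply/ffunP => t; rewrite !ffunE /psi_coef.
  by case: (incr_tripleP t) => [|a b c _|a b c _|]; rewrite ?split_l ?split_r // mxE mulr0.
- by move: yM; rewrite plucker_psi -dPQ.
Qed.

End HyperplaneSection.

(** * The isomorphism for m = 3 *)

Section Isomorphism.
Variable K : numClosedFieldType.
Local Notation W := (extpow K 3 (3 + 3)).
Local Notation V := (Vsym K 3).
Local Notation Zinv := (@Zinv K 3).

(** The value does not depend on the representative: [s] is unique for a nonzero pair and scales
    with it. Lines without such an [s] are sent to an arbitrary point. *)
Lemma embed_ex : exists f : proj V -> proj W, forall x v s, homog_coord x v ->
  Rel3 (vA v) (vB v) s -> homog_coord (f x) (psi s (vA v) (vB v) s).
Proof.
suff H x : exists y : proj W, forall v s, homog_coord x v ->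
    Rel3 (vA v) (vB v) s -> homog_coord y (psi s (vA v) (vB v) s).
  by have [f Hf] := choice H; exists f.
have [u xu] := homog_coord_ex x; have nz := vAB_neq0 xu.2.
have [[s R]|nR] := pselect (exists s, Rel3 (vA u) (vB u) s); last first.
  exists (line (psi_neq0 0 0 nz)) => v s xv R; case: nR.
  have [a a0 uE] := (homog_coordP _ xv).1 xu.
  by exists (a * s); rewrite uE vAZ vBZ; exact: Rel3_scale.
exists (line (psi_neq0 s s nz)) => v t xv R'.
have [a a0 vE] := (homog_coordP _ xu).1 xv.
have nz' := vAB_neq0 xv.2.
have ts : t = a * s.
  by apply: (Rel3_uniq nz' R'); rewrite vE vAZ vBZ; exact: Rel3_scale.
rewrite vE vAZ vBZ ts psi_scale; apply/(homog_coordZ _ _ a0).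
exact: homog_coord_line.
Qed.

Lemma project_ex : exists g : proj W -> proj V, forall y w, homog_coord y w ->
  backV w != 0 -> homog_coord (g y) (backV w).
Proof.
have [G HG] := linear_hom (@backV_linear K).
suff H y : exists x : proj V, forall w, homog_coord y w -> backV w != 0 ->
    homog_coord x (backV w).
  by have [g Hg] := choice H; exists g.
have [u yu] := homog_coord_ex y.
have [b0|b0] := eqVneq (backV u) 0.
  exists (line (mkV11_neq0 K (ltn0Sn 2))) => w yw; have [a a0 ->] := (homog_coordP _ yu).1 yw.
  by rewrite -HG linearZ /= HG b0 scaler0 eqxx.
exists (line b0) => w yw _; have [a a0 ->] := (homog_coordP _ yu).1 yw.
have -> : backV (a *: u) = a *: backV u by rewrite -!HG linearZ.
by apply/(homog_coordZ _ _ a0); exact: homog_coord_line.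
Qed.

Lemma Xinv3_isomorphic : isomorphic (Xinv_sym K 3) (@section3 K).
Proof.
have [f Hf] := embed_ex; have [g Hg] := project_ex.
have [G HG] := linear_hom (@backV_linear K).
have ZR x v : Xinv_sym K 3 x -> homog_coord x v -> exists s, Rel3 (vA v) (vB v) s.
  by move=> Xx xv; apply: Rel3_of_Zinv; apply/(XinvP xv).
have fX x v s : homog_coord x v -> Rel3 (vA v) (vB v) s -> @section3 K (f x) /\ g (f x) = x.
  move=> xv R; have fx := Hf _ _ _ xv R; split.
    exists (vA v), (vB v), s; rewrite vA_sym vB_sym; split=> //; exact: vAB_neq0 xv.2.
  have := Hg _ _ fx; rewrite backV_psi ?vA_sym ?vB_sym // mkV_eta => /(_ xv.2) gv.
  exact: homog_coord_inj gv xv.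
have gY A B s y : A^T = A -> B^T = B -> (A != 0) || (B != 0) ->
    homog_coord y (psi s A B s) -> homog_coord (g y) (mkV A B).
  move=> sA sB nz yw; have := Hg _ _ yw; rewrite backV_psi // => H.
  by apply: H; exact: mkV_neq0.
exists f, g; split.
- move=> x Xx; have [v0 xv0] := homog_coord_ex x.
  have chart (c : V -> 'M[K]_3) (a : V -> 'M[K]_3) k l :
      (forall i j, hfun 1 (fun v => c v i j)) -> (forall i j, hfun 2 (fun v => a v i j)) ->
      (forall v s, Rel3 (vA v) (vB v) s -> a v k l = s * c v k l) -> c v0 k l != 0 ->
      exists (D : set (proj V)) (d : nat)
        (F : 'I_(\dim {:W}) -> {mpoly K[\dim {:V}]}),
      [/\ pclosed D, ~ D x, (forall j, F j \is d.-homog)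
        & forall y v, Xinv_sym K 3 y -> ~ D y -> homog_coord y v ->
            homog_coord (f y) (polymap F v)].
    move=> hc ha ac c0.
    pose h v : W := psi (a v k l) (c v k l *: vA v) (c v k l *: vB v) (a v k l).
    have hh t : hfun 2 (fun v => h v t : K).
      apply: hfun_psi; [exact: ha | exact: ha | |] => i j.
        apply: (hfun_ext (hfunM (hc k l) (hfun_vA K i j))) => v; by rewrite mxE.
      apply: (hfun_ext (hfunM (hc k l) (hfun_vB K i j))) => v; by rewrite mxE.
    have [F Fh FE] := polymap_ex (fun i => hfun_extpow hh (linform_vcoord (V := W) i)).
    exists [set y | forall v, homog_coord y v -> c v k l = 0], 2%N, F; split=> //.
    + exact: pclosed_zero_locus (hc k l).
    + by move=> /(_ _ xv0)/eqP; rewrite (negPf c0).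
    move=> y v Xy nD yv; have [s R] := ZR _ _ Xy yv.
    have cv : c v k l != 0.
      apply/eqP => cv; case: nD => u /(homog_coordP _ yv)[b _ ->].
      have [p hp Hp] := hc k l.
      by rewrite -Hp (polyfunZ _ _ hp) Hp cv mulr0.
    rewrite FE /h (ac _ _ R) mulrC psi_scale; apply/(homog_coordZ _ _ cv).
    exact: Hf.
  have /orP[/matrix0Pn[k [l A0]]|/matrix0Pn[k [l B0]]] := vAB_neq0 xv0.2.
    apply: (chart (fun v => vA v) (fun v => \adj (vB v)) k l _ _ _ A0).
    + exact: hfun_vA.
    + exact: hfun_adj3 (@hfun_vB K).
    + by move=> v s [<- _ _]; rewrite mxE.
  apply: (chart (fun v => vB v) (fun v => \adj (vA v)) k l _ _ _ B0).
  + exact: hfun_vB.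
  + exact: hfun_adj3 (@hfun_vA K).
  + by move=> v s [_ <- _]; rewrite mxE.
- move=> y _.
  have hG i : hfun 1 (fun w : W => coord (vbasis {:V}) i (backV w)).
    by apply: hfun_linform => a u v; rewrite -!HG !linearP.
  have [F Fh FE] := polymap_ex hG.
  exists set0, 1%N, F; split=> //; first exact: pclosed0.
  move=> y' w [A [B [s [sA sB nz R yw']]]] _ yw; rewrite FE; apply: Hg => //.
  have [b b0 ->] := (homog_coordP _ yw').1 yw.
  rewrite -HG linearZ /= HG scaler_eq0 negb_or b0 backV_psi //.
  exact: mkV_neq0.
- move=> x Xx; have [v xv] := homog_coord_ex x; have [s R] := ZR _ _ Xx xv.
  exact: fX xv R.
- move=> y [A [B [s [sA sB nz R yw]]]]; have gy := gY _ _ _ _ sA sB nz yw.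
  split; first by apply/(XinvP gy); exact: Zinv_of_Rel3 R.
  have R' : Rel3 (vA (mkV A B)) (vB (mkV A B)) s by rewrite vA_mk ?vB_mk.
  have := Hf _ _ _ gy R'; rewrite vA_mk ?vB_mk // => fy.
  exact: homog_coord_inj fy yw.
Qed.

End Isomorphism.

Local Open Scope complex_scope.

Theorem theorem1p4 (R : realType) :
  (forall m : nat, (2 <= m)%N ->
     legendrian (omega_sym R[i] m) (Xinv_sym R[i] m)) /\
  (exists U : {vspace Vsym R[i] 2}, Xinv_sym R[i] 2 = psubspace U) /\
  (psmooth (Xinv_sym R[i] 3) /\
   exists Y : set (proj (extpow R[i] 3 (3 + 3))),
     hyperplane_section (GrL R[i] 3) Y /\
     isomorphic (Xinv_sym R[i] 3) Y) /\
  (psmooth (Xinv_sym R[i] 4) /\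
   has_pdim (Xinv_sym R[i] 4) 9 /\
   proj_equivalent (Gr R[i] 3 6) (Xinv_sym R[i] 4)) /\
  (forall m : nat, (5 <= m)%N -> psingular (Xinv_sym R[i] m)).
Proof.
split; first by case=> [//|n] _; exact: Xinv_legendrian.
split; first exact: Xinv2_linear.
split.
  split; first exact: psmooth3.
  by exists (@section3 R[i]); split; [exact: section3_hyperplane | exact: Xinv3_isomorphic].
split; last exact: Xinv_singular.
split; first exact: psmooth4.
by split; [exact: Xinv4_dim | exact: Xinv4_equivalent].
Qed.
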